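(* Let $N=1$. If $(\alpha,\beta)\in(-\infty,\lambda_2(p)]\times(-\infty,\lambda_2(q)]$, then the problem $(GEV;\alpha,\beta)$, i.e. $-\Delta_p u-\Delta_q u=\alpha|u|^{p-2}u+\beta|u|^{q-2}u$ in $\Omega$, $u=0$ on $\partial\Omega$, has no nodal solutions.
   Context: Standing assumptions: $\Omega\subset\mathbb{R}^N$ is a bounded domain (for $N=1$: a bounded open interval); $1<q<p<+\infty$; $\alpha,\beta\in\mathbb{R}$. $\Delta_r u=\mathrm{div}(|\nabla u|^{r-2}\nabla u)$ (for $N=1$, $(|u'|^{r-2}u')'$). $\|\cdot\|_r$ is the norm of $L^r(\Omega)$, $W_0^{1,r}=W_0^{1,r}(\Omega)$ has norm $\|\nabla u\|_r$, and $u^\pm:=\max\{\pm u,0\}$, so $u=u^+-u^-$. A (weak) solution of $(GEV;\alpha,\beta)$ is a function $u\in W_0^{1,p}$ such that for all $\varphi\in W_0^{1,p}$ $$\int_\Omega|\nabla u|^{p-2}\nabla u\cdot\nabla\varphi\,dx+\int_\Omega|\nabla u|^{q-2}\nabla u\cdot\nabla\varphi\,dx=\alpha\int_\Omega|u|^{p-2}u\varphi\,dx+\beta\int_\Omega|u|^{q-2}u\varphi\,dx.$$ A solution $u$ is called nodal (sign-changing) if $u^+\not\equiv0$ and $u^-\not\equiv 0$ a.e. in $\Omega$. For $r>1$, $\lambda$ is an eigenvalue of $-\Delta_r$ if $-\Delta_r u=\lambda|u|^{r-2}u$ in $\Omega$, $u=0$ on $\partial\Omega$ has a nontrivial weak solution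 in $W_0^{1,r}$; $\sigma(-\Delta_r)$ is the set of all eigenvalues. $\lambda_1(r)=\inf\{\|\nabla u\|_r^r/\|u\|_r^r: u\in W_0^{1,r}\setminus\{0\}\}$ is the first eigenvalue and $\lambda_2(r)=\inf\{\lambda\in\sigma(-\Delta_r):\lambda>\lambda_1(r)\}$ is the second eigenvalue. *)

(* Defs.v *)
From HB Require Import structures.
From mathcomp Require Import all_boot all_order all_algebra.
From mathcomp Require Import all_classical all_reals all_analysis.

Set Implicit Arguments.
Unset Strict Implicit.
Unset Printing Implicit Defensive.

Import Order.TTheory GRing.Theory Num.Theory.
Import numFieldNormedType.Exports.

Local Open Scope classical_set_scope.
Local Open Scope ring_scope.

(* Elements of L^r(Omega) are represented by functions on the whole line whose
   values outside Omega are irrelevant: they are cut off by [f \_ Omega] (zero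
   outside Omega), or only integrated over Omega. *)

Definition memL (R : realType) (Omega : set R) (r : R) (f : R -> R) : Prop :=
  (f \_ Omega : R -> R) \in Lfun (@lebesgue_measure R) r%:E.

Definition normL (R : realType) (Omega : set R) (r : R) (f : R -> R) : \bar R :=
  'N[@lebesgue_measure R]_r%:E [EFin \o (f \_ Omega)]%E.

Definition ae_zero (R : realType) (Omega : set R) (f : R -> R) : Prop :=
  ae_eq (@lebesgue_measure R) Omega f (cst 0).

(* C_c^oo(Omega) *)
Definition test_function (R : realType) (Omega : set R) (f : R -> R) : Prop :=
  [/\ forall (n : nat) (x : R), derivable (f^`(n))%classic x 1,
      compact (closure [set x | f x != 0]) &
      closure [set x | f x != 0] `<=` Omega].

Definition weak_derivative (R : realType) (Omega : set R) (u du : R -> R) :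
    Prop :=
  forall f : R -> R, test_function Omega f ->
    \int[@lebesgue_measure R]_(x in Omega) (u x * (f^`())%classic x) =
    - \int[@lebesgue_measure R]_(x in Omega) (du x * f x).

(* Sobolev functions are handled together with a representative [du] of their
   weak derivative, which is unique almost everywhere. *)
Definition W1 (R : realType) (Omega : set R) (r : R) (u du : R -> R) : Prop :=
  [/\ memL Omega r u, memL Omega r du & weak_derivative Omega u du].

(* W_0^{1,r}(Omega): the closure of C_c^oo(Omega) in W^{1,r}(Omega). *)
Definition W10 (R : realType) (Omega : set R) (r : R) (u du : R -> R) : Prop :=
  W1 Omega r u du /\
  exists f : nat -> R -> R,
    [/\ forall n, test_function Omega (f n),
        normL Omega r (f n \- u) @[n --> \oo] --> 0%E &
        normL Omega r (((f n)^`())%classic \- du) @[n --> \oo] --> 0%E].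

(* |s|^(r-2) s.  At s = 0 this is 0 also when r < 2, because of the factor s. *)
Definition spow (R : realType) (r s : R) : R := `|s| `^ (r - 2) * s.

Definition eigenvalue_of (R : realType) (Omega : set R) (r lambda : R) : Prop :=
  exists u du : R -> R,
    [/\ W10 Omega r u du, ~ ae_zero Omega u &
        forall f df : R -> R, W10 Omega r f df ->
          \int[@lebesgue_measure R]_(x in Omega) (spow r (du x) * df x) =
          lambda *
          \int[@lebesgue_measure R]_(x in Omega) (spow r (u x) * f x)].

Definition spectrum (R : realType) (Omega : set R) (r : R) : set R :=
  [set lambda | eigenvalue_of Omega r lambda].

Definition lambda1 (R : realType) (Omega : set R) (r : R) : R :=
  inf [set t | exists u du : R -> R,
    [/\ W10 Omega r u du, ~ ae_zero Omega u &
        t = fine (normL Omega r du) `^ r / fine (normL Omega r u) `^ r]].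

Definition lambda2 (R : realType) (Omega : set R) (r : R) : R :=
  inf [set lambda | spectrum Omega r lambda /\ lambda1 Omega r < lambda].

Definition GEV_solution (R : realType) (Omega : set R) (p q alpha beta : R)
    (u : R -> R) : Prop :=
  exists2 du : R -> R, W10 Omega p u du &
    forall f df : R -> R, W10 Omega p f df ->
      \int[@lebesgue_measure R]_(x in Omega) (spow p (du x) * df x) +
      \int[@lebesgue_measure R]_(x in Omega) (spow q (du x) * df x) =
      alpha * \int[@lebesgue_measure R]_(x in Omega) (spow p (u x) * f x) +
      beta * \int[@lebesgue_measure R]_(x in Omega) (spow q (u x) * f x).

Definition nodal (R : realType) (Omega : set R) (u : R -> R) : Prop :=
  ~ ae_zero Omega (u^\+) /\ ~ ae_zero Omega (u^\-).

(* Main.v *)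
Require Import Defs.
From mathcomp Require Import all_boot all_order all_algebra.
From mathcomp Require Import all_classical all_reals all_analysis.
From mathcomp Require Import measurable_realfun.
From mathcomp Require Import ring lra.
Import Order.TTheory GRing.Theory Num.Theory.
Import numFieldNormedType.Exports.
Local Open Scope classical_set_scope.
Local Open Scope ring_scope.

(** Testing the equation with test functions only, the lemma of du Bois-Reymond
    shows that a solution [u] is C^1 and that [|u'|^(p-2) u' + |u'|^(q-2) u']
    is C^1, so the equation holds pointwise.  A nodal solution is positive on
    some interval and negative on another; the shorter of these, say ]c, d[
    with [u > 0], has length at most half of that of the domain.

    For [r] in {[p], [q]}, let [A_r] be the logarithmic derivative of a first
    eigenfunction of the [r]-Laplacian on an interval of half the length of the
    domain containing ]c, d[.  It solves the Riccati equation
    [(|A|^(r-2) A)' = - lam_r - (r - 1) |A|^r], and [lambda2 r <= lam_r]: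
    gluing that eigenfunction to minus its translate yields an eigenfunction on
    the whole domain, while the first eigenvalue of the domain is less than
    [lam_r] by rescaling.  Picone's inequality then says that
    [Z = (|u'|^(p-2) u' + |u'|^(q-2) u') u - |A_p|^(p-2) A_p u^p
         - |A_q|^(q-2) A_q u^q]
    is nondecreasing on ]c, d[.  Since [Z] vanishes at both endpoints, there is
    equality in Picone's inequality for both exponents, i.e.
    [u' = A_p u = A_q u].  So [A_p = A_q], and comparing the two Riccati
    equations this function would be locally constant, which it is not. *)

Set Implicit Arguments.
Unset Strict Implicit.
Unset Printing Implicit Defensive.


(** * Signed powers and one-variable calculus *)

(** The delicate points are the ends of the nodal interval, where [A_r] may blow up. A Riccati
    solution stays below the inverse of the distance to its blow-up point, while [u], being C^1, is
    at most a constant times the distance to its zero. Hence |A_r|^(r-1) u^r is of the order of that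
    distance, which is why [Z] vanishes at the ends and why two explicit bounds on the slope are
    part of [log_slope].

    Picone's inequality is stated with slopes instead of eigenfunctions because every term of [Z]
    then contains [u] alone, and Z' is a sum of gaps in the strict convexity of |t|^r plus terms
    whose sign is given by [alpha <= lam_p] and [beta <= lam_q].

    The slopes have no closed form. They come from an autonomous equation for B = - |A|^(r-2) A,
    solved by inverting its time map; a conserved energy then gives the eigenfunction.

    The definitions force membership in W_0^{1,r} to be shown with explicit smooth functions. All
    approximations are made in L^1; together with uniform bounds this gives convergence for every
    exponent at once. *)

Section SignedPower.
Context {R : realType}.
Implicit Types r s t x y : R.

Lemma spowN r s : spow r (- s) = - spow r s.
Proof. by rewrite /spow normrN mulrN. Qed.

Lemma spow0 r : spow r 0 = 0 :> R.
Proof. by rewrite /spow mulr0. Qed.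

Lemma spow_ge0E r s : 1 < r -> 0 <= s -> spow r s = s `^ (r - 1).
Proof.
move=> r1; rewrite le_eqVlt => /predU1P[<-|s0].
  by rewrite spow0 powR0// gt_eqF// subr_gt0.
rewrite /spow gtr0_norm// -[X in _ * X](powRr1 (ltW s0)) -powRD.
  by congr (_ `^ _); ring.
by rewrite (gt_eqF s0) implybT.
Qed.

Lemma spow_gt0 r s : 1 < r -> 0 < s -> 0 < spow r s.
Proof. by move=> r1 s0; rewrite spow_ge0E ?ltW// powR_gt0. Qed.

Lemma spow_mulr r s : 1 < r -> spow r s * s = `|s| `^ r.
Proof.
move=> r1; have [->|s0] := eqVneq s 0.
  by rewrite mulr0 normr0 powR0// gt_eqF// (lt_trans ltr01).
rewrite /spow -mulrA -expr2 -real_normK ?num_real// -powR_mulrn// -powRD.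
  by congr (_ `^ _); ring.
by rewrite normr_eq0 s0 implybT.
Qed.

Lemma normr_spow r s : 1 < r -> `|spow r s| = `|s| `^ (r - 1).
Proof.
move=> r1; have [s0|s0] := leP 0 s.
  by rewrite spow_ge0E// !ger0_norm// powR_ge0.
have -> : spow r s = - spow r (- s) by rewrite spowN opprK.
rewrite normrN (ltr0_norm s0) spow_ge0E ?oppr_ge0 ?ltW//.
by rewrite ger0_norm ?powR_ge0.
Qed.

Lemma spow_lt r : 1 < r -> {homo spow r : x y / x < y}.
Proof.
move=> r1; have r0 : 0 < r - 1 by rewrite subr_gt0.
have pos x y : 0 <= x -> x < y -> spow r x < spow r y.
  move=> x0 xy; rewrite !spow_ge0E// ?(ltW (le_lt_trans x0 xy))//.
  by rewrite gt0_ltr_powR// nnegrE// ltW// (le_lt_trans x0 xy).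
move=> x y xy; have [x0|x0] := leP 0 x; first exact: pos.
have [y0|y0] := leP y 0.
  rewrite -ltrN2 -!spowN; apply: pos; first by rewrite oppr_ge0.
  by rewrite ltrN2.
apply: (@lt_trans _ _ 0); last exact: spow_gt0.
by rewrite -oppr_gt0 -spowN spow_gt0// oppr_gt0.
Qed.

Lemma spowK r r' : 1 < r -> (r - 1) * (r' - 1) = 1 -> cancel (spow r) (spow r').
Proof.
move=> r1 rr'; have r0 : 0 < r - 1 by rewrite subr_gt0.
have r'1 : 1 < r' by rewrite -subr_gt0 -(pmulr_rgt0 _ r0) rr'.
have pos s : 0 <= s -> spow r' (spow r s) = s.
  move=> s0; rewrite [X in spow r' X]spow_ge0E// spow_ge0E ?powR_ge0//.
  by rewrite -powRrM rr' powRr1.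
move=> s; have [s0|s0] := leP 0 s; first exact: pos.
by apply: oppr_inj; rewrite -!spowN pos// oppr_ge0 ltW.
Qed.

(** Monotonicity of [f] alone is enough: [g z] lies within [e] of [g y] as soon as [z] lies between
    [f (g y - e)] and [f (g y + e)]. This serves both for [spow] and for the inverse of
    [spow p + spow q]. *)
Lemma increasing_can_continuous (f g : R -> R) :
  {homo f : x y / x < y} -> cancel g f -> continuous g.
Proof.
move=> inc gfK y.
have inc' : {mono f : x y / x < y} by apply: leW_mono; exact: le_mono.
apply/cvgrPdist_lt => e e0 /=.
near=> z; rewrite distrC real_ltr_distl ?num_real//.
rewrite -(inc' _ (g z)) -(inc' (g z)) gfK; apply/andP; split; near: z.
- apply: lt_nbhsr; rewrite -[X in _ < X](gfK y) inc'; lra.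
- apply: lt_nbhsl; rewrite -[X in X < _](gfK y) inc'; lra.
Unshelve. all: by end_near. Qed.

(** [spow r] is the inverse of [spow r'] for the conjugate exponent, so continuity follows from
    monotonicity, without treating apart the point 0, where the exponent [r - 2] may be negative. *)
Lemma continuous_spow r : 1 < r -> continuous (spow r : R -> R).
Proof.
move=> r1; have r0 : 0 < r - 1 by rewrite subr_gt0.
pose r' : R := 1 + (r - 1)^-1.
have r'1 : 1 < r' by rewrite ltrDl invr_gt0.
have rr' : (r' - 1) * (r - 1) = 1.
  by rewrite /r' addrAC subrr add0r mulVf// gt_eqF.
apply: (@increasing_can_continuous (spow r') (spow r)); first exact: spow_lt.
by apply: spowK; rewrite // mulrC.
Qed.

Lemma continuous_normr_powR r : 0 < r -> continuous (fun s : R => `|s| `^ r).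
Proof.
move=> r0 s; have -> : (fun s : R => `|s| `^ r) = (fun s => `|spow (r + 1) s|).
  by apply/funext => x; rewrite normr_spow; [congr (_ `^ _); ring|lra].
apply: continuous_comp; last exact: norm_continuous.
by apply: continuous_spow; lra.
Qed.

Lemma is_derive_powR_normr r s : 1 < r ->
  is_derive s 1 (fun s : R => `|s| `^ r) (r * spow r s).
Proof.
move=> r1; have [->|s0] := eqVneq s 0; last first.
- have ab : \forall x \near s, `|x| `^ r = (Num.sg s * x) `^ r.
    have [s1|s1] := ltP 0 s.
      near=> x; rewrite gtr0_sg// mul1r gtr0_norm//.
      by near: x; exact: lt_nbhsr.
    have {}s1 : s < 0 by rewrite lt_neqAle s0.
    near=> x; rewrite ltr0_sg// mulN1r ltr0_norm//.
    by near: x; exact: lt_nbhsl.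
  apply: (@near_eq_is_derive _ _ _ (fun x => (Num.sg s * x) `^ r)).
    by near=> x; apply/esym; near: x; exact: ab.
  have sgs : 0 < Num.sg s * s by rewrite -normrEsg normr_gt0.
  have D1 : is_derive s 1 (fun x : R => Num.sg s * x) (Num.sg s).
    by apply: is_derive_eq; rewrite /GRing.scale/= mulr1.
  have D2 := is_derive1_powR r sgs.
  have := @is_derive1_comp _ (fun x => x `^ r) _ _ _ _ D2 D1.
  rewrite /GRing.scale/= => D3.
  apply: (is_derive_eq D3); rewrite -mulrA; congr (_ * _).
  rewrite -normrEsg; have [s1|s1] := ltP 0 s.
    by rewrite gtr0_sg// mulr1 spow_ge0E ?ltW// gtr0_norm.
  have {}s1 : s < 0 by rewrite lt_neqAle s0.
  rewrite ltr0_sg// mulrN1 -[s in RHS]opprK spowN; congr (- _).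
  by rewrite spow_ge0E ?oppr_ge0 ?ltW// ltr0_norm.
(* At 0 the difference quotient of |z|^r is [spow r z] itself, which is continuous and vanishes at
   0. *)
apply/is_derive1_caratheodory; exists (spow r); split; last first.
- by rewrite spow0 mulr0.
- exact: continuous_spow.
- move=> z; rewrite normr0 powR0 ?gt_eqF ?(lt_trans ltr01)// !subr0.
  by rewrite spow_mulr.
Unshelve. all: by end_near. Qed.

End SignedPower.

(** * Mean value theorem and antiderivatives on the whole line *)

Section Calculus.
Context {R : realType}.
Notation mu := (@lebesgue_measure R).
Implicit Types (f g F : R -> R) (x y z : R).

Lemma is_derive_continuous f x (df : R) : is_derive x 1 f df -> {for x, continuous f}.
Proof. by move=> [fx _]; apply/differentiable_continuous/derivable1_diffP. Qed.

Lemma mean_value f df x y : x < y ->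
  (forall z, x <= z <= y -> is_derive z 1 f (df z)) ->
  exists2 z, x < z < y & f y - f x = df z * (y - x).
Proof.
move=> xy fdf.
have dxy z : z \in `]x, y[ -> is_derive z 1 f (df z).
  by rewrite in_itv/= => /andP[xz zy]; apply: fdf; rewrite !ltW.
have [|z] := MVT xy dxy; last by rewrite in_itv; exists z.
apply: continuous_in_subspaceT => z /[!inE]/=; rewrite in_itv/= => zxy.
exact: is_derive_continuous (fdf _ zxy).
Qed.

Lemma is_derive_ge0_le f df x y : x <= y ->
  (forall z, x <= z <= y -> is_derive z 1 f (df z)) ->
  (forall z, x <= z <= y -> 0 <= df z) -> f x <= f y.
Proof.
rewrite le_eqVlt => /predU1P[->//|xy] fdf df0.
have [z /andP[xz zy] E] := mean_value xy fdf.
by rewrite -subr_ge0 E mulr_ge0 ?subr_ge0 ?(ltW xy)// df0// !ltW.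
Qed.

Lemma is_derive_gt0_lt f df x y : x < y ->
  (forall z, x <= z <= y -> is_derive z 1 f (df z)) ->
  (forall z, x <= z <= y -> 0 < df z) -> f x < f y.
Proof.
move=> xy fdf df0; have [z /andP[xz zy] E] := mean_value xy fdf.
by rewrite -subr_gt0 E mulr_gt0 ?subr_gt0// df0// !ltW.
Qed.

Lemma continuous_integrable_itv f a b : continuous f ->
  mu.-integrable `[a, b] (EFin \o f).
Proof.
move=> cf; apply: continuous_compact_integrable; first exact: segment_compact.
exact: continuous_subspaceT.
Qed.

Lemma Rintegral_itv_split f a x y : a <= x -> x <= y ->
  mu.-integrable `[a, y] (EFin \o f) ->
  \int[mu]_(t in `[a, y]) f t =
  \int[mu]_(t in `[a, x]) f t + \int[mu]_(t in `[x, y]) f t.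
Proof.
move=> ax xy fi; rewrite -(@Rintegral_itv_obnd_cbnd _ x); last first.
  apply: integrableS fi => //; apply: subset_itv; rewrite bnd_simp//.
by rewrite -(@Rintegral_itvB _ f (BLeft a) (BRight y) x)// ?bnd_simp// addrC subrK.
Qed.

Lemma antiderivative f : continuous f ->
  exists F, forall x, is_derive x 1 F (f x).
Proof.
move=> cf; pose I a x := \int[mu]_(t in `[a, x]) f t - \int[mu]_(t in `[a, 0]) f t.
(* The base point moves with [x] so as to stay to the left of both [x] and 0; subtracting the
   integral up to 0 makes the value independent of it ([Ichange]). *)
pose F x := I (- (`|x| + 1)) x.
have Ichange a a' x : a <= a' -> a' <= x -> a' <= 0 -> I a x = I a' x.
  move=> aa' a'x a'0; rewrite /I.
  rewrite (@Rintegral_itv_split _ a a' x)//; last exact: continuous_integrable_itv.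
  rewrite (@Rintegral_itv_split _ a a' 0)//; last exact: continuous_integrable_itv.
  by ring.
(* One base point lying to the left of those used by [F] on the whole unit ball around [x]. *)
exists F => x; pose a : R := - (`|x| + 2).
have nx := ler_norm x; have nNx := ler_norm (- x); rewrite normrN in nNx.
have xa : a < x by rewrite /a; lra.
have nearF (y : R) : ball x 1 y -> I a y = F y.
  rewrite -ball_normE/= => xy; have : `|y| < `|x| + 1.
    rewrite -(subrK x y) (le_lt_trans (ler_normD _ _))// distrC.
    by rewrite addrC ltrD2l.
  move=> y1; have := ler_norm (- y); rewrite normrN => ny; have y0 := normr_ge0 y.
  by rewrite /F; apply: Ichange; rewrite /a; lra.
apply: near_eq_is_derive (filterS nearF (nbhsx_ballx x 1 ltr01)) _.
have D : is_derive x 1 (fun y => \int[mu]_(t in `[a, y]) f t) (f x).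
  have xx1 : x < x + 1 by rewrite ltrDl.
  have := continuous_FTC1_closed xx1 (continuous_integrable_itv a (x + 1) cf) xa (cf x).
  case.
  by rewrite derive1E => D <-; exact: derivableP.
have := is_deriveB D (is_derive_cst (\int[mu]_(t in `[a, 0]) f t) x 1).
by rewrite subr0.
Qed.
End Calculus.

(** * One-dimensional eigenfunctions *)

Section RiccatiSolution.
Context {R : realType}.
Variables (r r' : R).
Hypothesis r1 : 1 < r.
Hypothesis rr' : (r - 1) * (r' - 1) = 1.
Implicit Types (s t x y z w : R).

Let r0 : 0 < r - 1. Proof. by rewrite subr_gt0. Qed.
Let r'0 : 0 < r' - 1. Proof. by rewrite -(pmulr_rgt0 _ r0) rr'. Qed.
Let r'1 : 1 < r'. Proof. by rewrite -subr_gt0. Qed.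
Let r'E : r' - 1 = (r - 1)^-1.
Proof. by apply: (mulfI (lt0r_neq0 r0)); rewrite rr' divff ?gt_eqF. Qed.

(** With B = - |A|^(r-2) A one has |A|^r = |B|^r', so the Riccati equation with eigenvalue 1 becomes
    the autonomous equation B' = g(B). *)
Let g s : R := 1 + (r - 1) * `|s| `^ r'.

Let g_gt0 s : 0 < g s.
Proof. by rewrite ltr_pwDl// mulr_ge0 ?powR_ge0// ltW. Qed.

Let continuous_gV : continuous (fun s => (g s)^-1).
Proof.
move=> s; apply: continuousV; first by rewrite gt_eqF.
apply: continuousD; first exact: cst_continuous.
apply: continuousM; first exact: cst_continuous.
by apply: continuous_normr_powR; rewrite (lt_trans ltr01).
Qed.

Section Tail.
Variable F : R -> R.
Hypothesis dF : forall s, is_derive s 1 F (g s)^-1.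

(* [(g s)^-1] is dominated by [s^(-r') / (r - 1)], the derivative of
   [- s^(1 - r')]. *)
Lemma riccati_tail x y : 0 < x -> x <= y -> F y <= F x + (x `^ (r' - 1))^-1.
Proof.
move=> x0 xy; pose K s := - F s - s `^ (1 - r').
have dK s : x <= s <= y ->
    is_derive s 1 K (- (g s)^-1 - (1 - r') * s `^ (1 - r' - 1)).
  move=> /andP[xs _]; have s0 : 0 < s := lt_le_trans x0 xs.
  exact: is_deriveB (is_deriveN (dF s)) (is_derive1_powR _ s0).
have : K x <= K y.
  apply: (is_derive_ge0_le xy dK) => s /andP[xs _].
  have s0 : 0 < s := lt_le_trans x0 xs.
  rewrite -(opprB r') mulNr opprK addrC subr_ge0.
  rewrite (_ : - (r' - 1) - 1 = - r'); last by ring.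
  rewrite powRN r'E -invfM lef_pV2 ?posrE ?mulr_gt0 ?powR_gt0//.
  by rewrite /g gtr0_norm// lerDr.
rewrite /K -(opprB r') !powRN.
have : 0 <= (y `^ (r' - 1))^-1 by rewrite invr_ge0 powR_ge0.
lra.
Qed.

End Tail.

(** Separation of variables: [B] inverts the time map [F], an antiderivative of 1/g. By
    [riccati_tail] the range of [F] is bounded, and [T1], [T2] are its infimum and supremum, so [B]
    runs through all of R in finite time. The same tail estimate bounds the remaining time by
    |B|^(1-r'), which is the pair of bounds at the end. *)
Lemma riccati_inverse : exists (T1 T2 : R) (B : R -> R), [/\ T1 < T2,
  forall t, T1 < t < T2 -> is_derive t 1 B (g (B t)),
  forall y, exists2 t, T1 < t < T2 & B t = y,
  forall t, T1 < t < T2 -> B t < 0 -> `|B t| `^ (r' - 1) <= (t - T1)^-1 &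
  forall t, T1 < t < T2 -> 0 < B t -> `|B t| `^ (r' - 1) <= (T2 - t)^-1].
Proof.
have [F dF] := antiderivative continuous_gV.
have cF s : {for s, continuous F} := is_derive_continuous (dF s).
have incF x y : x < y -> F x < F y.
  by move=> xy; apply: (is_derive_gt0_lt xy (fun z _ => dF z)) => z _; rewrite invr_gt0.
have FI : injective F.
  by move=> x y Fxy; case: (ltgtP x y) => // /incF; rewrite Fxy ltxx.
have lub x y : 0 < x -> F y <= F x + (x `^ (r' - 1))^-1.
  move=> x0; have [xy|yx] := leP x y; first exact: riccati_tail.
  by rewrite (le_trans (ltW (incF _ _ yx)))// lerDl invr_ge0 powR_ge0.
have glb x y : x < 0 -> F x - (`|x| `^ (r' - 1))^-1 <= F y.
  move=> x0; have [yx|xy] := leP y x; last first.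
    by rewrite (le_trans _ (ltW (incF _ _ xy)))// gerBl invr_ge0 powR_ge0.
  pose F' s := - F (- s).
  have dF' s : is_derive s 1 F' (g s)^-1.
    have := is_deriveN (is_derive1_comp (f := F) (g := -%R) (dF (- s)) (is_deriveNid s 1)).
    by rewrite /g normrN /GRing.scale/= mulrN1 opprK.
  have := @riccati_tail F' dF' (- x) (- y).
  by rewrite /F' !opprK oppr_gt0 lerN2 (ltr0_norm x0) => /(_ x0 yx); lra.
have supF : has_sup (range F).
  split; first by exists (F 0), 0.
  by exists (F 1 + (1 `^ (r' - 1))^-1) => _ [y _ <-]; exact: lub.
have infF : has_inf (range F).
  split; first by exists (F 0), 0.
  by exists (F (-1) - (`|-1| `^ (r' - 1))^-1) => _ [y _ <-]; exact: glb.
pose T1 := inf (range F); pose T2 := sup (range F).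
have FT1 s : T1 < F s.
  apply: le_lt_trans (incF (s - 1) s _); last by lra.
  by apply: ge_inf; [case: infF|exists (s - 1)].
have FT2 s : F s < T2.
  apply: lt_le_trans (incF s (s + 1) _) _; first by lra.
  by apply: ub_le_sup; [case: supF|exists (s + 1)].
have onto t : T1 < t < T2 -> exists s, F s = t.
  move=> /andP[tT1 tT2].
  have [_ [y1 _ <-] y1t] := inf_lt infF.1 tT1.
  have [_ [y2 _ <-] y2t] := sup_gt supF.1 tT2.
  have y12 : y1 <= y2.
    rewrite leNgt; apply/negP => /incF; rewrite ltNge.
    by rewrite (ltW (lt_trans y1t y2t)).
  have [||c _ Fc] := @IVT _ F y1 y2 t y12; last by exists c.
    exact: continuous_subspaceT.
  by rewrite ge_min le_max (ltW y1t) (ltW y2t) orbT.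
pose B t : R := if pselect (exists s, F s = t) is left p then sval (cid p) else 0.
have FB t : T1 < t < T2 -> F (B t) = t.
  by move=> /onto e; rewrite /B; case: pselect => // p; case: cid.
have BF s : B (F s) = s by apply: FI; rewrite FB// FT1 FT2.
exists T1, T2, B; split.
- exact: lt_trans (FT1 0) (FT2 0).
- move=> t /FB tE.
  have : is_derive (F (B t)) 1 B ((g (B t))^-1)^-1.
    apply: (@is_derive_inverse _ F B (g (B t))^-1 (B t)).
    - by near=> s; exact: BF.
    - by near=> s; exact: cF.
    - by rewrite invr_neq0// gt_eqF.
  by rewrite tE invrK.
- by move=> y; exists (F y); rewrite ?FT1 ?FT2.
- move=> t /[dup] /FB {1 2 5}<- /andP[T1t _] Bt0.
  have BP : 0 < `|B t| `^ (r' - 1) by rewrite powR_gt0// normr_gt0 lt_eqF.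
  rewrite -[leLHS]invrK lef_pV2 ?posrE ?invr_gt0// ?subr_gt0//.
  rewrite lerBlDr -lerBlDl; apply: lb_le_inf; first by case: infF.
  by move=> _ [y _ <-]; exact: glb.
- move=> t /[dup] /FB {1 2 5}<- /andP[_ tT2] Bt0.
  have BP : 0 < `|B t| `^ (r' - 1) by rewrite powR_gt0// normr_gt0 gt_eqF.
  rewrite -[leLHS]invrK lef_pV2 ?posrE ?invr_gt0// ?subr_gt0//.
  rewrite lerBlDl; apply: ge_sup; first by case: supF.
  by move=> _ [y _ <-]; rewrite gtr0_norm//; exact: lub.
Unshelve. all: by end_near. Qed.

End RiccatiSolution.

(** * Eigenfunctions on an interval and their rescaling *)

Section Arc.
Context {R : realType}.
Implicit Types (r s t x y z w c d lam k : R) (A phi g B : R -> R).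

(* [A] is the logarithmic derivative of a positive solution of
   [- (|v'|^(r-2) v')' = lam v^(r-1)] on ]c, d[ vanishing at [c] and [d]. *)
Definition log_slope r lam c d A : Prop :=
  (forall x, c < x < d ->
     is_derive x 1 (fun y => spow r (A y)) (- (lam + (r - 1) * `|A x| `^ r))) /\
  (forall x, c < x < d -> - (d - x)^-1 <= A x <= (x - c)^-1).

(** [phi] is a positive eigenfunction extended by 0, and [g] is its derivative inside the interval,
    continued continuously to the line. The condition [g d = - g c] records the symmetry that lets
    an arc be glued to minus its translate without a jump of the derivative. *)
Definition eigen_arc r lam c d phi g : Prop :=
  [/\ continuous phi, continuous g,
      forall x, c < x < d -> 0 < phi x,
      forall x, ~~ (c < x < d) -> phi x = 0 &
      g d = - g c] /\
  forall x, c < x < d -> is_derive x 1 phi (g x) /\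
     is_derive x 1 (fun y => spow r (g y)) (- (lam * phi x `^ (r - 1))).

Lemma powR_normM r x y : `|x * y| `^ r = `|x| `^ r * `|y| `^ r.
Proof. by rewrite normrM powRM. Qed.

Lemma spow_gt0M r k s : 1 < r -> 0 < k -> spow r (k * s) = k `^ (r - 1) * spow r s.
Proof.
move=> r1 k0; rewrite /spow normrM (gtr0_norm k0) powRM ?(ltW k0)//.
rewrite mulrACA; congr (_ * _); rewrite -[X in _ * X = _](powRr1 (ltW k0)) -powRD.
  by congr (_ `^ _); ring.
by rewrite (gt_eqF k0) implybT.
Qed.

Lemma is_derive_affine (f : R -> R) (df : R) k x c y : is_derive (c + k * (x - y)) 1 f df ->
  is_derive x 1 (fun z => f (c + k * (z - y))) (k * df).
Proof.
move=> D; have D1 : is_derive x 1 (fun z => c + k * (z - y)) k.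
  have := is_deriveD (is_derive_cst c x 1)
    (is_deriveZ k (is_deriveB (is_derive_id x 1) (is_derive_cst y x 1))).
  by rewrite subr0 add0r /GRing.scale/= mulr1.
by have := is_derive1_comp (g := fun z => c + k * (z - y)) D D1; rewrite mulrC.
Qed.

Lemma is_derive_powR_comp (f : R -> R) (df : R) x r : 0 < f x -> is_derive x 1 f df ->
  is_derive x 1 (fun y => f y `^ r) (r * f x `^ (r - 1) * df).
Proof.
move=> fx0 D.
exact: (is_derive1_comp (f := fun s => s `^ r) (is_derive1_powR _ fx0) D).
Qed.

Lemma continuous_affine (f : R -> R) k c y : continuous f ->
  continuous (fun z => f (c + k * (z - y))).
Proof.
move=> cf x.
apply: (continuous_comp (f := fun z => c + k * (z - y)) (g := f)); last exact: cf.
apply: continuousD; first exact: cst_continuous.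
apply: continuousM; first exact: cst_continuous.
by apply: continuousB => //; exact: cst_continuous.
Qed.

Section Rescaling.
Variables (r T1 T2 c d : R).
Hypotheses (r1 : 1 < r) (T12 : T1 < T2) (cd : c < d).
Let k := (T2 - T1) / (d - c).
Let k0 : 0 < k. Proof. by rewrite divr_gt0// subr_gt0. Qed.
Let dc0 : d - c != 0. Proof. by rewrite subr_eq0 gt_eqF. Qed.
Let kd : T1 + k * (d - c) = T2. Proof. by rewrite /k divfK// addrC subrK. Qed.

Let rangeE x : (T1 < T1 + k * (x - c) < T2) = (c < x < d).
Proof.
rewrite ltrDl pmulr_rgt0// subr_gt0; congr (_ && _).
by rewrite -kd ltrD2l ltr_pM2l// ltrD2r.
Qed.

(** A change of variable of ratio [k] multiplies slopes by [k] and eigenvalues by k^r. Inverse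
    distances also scale by [k], so the two bounds keep the constant 1. *)
Lemma log_slope_rescale lam A : log_slope r lam T1 T2 A ->
  log_slope r (k `^ r * lam) c d (fun x => k * A (T1 + k * (x - c))).
Proof.
move=> [dA bA]; split => x; rewrite -rangeE => xcd.
- rewrite (_ : (fun y => _) =
      (fun y => k `^ (r - 1) * spow r (A (T1 + k * (y - c))))); last first.
    by apply/funext => y; rewrite spow_gt0M.
  have := is_deriveZ (k `^ (r - 1)) (is_derive_affine (dA _ xcd)).
  rewrite /GRing.scale/= mulrA => D; apply: is_derive_eq D _.
  rewrite powR_normM (gtr0_norm k0) mulrC [_ * k]mulrC mulr_powRB1 ?(ltW k0)//; last first.
    by rewrite (lt_trans ltr01).
  by ring.
- have /andP[] := bA _ xcd.
  rewrite -kd (_ : T1 + k * (d - c) - _ = k * (d - x)); last by ring.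
  rewrite [X in (X - T1)^-1]addrC addrK => A1 A2.
  have E z : z^-1 = k * (k * z)^-1 by rewrite invfM mulVKf// gt_eqF.
  by rewrite (E (d - x)) (E (x - c)) -mulrN !ler_pM2l// A1 A2.
Qed.

Lemma eigen_arc_rescale lam phi g : eigen_arc r lam T1 T2 phi g ->
  eigen_arc r (k `^ r * lam) c d (fun x => phi (T1 + k * (x - c)))
    (fun x => k * g (T1 + k * (x - c))).
Proof.
move=> [[cphi cg phi0 phiE gE] dphi]; split; first split.
- exact: continuous_affine.
- move=> x; have C := @continuous_affine g k T1 c cg.
  exact: (continuous_comp (C x) (@mulrl_continuous _ k _)).
- by move=> x; rewrite -rangeE; exact: phi0.
- by move=> x; rewrite -rangeE; exact: phiE.
- by rewrite kd subrr mulr0 addr0 gE mulrN.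
move=> x; rewrite -rangeE => /dphi[D1 D2]; split; first exact: is_derive_affine.
rewrite (_ : (fun y => _) =
    (fun y => k `^ (r - 1) * spow r (g (T1 + k * (y - c))))); last first.
  by apply/funext => y; rewrite spow_gt0M.
have := is_deriveZ (k `^ (r - 1)) (is_derive_affine D2).
rewrite /GRing.scale/= mulrA => D; apply: is_derive_eq D _.
rewrite [_ * k]mulrC mulr_powRB1 ?(ltW k0) ?(lt_trans ltr01)//.
by rewrite mulrN mulrA.
Qed.

End Rescaling.
End Arc.

(** * The arc with eigenvalue 1 *)

Section UnitArc.
Context {R : realType}.
Implicit Types (r s t x y z w c d : R).

Lemma near_itvoo c d x : c < x < d -> \forall y \near x, c < y < d.
Proof.
move=> xcd; have : x \in `]c, d[ by rewrite in_itv.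
move=> /near_in_itvoo; apply: filterS => y; by rewrite in_itv.
Qed.

Lemma eq_is_derive_itvoo (f g : R -> R) c d x (df : R) :
  (forall y, c < y < d -> f y = g y) -> c < x < d ->
  is_derive x 1 f df -> is_derive x 1 g df.
Proof.
move=> fg xcd; apply: near_eq_is_derive.
by apply: filterS (near_itvoo xcd) => y /fg.
Qed.

Lemma near_eq_continuous (f g : R -> R) x : (\forall y \near x, f y = g y) ->
  {for x, continuous f} -> {for x, continuous g}.
Proof.
move=> fg cf; rewrite /prop_for /continuous_at -(nbhs_singleton fg).
by apply: cvg_trans cf; apply: near_eq_cvg; apply: filterS fg => y.
Qed.

Variable r : R.
Hypothesis r1 : 1 < r.

Let r' : R := 1 + (r - 1)^-1.
Let r0 : 0 < r. Proof. exact: lt_trans r1. Qed.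
Let rB0 : 0 < r - 1. Proof. by rewrite subr_gt0. Qed.
Let rr' : (r - 1) * (r' - 1) = 1.
Proof. by rewrite /r' [1 + _]addrC addrK divff// gt_eqF. Qed.
Let rr'C : (r' - 1) * (r - 1) = 1. Proof. by rewrite mulrC. Qed.
Let r'1 : 1 < r'. Proof. by rewrite ltrDl invr_gt0. Qed.
Let r'0 : 0 < r'. Proof. exact: lt_trans r'1. Qed.
Let Er' : (r' - 1) * r = r'.
Proof. by rewrite -[X in _ * X](subrK 1) mulrDr rr'C mulr1 addrC subrK. Qed.
Let Er : (r - 1) * r' = r.
Proof. by rewrite -[X in _ * X](subrK 1) mulrDr rr' mulr1 addrC subrK. Qed.

(** The energy |phi|^r + (r-1) |phi'|^r is conserved when the eigenvalue is 1. Normalized to 1, and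
    with phi' = A phi and |A|^r = |B|^r', it reads phi^r u(B) = 1, hence phi = k(B) with the [k]
    that follows. *)
Let u z : R := 1 + (r - 1) * `|z| `^ r'.
Let k z : R := u z `^ (- r^-1).

Let u_gt0 z : 0 < u z.
Proof. by rewrite ltr_pwDl// mulr_ge0 ?powR_ge0// ltW. Qed.

Let k_gt0 z : 0 < k z. Proof. exact: powR_gt0. Qed.

Let kr z : k z `^ r = (u z)^-1.
Proof. by rewrite /k -powRrM mulNr mulVf ?gt_eqF// powR_inv1// ltW. Qed.

Let k_small (e : R) : 0 < e -> exists y, forall z, y <= `|z| -> k z < e.
Proof.
move=> e0; pose y := (e `^ (- r) / (r - 1)) `^ (r'^-1); exists y => z yz.
have y0 : 0 <= y by exact: powR_ge0.
have er0 : 0 < e `^ (- r) by exact: powR_gt0.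
rewrite /k powRN -[ltRHS]invrK ltf_pV2 ?posrE ?powR_gt0 ?invr_gt0//.
have <- : (e `^ (- r)) `^ (r^-1) = e^-1.
  by rewrite -powRrM mulNr divff ?gt_eqF// powR_inv1// ltW.
rewrite gt0_ltr_powR ?invr_gt0// ?nnegrE ?ltW//.
rewrite /u (@lt_le_trans _ _ (1 + e `^ (- r)))// ?ltrDr// lerD2l.
have -> : e `^ (- r) = (r - 1) * y `^ r'.
  rewrite /y -powRrM mulVf ?gt_eqF// powRr1; last by rewrite divr_ge0// ltW.
  by rewrite mulrC divfK// gt_eqF.
by rewrite ler_pM2l// ge0_ler_powR ?nnegrE// ltW.
Qed.

(** This is |phi'| as a function of phi, read off from the energy identity. The absolute value
    around the difference makes [h] total and continuous. *)
Let h s : R := (`|1 - `|s| `^ r| / (r - 1)) `^ r^-1.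

Let continuous_h : continuous h.
Proof.
have -> : h = (fun s => `|s| `^ r^-1) \o (fun s => (r - 1)^-1 * s) \o
    (fun s => `|1 - s|) \o (fun s => `|s| `^ r).
  apply/funext => s; rewrite /h /= [(r - 1)^-1 * _]mulrC normrM normr_id.
  by rewrite (gtr0_norm (_ : 0 < (r - 1)^-1)) ?invr_gt0.
move=> s; apply: continuous_comp; first exact: continuous_normr_powR.
apply: continuous_comp.
  apply: continuous_comp; last exact: norm_continuous.
  apply: continuousB; [exact: cst_continuous|exact: cvg_id].
apply: continuous_comp; first exact: mulrl_continuous.
by apply: continuous_normr_powR; rewrite invr_gt0.
Qed.

(** Everything is computed from [B]: the slope as A = - spow r' B, the function from the energy
    identity, and its derivative as A phi. The work lies at the ends, where [B] is infinite. *)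
Lemma unit_arc : exists (T1 T2 : R) (A phi g : R -> R),
  [/\ T1 < T2, log_slope r 1 T1 T2 A & eigen_arc r 1 T1 T2 phi g].
Proof.
have [T1 [T2 [B [T12 dB Bonto BT1 BT2]]]] := riccati_inverse r1 rr'.
have Binc x y : T1 < x -> x < y -> y < T2 -> B x < B y.
  move=> T1x xy yT2.
  apply: (is_derive_gt0_lt (df := fun z => u (B z)) xy) => z /andP[xz zy]; last exact: u_gt0.
  by apply: dB; rewrite (lt_le_trans T1x xz) (le_lt_trans zy yT2).
have [m mT Bm] := Bonto 0; have [T1m mT2] := andP mT.
pose A t := - spow r' (B t).
pose phi t := if T1 < t < T2 then k (B t) else 0.
(* At the ends A phi is of the form infinity times zero, so the derivative is written through
   [h (phi t)], which is continuous there. The sign changes at [m], where [B] and hence the slope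
   vanish. *)
pose g t := if t < m then h (phi t) else - h (phi t).
have phiE t : T1 < t < T2 -> phi t = k (B t) by rewrite /phi => ->.
have phi_gt0 t : T1 < t < T2 -> 0 < phi t by move=> /phiE ->.
have phi0 t : ~~ (T1 < t < T2) -> phi t = 0 by rewrite /phi => /negbTE ->.
have spowA t : spow r (A t) = - B t by rewrite spowN spowK.
have normA t : `|A t| `^ r = `|B t| `^ r'.
  by rewrite normrN normr_spow// -powRrM Er'.
have dphi t : T1 < t < T2 -> is_derive t 1 phi (A t * phi t).
  move=> tT; rewrite phiE//; apply: (eq_is_derive_itvoo (f := k \o B) _ tT).
    by move=> y /phiE ->.
  have D1 : is_derive t 1 (fun t => u (B t)) (r * spow r' (B t) * u (B t)).
    have := is_derive1_comp (is_derive_powR_normr (B t) r'1) (dB t tT).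
    move=> /(is_deriveZ (r - 1)) /(is_deriveD (is_derive_cst (1 : R) t (1 : R))).
    by rewrite add0r /GRing.scale/= !mulrA Er.
  have := is_derive_powR_comp (f := fun t => u (B t)) (- r^-1) (u_gt0 _) D1.
  move=> D; apply: is_derive_eq D _.
  rewrite powRB; last by rewrite (gt_eqF (u_gt0 _)) implybT.
  rewrite powRr1; last exact: ltW.
  rewrite /A /k; field.
  by rewrite !gt_eqF.
have hphi t : T1 < t < T2 -> h (phi t) = `|A t * phi t|.
  move=> tT; rewrite /h phiE// (gtr0_norm (k_gt0 _)) kr normrM (gtr0_norm (k_gt0 _)).
  have -> : `|1 - (u (B t))^-1| / (r - 1) = (`|A t| * k (B t)) `^ r.
    rewrite powRM// ?(ltW (k_gt0 _))// kr normA.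
    have -> : 1 - (u (B t))^-1 = (r - 1) * `|B t| `^ r' / u (B t).
      by rewrite /u; field; rewrite -/(u _) gt_eqF.
    rewrite ger0_norm; last by rewrite divr_ge0 ?(ltW (u_gt0 _))// mulr_ge0 ?powR_ge0 ?ltW.
    by field; rewrite !gt_eqF.
  by rewrite -powRrM divff ?gt_eqF// powRr1// mulr_ge0// ltW.
have gE t : T1 < t < T2 -> A t * phi t = g t.
  move=> tT; have [T1t tT2] := andP tT.
  rewrite /g hphi// /A; case: ifPn => [tm|]; last rewrite -leNgt => mt.
    have Bt : B t < 0 by rewrite -Bm; exact: Binc.
    rewrite gtr0_norm// mulr_gt0 ?phi_gt0// -spowN spow_gt0// oppr_gt0//.
  have Bt : 0 <= B t.
    by move: mt; rewrite le_eqVlt => /predU1P[<-|mt]; rewrite -?Bm// ltW// Binc.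
  rewrite ler0_norm ?opprK// mulNr oppr_le0 mulr_ge0 ?(ltW (phi_gt0 _ _))//.
  by rewrite spow_ge0E// powR_ge0.
have cphi : continuous phi.
  move=> x; have [xT|xT] := boolP (T1 < x < T2).
    exact: is_derive_continuous (dphi _ xT).
  apply/cvgrPdist_lt => e e0; rewrite (phi0 _ xT).
  have [y0 ky0] := k_small e0; pose y1 := Num.max y0 1.
  (* [B] is increasing and onto, so to the left of [t1] and to the right of [t2] it is at least [y1]
     in absolute value and [k (B y)] is below [e]. A point outside the open arc has a neighbourhood
     of one of these two kinds. *)
  have [t1 t1T Bt1] := Bonto (- y1); have [t2 t2T Bt2] := Bonto y1.
  have small y : (y < t1) || (t2 < y) -> `|0 - phi y| < e.
    move=> yt; rewrite sub0r normrN; have [yT|yT] := boolP (T1 < y < T2); last first.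
      by rewrite phi0// normr0.
    have [T1y yT2] := andP yT; rewrite gtr0_norm ?phi_gt0// phiE//; apply: ky0.
    rewrite (@le_trans _ _ y1) ?le_max ?lexx//.
    have [[T1t1 _] [_ t2T2]] := (andP t1T, andP t2T).
    case/orP: yt => yt.
      have := Binc _ _ T1y yt (andP t1T).2; rewrite Bt1 => By.
      by rewrite -normrN (le_trans _ (ler_norm _))// lerNr ltW.
    have := Binc _ _ (andP t2T).1 yt yT2; rewrite Bt2 => By.
    by rewrite (le_trans (ltW By))// ler_norm.
  have [xt1|t1x] := ltP x t1.
    by near=> y; apply: small; apply/orP; left; near: y; exact: lt_nbhsl.
  have t2x : t2 < x.
    move: xT; rewrite (lt_le_trans (andP t1T).1 t1x)/= -leNgt.
    exact: lt_le_trans (andP t2T).2.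
  by near=> y; apply: small; apply/orP; right; near: y; exact: lt_nbhsr.
have cg : continuous g.
  move=> x; have chphi : continuous (h \o phi).
    by move=> y; apply: continuous_comp; [exact: cphi|exact: continuous_h].
  have [xm|mx|->] := ltgtP x m.
  - apply: near_eq_continuous (chphi x).
    near=> y; rewrite /g /= ifT//; near: y; exact: lt_nbhsl.
  - apply: near_eq_continuous (continuousN (chphi x)).
    near=> y; rewrite /g /= ltNge ifN// negbK ltW//; near: y; exact: lt_nbhsr.
  - apply: (@near_eq_continuous (fun t => A t * phi t)).
      by apply: filterS (near_itvoo mT) => y yT; exact: gE.
    apply: (continuousM (s := A) (t := phi)); last exact: cphi.
    apply: continuousN; apply: continuous_comp; last exact: continuous_spow.
    exact: is_derive_continuous (dB _ mT).
exists T1, T2, A, phi, g; split => //; split.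
- move=> t tT; rewrite normA.
  rewrite (_ : (fun y => _) = (fun y => - B y)); last by apply/funext.
  exact: is_deriveN (dB _ tT).
- move=> t tT; rewrite /A; have [T1t tT2] := andP tT.
  have P1 : - (T2 - t)^-1 <= 0 by rewrite oppr_le0 invr_ge0 subr_ge0 ltW.
  have P2 : 0 <= (t - T1)^-1 by rewrite invr_ge0 subr_ge0 ltW.
  apply/andP; split.
  + have [Bt|Bt] := leP (B t) 0.
      by rewrite (le_trans P1)// -spowN spow_ge0E ?powR_ge0// oppr_ge0.
    by rewrite lerN2 (le_trans (ler_norm _))// normr_spow// BT2.
  + have [Bt|Bt] := leP 0 (B t).
      by rewrite (le_trans _ P2)// oppr_le0 spow_ge0E ?powR_ge0.
    by rewrite (le_trans (ler_norm _))// normrN normr_spow// BT1.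
- by split => //; rewrite /g T1m ltNge (ltW mT2)/= !phi0 ?ltxx ?andbF.
- move=> t tT; split; first by rewrite -gE//; exact: dphi.
  (* [g] itself need not be differentiable where [B] vanishes, but spow r (A phi) is the product of
     - B and phi^(r-1), both differentiable. *)
  apply: (eq_is_derive_itvoo (f := fun y => - B y * phi y `^ (r - 1)) _ tT).
    move=> y yT; rewrite -gE// [A y * _]mulrC spow_gt0M ?phi_gt0// spowA mulrC//.
  have D2 := is_derive_powR_comp (r - 1) (phi_gt0 t tT) (dphi t tT).
  have := is_deriveM (is_deriveN (dB t tT)) D2.
  rewrite /GRing.scale/= => D; apply: is_derive_eq D _.
  rewrite powRB; last by rewrite (gt_eqF (phi_gt0 _ tT)) implybT.
  rewrite powRr1; last by rewrite ltW ?phi_gt0.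
  have := spow_mulr (B t) r'1; rewrite -/(A t) /u => E.
  rewrite (_ : - B t * _ = `|B t| `^ r' * (r - 1) * phi t `^ (r - 1)); last first.
    by rewrite -E /A; field; rewrite gt_eqF ?phi_gt0.
  by ring.
Unshelve. all: by end_near. Qed.

End UnitArc.

(** * Picone's inequality on a nodal interval *)

Section Picone.
Context {R : realType}.
Implicit Types (r s t x y z c d a : R).

(** Strict convexity, by the mean value theorem and the strict monotonicity of [spow r]. The
    strictness is what later identifies the equality case in Picone's inequality. *)
Lemma powR_normr_convex r a t : 1 < r -> t != a ->
  r * spow r a * (t - a) < `|t| `^ r - `|a| `^ r.
Proof.
move=> r1; have r0 : 0 < r by rewrite (lt_trans ltr01).
have D z : is_derive z 1 (fun s : R => `|s| `^ r) (r * spow r z).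
  exact: is_derive_powR_normr.
rewrite neq_lt => /orP[ta|at_].
- have [z /andP[_ za] E] := mean_value ta (fun z _ => D z).
  rewrite -ltrN2 opprB E -mulrN opprB ltr_pM2r ?subr_gt0//.
  by rewrite ltr_pM2l// spow_lt.
- have [z /andP[az _] ->] := mean_value at_ (fun z _ => D z).
  by rewrite ltr_pM2r ?subr_gt0// ltr_pM2l// spow_lt.
Qed.

(** For [s > 0] this is s^r times the gap between |.|^r at t/s and its tangent at [a]. It is
    expanded so that no division by [s] occurs, the form in which it appears in the derivative of
    [Z]. *)
Definition picone_defect r a s t : R :=
  `|t| `^ r - r * spow r a * (s `^ (r - 1) * t) + (r - 1) * `|a| `^ r * s `^ r.

Lemma picone_defectE r a s t : 1 < r -> 0 < s ->
  picone_defect r a s t =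
  s `^ r * (`|t / s| `^ r - `|a| `^ r - r * spow r a * (t / s - a)).
Proof.
move=> r1 s0; rewrite /picone_defect.
have -> : `|t| `^ r = s `^ r * `|t / s| `^ r.
  rewrite -{1}(gtr0_norm s0) -powR_normM mulrC divfK// gt_eqF//.
have -> : s `^ (r - 1) * t = s `^ r * (t / s).
  have <- : s * s `^ (r - 1) = s `^ r by rewrite mulr_powRB1 ?(lt_trans ltr01) ?ltW.
  by field; rewrite gt_eqF.
rewrite -spow_mulr//; ring.
Qed.

Lemma picone_defect_ge0 r a s t : 1 < r -> 0 < s -> 0 <= picone_defect r a s t.
Proof.
move=> r1 s0; rewrite picone_defectE// mulr_ge0 ?powR_ge0// subr_ge0.
have [->|ta] := eqVneq (t / s) a; first by rewrite !subrr mulr0.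
exact/ltW/powR_normr_convex.
Qed.

Lemma picone_defect_eq0 r a s t : 1 < r -> 0 < s ->
  picone_defect r a s t = 0 -> t = a * s.
Proof.
move=> r1 s0; rewrite picone_defectE// => /eqP.
rewrite mulf_eq0 gt_eqF ?powR_gt0//= => D0.
have [<-|ta] := eqVneq (t / s) a; first by rewrite divfK// gt_eqF.
by move: (powR_normr_convex r1 ta); rewrite -subr_gt0 (eqP D0) ltxx.
Qed.

Lemma log_slope_sub r (lam : R) c d d' (A : R -> R) : d <= d' ->
  log_slope r lam c d' A -> log_slope r lam c d A.
Proof.
move=> dd' [dA bA]; split => x /andP[cx xd].
  by apply: dA; rewrite cx (lt_le_trans xd dd').
have /andP[A1 ->] : - (d' - x)^-1 <= A x <= (x - c)^-1.
  by apply: bA; rewrite cx (lt_le_trans xd dd').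
rewrite andbT (le_trans _ A1)// lerN2 lef_pV2 ?posrE ?subr_gt0//.
  by rewrite lerB.
exact: lt_le_trans dd'.
Qed.

Lemma log_slope_decr r (lam : R) c d (A : R -> R) x y : 1 < r -> 0 < lam ->
  log_slope r lam c d A -> c < x -> x < y -> y < d ->
  spow r (A y) < spow r (A x).
Proof.
move=> r1 lam0 [dA _] cx xy yd.
have dA' z : x <= z <= y ->
    is_derive z 1 (fun y => - spow r (A y)) (- - (lam + (r - 1) * `|A z| `^ r)).
  move=> /andP[xz zy]; apply: is_deriveN; apply: dA.
  by rewrite (lt_le_trans cx xz) (le_lt_trans zy yd).
rewrite -ltrN2; apply: (is_derive_gt0_lt xy dA') => z _.
by rewrite opprK ltr_pwDl// mulr_ge0 ?powR_ge0// subr_ge0 ltW.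
Qed.

(** Where [A] keeps its sign, spow q A is, up to that sign, the power th = (q-1)/(p-1) of spow p A.
    Differentiating this and inserting both Riccati equations, the terms in |A|^q cancel and the
    stated relation remains. *)
Lemma log_slope_common p q (lp lq : R) c d (A : R -> R) x : 1 < q -> 1 < p ->
  log_slope p lp c d A -> log_slope q lq c d A -> c < x < d -> A x != 0 ->
  lq = (q - 1) / (p - 1) * lp * `|A x| `^ (q - p).
Proof.
move=> q1 p1 [dp _] [dq _] xcd Ax0.
pose th := (q - 1) / (p - 1); pose sg : R := Num.sg (A x).
have p0 : 0 < p - 1 by rewrite subr_gt0.
have sgn r s : 1 < r -> 0 < sg * s -> sg * spow r s = `|s| `^ (r - 1).
  move=> r1; rewrite /sg; case: (ltgtP (A x) 0) Ax0 => // Ax _.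
    rewrite ltr0_sg// !mulN1r => s0; rewrite -spowN spow_ge0E ?ltW//.
    by rewrite -normrN gtr0_norm.
  rewrite gtr0_sg// !mul1r => s0; rewrite spow_ge0E ?ltW//.
  by rewrite gtr0_norm.
have cP : {for x, continuous (fun y => sg * spow p (A y))}.
  exact: continuous_comp (is_derive_continuous (dp _ xcd)) (@mulrl_continuous _ _ _).
have sgA : 0 < sg * A x by rewrite -normrEsg normr_gt0.
(* The Riccati equation gives continuity of [spow p (A y)], so the sign of [A] near [x] is obtained
   through the sign of that power. *)
have nA : \forall y \near x, 0 < sg * A y.
  have : \forall y \near x, 0 < sg * spow p (A y).
    by apply: (cvgr_gt _ cP); rewrite sgn// powR_gt0// normr_gt0.
  apply: filterS => y; rewrite /sg; case: (ltgtP (A x) 0) Ax0 => // Ax _.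
    rewrite ltr0_sg// !mulN1r -spowN => H; rewrite ltNge; apply/negP => H'.
    have : spow p (- A y) <= 0.
      by rewrite -oppr_ge0 -spowN opprK spow_ge0E ?powR_ge0// -oppr_le0.
    by rewrite leNgt H.
  rewrite gtr0_sg// !mul1r => H; rewrite ltNge; apply/negP => H'.
  have : spow p (A y) <= 0.
    by rewrite -oppr_ge0 -spowN spow_ge0E ?powR_ge0// oppr_ge0.
  by rewrite leNgt H.
have Dp : is_derive x 1 (fun y => sg * spow p (A y))
    (sg * - (lp + (p - 1) * `|A x| `^ p)) by exact: is_deriveZ (dp _ xcd).
have Dq : is_derive x 1 (fun y => sg * spow q (A y))
    (sg * - (lq + (q - 1) * `|A x| `^ q)) by exact: is_deriveZ (dq _ xcd).
have P0 : 0 < sg * spow p (A x) by rewrite sgn// powR_gt0// normr_gt0.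
have Dq' : is_derive x 1 (fun y => sg * spow q (A y))
    (th * (sg * spow p (A x)) `^ (th - 1) * (sg * - (lp + (p - 1) * `|A x| `^ p))).
  pose P y := sg * spow p (A y).
  apply: near_eq_is_derive (is_derive_powR_comp (f := P) th P0 Dp).
  apply: filterS nA => y Ay; rewrite /P !sgn// -powRrM; congr (_ `^ _).
  by rewrite /th mulrC divfK// gt_eqF.
have := @derive_val _ _ _ _ _ _ _ Dq'; rewrite (@derive_val _ _ _ _ _ _ _ Dq).
rewrite [RHS]mulrCA => /mulfI; rewrite sgr_eq0 => /(_ Ax0).
rewrite mulrN => /oppr_inj.
rewrite sgn// -powRrM (_ : (p - 1) * (th - 1) = q - p); last first.
  by rewrite /th; field; rewrite gt_eqF.
have -> : `|A x| `^ q = `|A x| `^ (q - p) * `|A x| `^ p.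
  rewrite -powRD; last by rewrite normr_eq0 Ax0 implybT.
  by congr (_ `^ _); ring.
have -> : q - 1 = th * (p - 1) by rewrite /th divfK// gt_eqF.
by move=> E; rewrite -/th mulfK ?gt_eqF//; move: E; lra.
Qed.

(** If the slopes agreed, [log_slope_common] would fix |A| wherever A is nonzero, since p and q
    differ. Two points where A has the same sign would then have the same slope, against its strict
    decrease. *)
Lemma log_slope_neq p q (lp lq : R) c d (Ap Aq : R -> R) :
  1 < q -> q < p -> 0 < lp -> c < d ->
  log_slope p lp c d Ap -> log_slope q lq c d Aq ->
  ~ (forall x, c < x < d -> Ap x = Aq x).
Proof.
move=> q1 qp lp0 cd Hp Hq Apq; have p1 := lt_trans q1 qp.
have {}Hq : log_slope q lq c d Ap.
  case: Hq => dq bq; split => x xcd; rewrite Apq//; last exact: bq.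
  apply: (eq_is_derive_itvoo (f := fun y => spow q (Aq y)) _ xcd); last exact: dq.
  by move=> y ycd; rewrite Apq.
have key x y : c < x -> x < y -> y < d -> 0 < Ap x * Ap y -> False.
  move=> cx xy yd Axy; have := log_slope_decr p1 lp0 Hp cx xy yd.
  have [Ax0 Ay0] : Ap x != 0 /\ Ap y != 0.
    by apply/andP; rewrite -negb_or -mulf_eq0 gt_eqF.
  have Ex := log_slope_common q1 p1 Hp Hq (_ : c < x < d) Ax0.
  have {}Ex := Ex (introT andP (conj cx (lt_trans xy yd))).
  have Ey := log_slope_common q1 p1 Hp Hq (_ : c < y < d) Ay0.
  have {}Ey := Ey (introT andP (conj (lt_trans cx xy) yd)).
  move: Ey; rewrite Ex => /mulfI E.
  have {}E : `|Ap x| `^ (q - p) = `|Ap y| `^ (q - p).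
    by apply: E; rewrite !mulf_neq0 ?invr_neq0 ?gt_eqF ?subr_gt0.
  have {}E : `|Ap x| = `|Ap y|.
    move: E; rewrite -(opprB p q) !powRN => /invr_inj.
    by apply: powR_injective; rewrite ?nnegrE// subr_gt0.
  suff -> : Ap x = Ap y by rewrite ltxx.
  have [Ax|Ax|Ax] := ltgtP (Ap x) 0; last by rewrite Ax eqxx in Ax0.
    have Ay : Ap y < 0 by rewrite -(nmulr_rgt0 _ Ax).
    by move: E; rewrite !ltr0_norm// => /oppr_inj.
  have Ay : 0 < Ap y by rewrite -(pmulr_rgt0 _ Ax).
  by move: E; rewrite !gtr0_norm.
pose x1 := c + (d - c) / 4; pose x2 := c + (d - c) / 2; pose x3 := c + 3 * (d - c) / 4.
have [cx1 x12 x23 x3d] : [/\ c < x1, x1 < x2, x2 < x3 & x3 < d].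
  by rewrite /x1 /x2 /x3; split; lra.
have P12 := log_slope_decr p1 lp0 Hp cx1 x12 (lt_trans x23 x3d).
pose y1 := (c + x1) / 2; pose y3 := (x3 + d) / 2.
have [cy1 y1x1 x3y3 y3d] : [/\ c < y1, y1 < x1, x3 < y3 & y3 < d].
  by rewrite /y1 /y3; split; lra.
have inc x y : spow p (Ap y) < spow p (Ap x) -> Ap y < Ap x.
  by rewrite (leW_mono (le_mono (spow_lt p1))).
(* Being strictly decreasing, [Ap] is negative to the right of the midpoint [x2] if [Ap x2 <= 0],
   and positive to its left otherwise. Two points on that side are fed to [key]. *)
have [A2|A2] := leP (Ap x2) 0.
- have A3 := inc _ _ (log_slope_decr p1 lp0 Hp (lt_trans cx1 x12) x23 x3d).
  have A4 := inc _ _ (log_slope_decr p1 lp0 Hp (lt_trans (lt_trans cx1 x12) x23) x3y3 y3d).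
  apply: (key x3 y3) => //; first exact: lt_trans (lt_trans cx1 x12) x23.
  by rewrite nmulr_rgt0 ?(lt_le_trans A3 A2)// (lt_trans A4)// (lt_le_trans A3 A2).
- have A1 := inc _ _ P12.
  have A0 := inc _ _ (log_slope_decr p1 lp0 Hp cy1 y1x1 (lt_trans x12 (lt_trans x23 x3d))).
  apply: (key y1 x1) => //; first exact: lt_trans x12 (lt_trans x23 x3d).
  by rewrite pmulr_rgt0 (lt_trans A2)// (lt_trans A1).
Qed.

End Picone.

(** * Picone's argument on an interval where the solution is positive *)

Section NoPositiveArc.
Context {R : realType}.
Variables (p q al be lp lq c d M : R) (Ap Aq U G : R -> R).
Hypotheses (q1 : 1 < q) (qp : q < p) (cd : c < d).
Hypotheses (lp0 : 0 < lp) (alp : al <= lp) (beq : be <= lq).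
Hypotheses (HAp : log_slope p lp c d Ap) (HAq : log_slope q lq c d Aq).
Hypothesis U_gt0 : forall x, c < x < d -> 0 < U x.
Hypothesis dU : forall x, c < x < d -> is_derive x 1 U (G x).
Hypothesis dG : forall x, c < x < d ->
  is_derive x 1 (fun y => spow p (G y) + spow q (G y))
    (- (al * U x `^ (p - 1) + be * U x `^ (q - 1))).
Hypothesis G_le : forall x, c < x < d -> `|G x| <= M.
Hypothesis U_le : forall x, c < x < d -> U x <= M * (x - c) /\ U x <= M * (d - x).

Let p1 : 1 < p. Proof. exact: lt_trans q1 qp. Qed.

Let Z x : R := (spow p (G x) + spow q (G x)) * U x -
  (spow p (Ap x) * U x `^ p + spow q (Aq x) * U x `^ q).

(** The derivative of [Z]: after the Riccati equations and the equation for [U] are inserted, the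
    two Picone defects remain, together with two terms that are nonnegative by [al <= lp] and
    [be <= lq]. *)
Let defect x : R :=
  picone_defect p (Ap x) (U x) (G x) + picone_defect q (Aq x) (U x) (G x) +
  ((lp - al) * U x `^ p + (lq - be) * U x `^ q).

Let dZ x : c < x < d -> is_derive x 1 Z (defect x).
Proof.
move=> xcd; have Ux := U_gt0 xcd; have dUx := dU xcd.
have D r lam A : log_slope r lam c d A ->
    is_derive x 1 (fun y => spow r (A y) * U y `^ r)
      (spow r (A x) * (r * U x `^ (r - 1) * G x)
        + U x `^ r * - (lam + (r - 1) * `|A x| `^ r)).
  by move=> [dA _]; exact: is_deriveM (dA _ xcd) (is_derive_powR_comp r Ux dUx).
have := is_deriveB (is_deriveM (dG xcd) dUx) (is_deriveD (D _ _ _ HAp) (D _ _ _ HAq)).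
rewrite /GRing.scale/= => DZ; apply: is_derive_eq DZ _.
rewrite /defect /picone_defect -!spow_mulr//.
rewrite -(mulr_powRB1 (ltW Ux) (lt_trans ltr01 p1)).
rewrite -(mulr_powRB1 (ltW Ux) (lt_trans ltr01 q1)).
by ring.
Qed.

Let defect_ge0 x : c < x < d -> 0 <= defect x.
Proof.
move=> xcd; apply: addr_ge0.
  by apply: addr_ge0; apply: picone_defect_ge0 => //; exact: U_gt0.
by apply: addr_ge0; rewrite mulr_ge0 ?powR_ge0 ?subr_ge0.
Qed.

Let Z_le x y : c < x -> x <= y -> y < d -> Z x <= Z y.
Proof.
move=> cx xy yd; have sub z : x <= z <= y -> c < z < d.
  by move=> /andP[xz zy]; rewrite (lt_le_trans cx xz) (le_lt_trans zy yd).
apply: (is_derive_ge0_le (df := defect) xy) => z /sub zcd; first exact: dZ.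
exact: defect_ge0.
Qed.

Let K : R := 2 * (M `^ p + M `^ q).

(** Here [e] stands for the distance to the nearer end. The factor e^-(r-1) from the slope is
    absorbed by U^r <= (M e)^r, so each of the four terms of [Z], two for [p] and two for [q], is at
    most M^r e; this is the origin of [K]. *)
Let Z_bound e x : c < x < d -> 0 < e -> U x <= M * e ->
  `|Ap x| <= e^-1 -> `|Aq x| <= e^-1 -> `|Z x| <= K * e.
Proof.
move=> xcd e0 Ue Ape Aqe; have Ux := U_gt0 xcd.
have M0 : 0 < M by rewrite -(pmulr_lgt0 _ e0) (lt_le_trans Ux).
have bG r : 1 < r -> `|spow r (G x) * U x| <= M `^ r * e.
  move=> r1; rewrite normrM normr_spow// (gtr0_norm Ux).
  rewrite -(mulr_powRB1 (ltW M0)) ?(lt_trans ltr01)// mulrAC [_ * _ * _]mulrC.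
  apply: (ler_pM (powR_ge0 _ _) (ltW Ux)) Ue.
  by rewrite ge0_ler_powR ?nnegrE ?subr_ge0 ?(ltW M0) ?(ltW r1)// G_le.
have bA r a : 1 < r -> `|a| <= e^-1 -> `|spow r a * U x `^ r| <= M `^ r * e.
  move=> r1 ae; rewrite normrM normr_spow// (ger0_norm (powR_ge0 _ _)).
  rewrite (@le_trans _ _ (e^-1 `^ (r - 1) * (M * e) `^ r))//.
    apply: (ler_pM (powR_ge0 _ _) (powR_ge0 _ _)).
      by rewrite ge0_ler_powR ?nnegrE ?subr_ge0 ?invr_ge0 ?(ltW r1) ?(ltW e0).
    rewrite ge0_ler_powR ?nnegrE ?mulr_ge0 ?(ltW M0) ?(ltW e0) ?(ltW Ux)//.
    exact: ltW (lt_trans ltr01 r1).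
  rewrite (powRM _ (ltW M0) (ltW e0)) mulrCA ler_pM2l ?powR_gt0//.
  rewrite -(mulr_powRB1 (ltW e0) (lt_trans ltr01 r1)) mulrCA.
  rewrite -powRM ?invr_ge0 ?(ltW e0)//.
  by rewrite mulVf ?gt_eqF// powR1 mulr1.
have := bG _ p1; have := bG _ q1; have := bA _ _ p1 Ape; have := bA _ _ q1 Aqe.
rewrite !ler_norml /Z /K => /andP[? ?] /andP[? ?] /andP[? ?] /andP[? ?].
by apply/andP; split; lra.
Qed.

Let Z_left x : c < x <= (c + d) / 2 -> `|Z x| <= K * (x - c).
Proof.
move=> /andP[cx xm]; have xd : x < d by lra.
have xcd : c < x < d by rewrite cx.
have xc0 : 0 < x - c by rewrite subr_gt0.
have dx : (d - x)^-1 <= (x - c)^-1 by rewrite lef_pV2 ?posrE ?subr_gt0//; lra.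
apply: Z_bound => //; first exact: (U_le xcd).1.
- by rewrite ler_norml; have /andP[A1 ->] := HAp.2 _ xcd; rewrite andbT; lra.
- by rewrite ler_norml; have /andP[A1 ->] := HAq.2 _ xcd; rewrite andbT; lra.
Qed.

Let Z_right x : (c + d) / 2 <= x < d -> `|Z x| <= K * (d - x).
Proof.
move=> /andP[mx xd]; have cx : c < x by lra.
have xcd : c < x < d by rewrite cx.
have xd0 : 0 < d - x by rewrite subr_gt0.
have dx : (x - c)^-1 <= (d - x)^-1 by rewrite lef_pV2 ?posrE ?subr_gt0//; lra.
apply: Z_bound => //; first exact: (U_le xcd).2.
- by rewrite ler_norml; have /andP[-> A1] := HAp.2 _ xcd; lra.
- by rewrite ler_norml; have /andP[-> A1] := HAq.2 _ xcd; lra.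
Qed.

Let K_ge0 : 0 <= K. Proof. by rewrite mulr_ge0 ?addr_ge0 ?powR_ge0. Qed.

(* [Z] is nondecreasing and tends to [0] at both ends. *)
Let Z_eq0 x : c < x < d -> Z x = 0.
Proof.
move=> /andP[cx xd]; apply/eqP; rewrite eq_le; apply/andP; split.
- rewrite leNgt; apply/negP => Z0.
  have K0 : 0 < K + 1 by rewrite ltr_wpDl.
  (* A point so close to [d] that (K+1)(d-y) <= Z x. Since Z x <= Z y <= K (d-y), this is absurd.
     The constant [K + 1] is positive even if [K] vanishes. *)
  pose y := Num.max (Num.max x ((c + d) / 2)) (d - Z x / (K + 1)).
  have [xy my sy] : [/\ x <= y, (c + d) / 2 <= y & d - Z x / (K + 1) <= y].
    by rewrite /y !le_max !lexx !orbT.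
  have yd : y < d.
    rewrite /y !gt_max xd ltrBlDr ltrDl divr_gt0// andbT /=; lra.
  have := Z_le cx xy yd; have := Z_right (introT andP (conj my yd)).
  move=> /(le_trans (ler_norm _)) H1 H2.
  have : (K + 1) * (d - y) <= Z x.
    by rewrite mulrC -ler_pdivlMr// lerBlDl -lerBlDr.
  have : 0 < d - y by rewrite subr_gt0.
  by rewrite mulrDl mul1r; lra.
- rewrite leNgt; apply/negP => Z0.
  have K0 : 0 < K + 1 by rewrite ltr_wpDl.
  pose y := Num.min (Num.min x ((c + d) / 2)) (c - Z x / (K + 1)).
  have [xy my sy] : [/\ y <= x, y <= (c + d) / 2 & y <= c - Z x / (K + 1)].
    by rewrite /y !ge_min !lexx !orbT.
  have cy : c < y.
    have Zneg : Z x / (K + 1) < 0 by rewrite pmulr_llt0 ?invr_gt0.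
    by rewrite /y !lt_min cx; apply/andP; split; lra.
  have := Z_le cy xy xd; have := Z_left (introT andP (conj cy my)).
  rewrite -normrN => /(le_trans (ler_norm _)) H1 H2.
  have : (K + 1) * (y - c) <= - Z x.
    by rewrite mulrC -ler_pdivlMr// lerBlDl mulNr.
  have : 0 < y - c by rewrite subr_gt0.
  by rewrite mulrDl mul1r; lra.
Qed.

Lemma no_positive_arc : False.
Proof.
have D0 x : c < x < d -> defect x = 0.
  move=> xcd; have D : is_derive x 1 (fun=> 0 : R) (defect x).
    by apply: (eq_is_derive_itvoo (f := Z) _ xcd); [exact: Z_eq0|exact: dZ].
  have := @derive_val _ _ _ _ _ _ _ D.
  by rewrite (@derive_val _ _ _ _ _ _ _ (is_derive_cst (0 : R) x (1 : R))).
apply: (log_slope_neq q1 qp lp0 cd HAp HAq) => x xcd.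
have Ux := U_gt0 xcd.
have d1 := picone_defect_ge0 (Ap x) (G x) p1 Ux.
have d2 := picone_defect_ge0 (Aq x) (G x) q1 Ux.
have d3 : 0 <= (lp - al) * U x `^ p by rewrite mulr_ge0 ?powR_ge0 ?subr_ge0.
have d4 : 0 <= (lq - be) * U x `^ q by rewrite mulr_ge0 ?powR_ge0 ?subr_ge0.
have := D0 _ xcd; rewrite /defect => E.
have /(picone_defect_eq0 p1 Ux) Gp : picone_defect p (Ap x) (U x) (G x) = 0 by lra.
have /(picone_defect_eq0 q1 Ux) Gq : picone_defect q (Aq x) (U x) (G x) = 0 by lra.
by apply: (mulIf (lt0r_neq0 Ux)); rewrite -Gp -Gq.
Qed.

End NoPositiveArc.

(** * Smooth test functions *)

Section Smooth.
Context {R : realType}.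
Implicit Types (f g h : R -> R) (x y z c d : R) (n : nat).

(** [Cn 0] already asks for differentiability, so [Cn n] means n+1 times differentiable and implies
    class C^n. Peeling derivatives from the inside suits the inductions for sums and products. *)
Fixpoint Cn n f : Prop :=
  (forall x, derivable f x 1) /\
  (if n is m.+1 then Cn m (f^`())%classic else True).

Lemma CnP f : (forall n x, derivable (f^`(n))%classic x 1) <-> forall n, Cn n f.
Proof.
split=> [H n|]; last first.
  move=> H n; elim: n f H => [|n IH] f H x; first by case: (H 0%N).
  by rewrite derive1Sn; apply: IH => m; case: (H m.+1).
elim: n f H => [|n IH] f H; first by split => //; exact: (H 0%N).
split; first exact: (H 0%N).
by apply: IH => m x; rewrite -derive1Sn.
Qed.

Lemma Cn_derivable n f x : Cn n f -> derivable f x 1.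
Proof. by case: n => [|n] []. Qed.

Lemma Cn_derive n f : Cn n.+1 f -> Cn n (f^`())%classic.
Proof. by case. Qed.

Lemma Cn_ext n f g : f =1 g -> Cn n f -> Cn n g.
Proof. by move=> /funext ->. Qed.

Lemma CnW n f : Cn n.+1 f -> Cn n f.
Proof. by elim: n f => [|n IH] f [df H]; split => //; apply: IH. Qed.

Lemma Cn_is_derive n f g : (forall x, is_derive x 1 f (g x)) -> Cn n g ->
  Cn n.+1 f.
Proof.
move=> D Cg; split=> [x|]; first by have [] := D x.
apply: Cn_ext Cg => x; rewrite derive1E.
by rewrite (@derive_val _ _ _ _ _ _ _ (D x)).
Qed.

Lemma Cn_cst n (k : R) : Cn n (cst k).
Proof.
elim: n k => [|n IH] k; first by split.
by apply: (Cn_is_derive (g := cst 0)) => // x; exact: is_derive_cst.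
Qed.

Lemma derivable_is_derive1 f x : derivable f x 1 -> is_derive x 1 f (f^`()%classic x).
Proof. by rewrite derive1E; exact: derivableP. Qed.

Lemma CnD n f g : Cn n f -> Cn n g -> Cn n (f \+ g).
Proof.
elim: n f g => [|n IH] f g [df Cf] [dg Cg].
  by split => // x; exact: derivableD.
apply: (Cn_is_derive (g := (f^`() \+ g^`())%classic)); last exact: IH.
by move=> x; apply: is_deriveD; exact: derivable_is_derive1.
Qed.

Lemma CnM n f g : Cn n f -> Cn n g -> Cn n (f \* g).
Proof.
elim: n f g => [|n IH] f g Cf Cg.
  by split => // x; apply: derivableM; [exact: Cn_derivable Cf|exact: Cn_derivable Cg].
apply: (Cn_is_derive (g := (f \* g^`() \+ g \* f^`())%classic)).
  move=> x; apply: is_deriveM; apply: derivable_is_derive1.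
    exact: Cn_derivable Cf.
  exact: Cn_derivable Cg.
apply: CnD; apply: IH; [exact: CnW|exact: Cn_derive|exact: CnW|exact: Cn_derive].
Qed.

Lemma Cn_affine n f k c y : Cn n f -> Cn n (fun x => f (c + k * (x - y))).
Proof.
elim: n f => [|n IH] f Cf.
  split=> // x; have D := derivable_is_derive1 (@Cn_derivable 0%N f (c + k * (x - y)) Cf).
  by have [] := is_derive_affine D.
apply: (Cn_is_derive (g := fun x => k * (f^`())%classic (c + k * (x - y)))).
  move=> x; apply: is_derive_affine; apply: derivable_is_derive1.
  exact: Cn_derivable Cf.
apply: (CnM (f := cst k)); first exact: Cn_cst.
by apply: IH; exact: Cn_derive.
Qed.

Lemma CnX n f m : Cn n f -> Cn n (fun x => f x ^+ m).
Proof.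
move=> Cf; elim: m => [|m IH].
  by apply: Cn_ext (Cn_cst n 1) => x; rewrite expr0.
by apply: Cn_ext (CnM Cf IH) => x; rewrite /= exprS.
Qed.

Lemma Cn_continuous n f : Cn n f -> continuous f.
Proof.
move=> Cf x.
by apply: (is_derive_continuous (derivable_is_derive1 _)); exact: Cn_derivable Cf.
Qed.

(* The derivative of [flat p] is [flat q] for another polynomial [q], and
   [flat p z = flat ('X * p) z * z]: this makes all the [flat p] smooth. *)
Definition flat (p : {poly R}) x : R :=
  if 0 < x then p.[x^-1] * expR (- x^-1) else 0.

Lemma flat_le0 p x : x <= 0 -> flat p x = 0.
Proof. by rewrite /flat ltNge => ->. Qed.

Lemma flatD p q x : flat (p + q) x = flat p x + flat q x.
Proof. by rewrite /flat hornerD; case: ifP; rewrite ?addr0// mulrDl. Qed.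

(** Splitting off the constant coefficient leaves another polynomial times X^(m+1), so the extra
    power makes the induction close. For a monomial, exp(1/x) >= x^-(m+1) / (m+1)! gives x^-m
    exp(-1/x) <= (m+1)! x. *)
Lemma flat_cvg0 p m : {for 0, continuous (flat (p * 'X^m))}.
Proof.
elim/poly_ind: p m => [|p c IH] m.
  rewrite mul0r; have -> : flat 0 = cst 0; last exact: cst_continuous.
  by apply/funext => x; rewrite /flat horner0 mul0r if_same.
have -> : flat ((p * 'X + c%:P) * 'X^m) =
    flat (p * 'X^(m.+1)) \+ flat (c%:P * 'X^m).
  by apply/funext => x; rewrite /= -flatD mulrDl -mulrA -exprS.
apply: continuousD; first exact: IH.
rewrite /prop_for /continuous_at (flat_le0 _ (lexx 0)).
apply/cvgrPdist_lt => e e0.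
pose K : R := (m.+1)`!%:R * `|c| + 1.
have K0 : 0 < K by rewrite ltr_wpDl// mulr_ge0.
have bound x : `|x| < e / K -> `|0 - flat (c%:P * 'X^m) x| < e.
  rewrite sub0r normrN /flat; case: ifPn => [x0|_ _]; last by rewrite normr0.
  rewrite (gtr0_norm x0) ltr_pdivlMr// => xe.
  rewrite hornerCM hornerXn !normrM (gtr0_norm (expR_gt0 _)) normrX.
  rewrite (gtr0_norm (_ : 0 < x^-1)) ?invr_gt0//.
  apply: le_lt_trans xe.
  have /= E := @expR_ge1Dxn R x^-1 m.
  have {}E : x^-1 ^+ m.+1 / (m.+1)`!%:R <= expR x^-1.
    by apply: le_trans (E _); [rewrite lerDr|rewrite invr_ge0 ltW].
  have {}E : x^-1 ^+ m * expR (- x^-1) <= x * (m.+1)`!%:R.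
    rewrite expRN ler_pdivrMr ?expR_gt0// mulrC -ler_pdivrMr; last first.
      by rewrite mulr_gt0// ltr0n fact_gt0.
    apply: le_trans E; rewrite exprS invfM mulrA; apply: ler_wpM2r; first by rewrite invr_ge0.
    by rewrite mulrC.
  rewrite -mulrA (le_trans (ler_wpM2l (normr_ge0 c) E))//.
  rewrite mulrCA ler_wpM2l ?(ltW x0)//.
  by rewrite /K mulrC lerDl.
near=> x; apply: bound; rewrite -[x]subr0 distrC; near: x.
by apply: (@cvgr_dist_lt _ _ _ (nbhs 0)); [exact: cvg_id|rewrite divr_gt0].
Unshelve. all: by end_near. Qed.

Lemma is_derive_flat p x :
  is_derive x 1 (flat p) (flat ('X^2 * (p - p^`()))%R x).
Proof.
have [x0|x0|->] := ltgtP x 0.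
- rewrite flat_le0 ?ltW//; apply: (near_eq_is_derive (f := cst 0)).
  by near=> y; rewrite flat_le0// ltW//; near: y; exact: lt_nbhsl.
- pose f y := p.[y^-1] * expR (- y^-1).
  apply: (near_eq_is_derive (f := f)).
    by near=> y; rewrite /flat ifT//; near: y; exact: lt_nbhsr.
  have xN0 : x != 0 by rewrite gt_eqF.
  have D1 : is_derive x 1 (fun y : R => y^-1) (- x ^- 2).
    have := is_deriveV xN0 (is_derive_id x (1 : R)).
    by rewrite /GRing.scale/= mulr1.
  have D2 := is_derive1_comp (f := horner p) (is_derive_poly p x^-1) D1.
  have D3 := is_derive1_comp (g := fun y : R => - y^-1) (is_derive_expR (- x^-1)) (is_deriveN D1).
  have := is_deriveM D2 D3; rewrite /GRing.scale/= opprK => D.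
  apply: is_derive_eq D _; rewrite /flat x0 !hornerE/=.
  by field.
(* At 0 the difference quotient of [flat p] is [flat] of [p] times X, which tends to 0. *)
- rewrite flat_le0//; apply/is_derive1_caratheodory; exists (flat (p * 'X^1)); split.
  + move=> z; rewrite subr0 (flat_le0 p (lexx 0)) subr0 /flat.
    case: ifPn => [z0|_]; last by rewrite mul0r.
    by rewrite hornerM hornerXn expr1 mulrAC divfK ?gt_eqF// mulrC; field; rewrite gt_eqF.
  + exact: flat_cvg0.
  + by rewrite flat_le0.
Unshelve. all: by end_near. Qed.

Lemma Cn_flat n p : Cn n (flat p).
Proof.
elim: n p => [|n IH] p; first by split=> // x; have [] := is_derive_flat p x.
by apply: Cn_is_derive (IH _) => x; exact: is_derive_flat.
Qed.

Definition bump c d x : R := flat 1 (x - c) * flat 1 (d - x).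

Lemma flat1_bnd x : 0 <= flat 1 x <= 1.
Proof.
rewrite /flat; case: ifPn => [x0|_]; last by rewrite lexx ler01.
by rewrite hornerC mul1r expR_ge0 -expR0 ler_expR oppr_le0 invr_ge0 ltW.
Qed.

Lemma bump_bnd c d x : 0 <= bump c d x <= 1.
Proof.
have /andP[? ?] := flat1_bnd (x - c); have /andP[? ?] := flat1_bnd (d - x).
by rewrite mulr_ge0// mulr_ile1.
Qed.

Lemma bump_gt0 c d x : c < x < d -> 0 < bump c d x.
Proof.
move=> /andP[cx xd].
by rewrite mulr_gt0// /flat subr_gt0 ?cx ?xd hornerC mul1r expR_gt0.
Qed.

Lemma bump_eq0 c d x : ~~ (c < x < d) -> bump c d x = 0.
Proof.
rewrite negb_and -!leNgt => /orP[xc|dx].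
  by rewrite /bump flat_le0 ?mul0r// subr_le0.
by rewrite /bump [X in _ * X]flat_le0 ?mulr0// subr_le0.
Qed.

Lemma Cn_bump n c d : Cn n (bump c d).
Proof.
apply: CnM.
  apply: Cn_ext (Cn_affine 1 0 c (Cn_flat n 1)) => x.
  by rewrite add0r mul1r.
apply: Cn_ext (Cn_affine (-1) 0 d (Cn_flat n 1)) => x.
by rewrite add0r mulN1r opprB.
Qed.

(** A smooth function with values in [0, 1] that tends pointwise to the indicator of ]c, d[ as [n]
    grows; with dominated convergence it does the work of cutoff functions and mollifiers. *)
Definition plateau c d n x : R := 1 - (1 - bump c d x) ^+ n.

Lemma plateau_bnd c d n x : 0 <= plateau c d n x <= 1.
Proof.
have /andP[b0 b1] := bump_bnd c d x.
have H : 0 <= 1 - bump c d x <= 1 by rewrite subr_ge0 b1 gerBl.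
have /andP[H0 H1] := H.
by rewrite subr_ge0 gerBl exprn_ge0// exprn_ile1.
Qed.

Lemma plateau_eq0 c d n x : ~~ (c < x < d) -> plateau c d n x = 0.
Proof. by move=> /bump_eq0 E; rewrite /plateau E subr0 expr1n subrr. Qed.

Lemma plateau_cvg c d x : c < x < d -> plateau c d n x @[n --> \oo] --> (1 : R).
Proof.
move=> xcd; rewrite -[X in _ --> X]subr0; apply: cvgB; first exact: cvg_cst.
apply: cvg_expr; have /andP[b0 b1] := bump_bnd c d x.
by rewrite ger0_norm ?subr_ge0// gtrBl bump_gt0.
Qed.

Lemma Cn_plateau n c d m : Cn n (plateau c d m).
Proof.
have H : Cn n (fun x => (1 - bump c d x) ^+ m).
  apply: CnX; apply: Cn_ext (CnD (Cn_cst n 1) (CnM (Cn_cst n (-1)) (Cn_bump n c d))) => x.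
  by rewrite /= mulN1r.
apply: Cn_ext (CnD (Cn_cst n 1) (CnM (Cn_cst n (-1)) H)) => x.
by rewrite /= mulN1r.
Qed.

End Smooth.

(** * Test functions, their primitives and the fundamental theorem of calculus *)

Section TestFunctions.
Context {R : realType}.
Notation mu := (@lebesgue_measure R).
Implicit Types (f g h : R -> R) (x y z c d : R) (n : nat).

Lemma test_functionI a b c d f : (forall n, Cn n f) -> a < c -> d < b ->
  (forall x, ~~ (c <= x <= d) -> f x = 0) -> test_function `]a, b[ f.
Proof.
move=> Cf ac db f0.
have sub : closure [set x | f x != 0] `<=` `[c, d].
  have /closure_id -> : closed `[c, d] by exact: interval_closed.
  apply: closure_subset => x /= fx; rewrite in_itv/=.
  by apply: contraT => /f0 fx0; rewrite fx0 eqxx in fx.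
split; first exact/CnP.
- apply: subclosed_compact sub; first exact: closed_closure.
  exact: segment_compact.
- move=> x /sub; rewrite /= !in_itv/= => /andP[cx xd].
  by rewrite (lt_le_trans ac cx) (le_lt_trans xd db).
Qed.

Lemma test_functionP a b f : a < b -> test_function `]a, b[ f ->
  (forall n, Cn n f) /\ exists c d, [/\ a < c, c < d, d < b &
    forall x, ~~ (c < x < d) -> f x = 0].
Proof.
move=> ab [/CnP Cf K sub]; split => //.
have [/eqP|/set0P K0] := eqVneq (closure [set x | f x != 0]) set0.
  (* Empty support: [f] is zero and any interior interval will do. *)
  move=> /eqP E; exists (a + (b - a) / 3), (a + 2 * (b - a) / 3); split; try lra.
  move=> x _; apply: contrapT => /eqP fx.
  by have : closure [set x | f x != 0] x by [exact: subset_closure]; rewrite E.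
have cid_ : {within closure [set x | f x != 0], continuous (id : R -> R)}.
  by apply: continuous_subspaceT => ?; exact: cvg_id.
have [d /set_mem dK dmax] := compact_EVT_max K0 K cid_.
have [c /set_mem cK cmin] := compact_EVT_min K0 K cid_.
have := sub _ dK; have := sub _ cK; rewrite /= !in_itv/= => /andP[ac _] /andP[_ db].
have cd : c <= d by apply: dmax; exact/mem_set.
(* [c] and [d] are the extreme points of the support; moving halfway towards [a] and [b] puts the
   support inside the open interval. *)
exists ((a + c) / 2), ((d + b) / 2); split; try lra.
move=> x; apply: contraNeq => fx.
have /mem_set xK : closure [set x | f x != 0] x by exact: subset_closure.
have := cmin _ xK; have := dmax _ xK => /= ? ?.
by apply/andP; split; lra.
Qed.

Lemma is_derive_eq_cst f x y : x <= y ->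
  (forall z, x <= z <= y -> is_derive z 1 f 0) -> f y = f x.
Proof.
rewrite le_eqVlt => /predU1P[->//|xy] H.
by have [z _ /eqP] := mean_value (df := fun=> 0) xy H; rewrite mul0r subr_eq0 => /eqP.
Qed.

(** The constant value on the right is the integral of [h], so the primitive has compact support
    exactly when [h] has mean zero. This is how test functions with a prescribed derivative are
    produced. *)
Lemma smooth_primitive h c d : (forall n, Cn n h) -> c <= d ->
  (forall x, ~~ (c < x < d) -> h x = 0) ->
  exists f, [/\ forall x, is_derive x 1 f (h x), forall n, Cn n f,
    forall x, x <= c -> f x = 0 & forall x, d <= x -> f x = f d].
Proof.
move=> Ch cd h0; have [F dF] := antiderivative (Cn_continuous (Ch 0%N)).
pose f x := F x - F c.
have df x : is_derive x 1 f (h x).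
  by have := is_deriveB (dF x) (is_derive_cst (F c) x (1 : R)); rewrite subr0.
exists f; split => //.
- by case=> [|n]; [split=> // x; have [] := df x|exact: Cn_is_derive (Ch n)].
- move=> x xc; apply/eqP; rewrite subr_eq0 eq_sym; apply/eqP.
  apply: is_derive_eq_cst => // z /andP[_ zc].
  by rewrite -(h0 z) ?dF// negb_and -leNgt zc.
- move=> x dx; congr (_ - _); apply: is_derive_eq_cst => // z /andP[dz _].
  by rewrite -(h0 z) ?dF// negb_and -!leNgt dz orbT.
Qed.

Lemma continuous_integrable_itvoo f a b : continuous f ->
  mu.-integrable `]a, b[ (EFin \o f).
Proof.
move=> cf; apply: integrableS (continuous_integrable_itv a b cf) => //.
exact: subset_itv_oo_cc.
Qed.

Lemma Rintegral_itvoo_cc f a b : mu.-integrable `[a, b] (EFin \o f) ->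
  \int[mu]_(x in `]a, b[) f x = \int[mu]_(x in `[a, b]) f x.
Proof.
move=> fi; rewrite Rintegral_itv_bndo_bndc; last first.
  by apply: integrableS fi => //; exact: subset_itv_oo_cc.
rewrite Rintegral_itv_obnd_cbnd//.
by apply: integrableS fi => //; apply: subset_itv; rewrite bnd_simp.
Qed.

Lemma ftc f g c d : c < d -> continuous f -> continuous g ->
  (forall x, c < x < d -> is_derive x 1 f (g x)) ->
  \int[mu]_(x in `]c, d[) g x = f d - f c.
Proof.
move=> cd cf cg df; rewrite Rintegral_itvoo_cc; last exact: continuous_integrable_itv.
rewrite /Rintegral (@continuous_FTC2 _ g f)//.
- exact: continuous_subspaceT.
- split.
  + by move=> x; rewrite in_itv/= => /df[].
  + exact/cvg_at_right_filter/cf.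
  + exact/cvg_at_left_filter/cf.
- by move=> x; rewrite in_itv/= derive1E => /df D; rewrite (@derive_val _ _ _ _ _ _ _ D).
Qed.

End TestFunctions.

(** * Sobolev functions on an interval *)

Section L1.
Context d (T : measurableType d) (R : realType).
Variables (mu : {measure set T -> \bar R}) (D : set T).
Hypothesis mD : measurable D.
Implicit Types (f g h k u v : T -> R) (C : R).

Lemma integrable_mulbnd h k C : measurable_fun D h ->
  (forall x, D x -> `|h x| <= C) -> mu.-integrable D (EFin \o k) ->
  mu.-integrable D (EFin \o (fun x => h x * k x)).
Proof.
move=> mh hC ik.
have bh : [bounded h x | x in D].
  by exists C; split; [exact: num_real|move=> M CM x /hC /le_trans; apply; exact: ltW].
by apply: (eq_integrable mD _ _ _ (integrableMr mD mh bh ik)) => x _; rewrite /= EFinM.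
Qed.

Lemma integrable_addr f g : mu.-integrable D (EFin \o f) ->
  mu.-integrable D (EFin \o g) -> mu.-integrable D (EFin \o (fun x => f x + g x)).
Proof. by move=> fi gi; apply: (eq_integrable mD _ _ _ (integrableD mD fi gi)) => //. Qed.

Lemma integrable_subr f g : mu.-integrable D (EFin \o f) ->
  mu.-integrable D (EFin \o g) -> mu.-integrable D (EFin \o (fun x => f x - g x)).
Proof. by move=> fi gi; apply: (eq_integrable mD _ _ _ (integrableB mD fi gi)) => //. Qed.

Lemma integrable_mulr (c : R) f : mu.-integrable D (EFin \o f) ->
  mu.-integrable D (EFin \o (fun x => c * f x)).
Proof. by move=> fi; apply: (eq_integrable mD _ _ _ (integrableZl mD c fi)). Qed.

Lemma integrable_normr f : mu.-integrable D (EFin \o f) ->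
  mu.-integrable D (EFin \o (fun x => `|f x|)).
Proof. exact: integrable_norm. Qed.

Lemma integrable_measurable f : mu.-integrable D (EFin \o f) -> measurable_fun D f.
Proof. by move=> /(measurable_int mu) /measurable_EFinP. Qed.

Lemma Rint_dominated_cvg (f_ : nat -> T -> R) f g :
  (forall n, measurable_fun D (f_ n)) ->
  (forall x, D x -> f_ n x @[n --> \oo] --> f x) ->
  mu.-integrable D (EFin \o g) ->
  (forall n x, D x -> `|f_ n x| <= g x) ->
  mu.-integrable D (EFin \o f) /\
  \int[mu]_(x in D) f_ n x @[n --> \oo] --> \int[mu]_(x in D) f x.
Proof.
move=> mf cf ig fg.
have mf' n : measurable_fun D (EFin \o f_ n) by exact/measurable_EFinP.
have cf' x : D x -> (EFin \o f_ n) x @[n --> \oo] --> (EFin \o f) x.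
  by move=> Dx; apply: cvg_EFin; [exact: nearW|exact: cf].
have fg' n x : D x -> (`|(EFin \o f_ n) x| <= (EFin \o g) x)%E.
  by move=> Dx; rewrite /= lee_fin fg.
have mfl : measurable_fun D (EFin \o f).
  by apply/measurable_EFinP; exact: measurable_fun_cvg cf.
have [fi _ H] := dominated_convergence mD mf' mfl (aeW _ cf') ig (aeW _ (fun x n => fg' n x)).
split => //; apply: fine_cvg; rewrite fineK; first exact: H.
exact: integrable_fin_num.
Qed.

Definition L1cvg (f_ : nat -> T -> R) f : Prop :=
  \int[mu]_(x in D) `|f_ n x - f x| @[n --> \oo] --> (0 : R).

Lemma L1cvg_mul (f_ : nat -> T -> R) f h C : measurable_fun D h ->
  (forall x, D x -> `|h x| <= C) ->
  (forall n, mu.-integrable D (EFin \o f_ n)) -> mu.-integrable D (EFin \o f) ->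
  L1cvg f_ f ->
  \int[mu]_(x in D) (h x * f_ n x) @[n --> \oo] --> \int[mu]_(x in D) (h x * f x).
Proof.
move=> mh hC fni fi ff; apply/cvgrPdistC_le => e e0.
have C1 : 0 < `|C| + 1 by rewrite ltr_wpDl.
have /cvgr0Pnorm_lt /(_ _ (divr_gt0 e0 C1)) := ff; apply: filterS => n Hn.
have hfn := integrable_mulbnd mh hC (fni n); have hf := integrable_mulbnd mh hC fi.
have dfi := integrable_subr (fni n) fi.
rewrite -RintegralB//.
rewrite (le_trans (le_normr_Rintegral _ _))//; first exact: integrable_subr.
apply: (@le_trans _ _ (\int[mu]_(x in D) ((`|C| + 1) * `|f_ n x - f x|))).
  apply: le_Rintegral => //.
  - by apply: integrable_normr; exact: integrable_subr.
  - by apply: integrable_mulr; exact: integrable_normr.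
  - move=> x Dx; rewrite -mulrBr normrM ler_wpM2r// (le_trans (hC _ Dx))//.
    by rewrite (le_trans (ler_norm C))// lerDl.
rewrite RintegralZl//; last exact: integrable_normr.
rewrite mulrC -ler_pdivlMr// (le_trans _ (ltW Hn))// ler_norm//.
Qed.

Lemma L1cvg_ae_eq (f_ : nat -> T -> R) f g :
  (forall n, mu.-integrable D (EFin \o f_ n)) ->
  mu.-integrable D (EFin \o f) -> mu.-integrable D (EFin \o g) ->
  L1cvg f_ f -> L1cvg f_ g -> ae_eq mu D f g.
Proof.
move=> fni fi gi ff fg.
have fgi := integrable_normr (integrable_subr fi gi).
have I0 : \int[mu]_(x in D) `|f x - g x| = 0.
  apply/eqP; rewrite eq_le Rintegral_ge0// andbT.
  have H : \int[mu]_(x in D) `|f_ n x - f x| + \int[mu]_(x in D) `|f_ n x - g x|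
      @[n --> \oo] --> (0 + 0 : R) by exact: cvgD.
  rewrite addr0 in H; rewrite -(cvg_lim _ H)//.
  apply: limr_ge; first by apply/cvg_ex; exists 0.
  apply: nearW => n.
  have i1 := integrable_normr (integrable_subr (fni n) fi).
  have i2 := integrable_normr (integrable_subr (fni n) gi).
  rewrite -RintegralD//; apply: le_Rintegral => //; first exact: integrable_addr.
  move=> x _; have -> : f x - g x = - ((f_ n x - f x) - (f_ n x - g x)) by ring.
  by rewrite normrN ler_normB.
have mfg := integrable_measurable fi; have mg := integrable_measurable gi.
have /ae_eq_integral_abs H : measurable_fun D (EFin \o (fun x => f x - g x)).
  by apply/measurable_EFinP; exact: measurable_funB.
have /(H mu mD) : (\int[mu]_(x in D) `|(EFin \o (fun x => (f x - g x)%R)) x| = 0)%E.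
  have := integrable_fin_num mD fgi; move: I0; rewrite /Rintegral /=.
  by case: (\int[mu]_(x in D) _)%E => //= r ->.
apply: filterS => x /= Hx Dx; have /eqP := Hx Dx.
by rewrite eqe subr_eq0 => /eqP.
Qed.

End L1.

(** * L^r on a bounded interval, compared with L^1 *)

Section Lr.
Context {R : realType}.
Notation mu := (@lebesgue_measure R).
Variables (a b r : R).
Hypotheses (ab : a < b) (r1 : 1 < r).
Notation D := (`]a, b[%classic : set (measurableTypeR R)).
Implicit Types (f g h k u v : R -> R) (C : R).

Let mD : measurable D. Proof. exact: measurable_itv. Qed.
Let r0 : 0 < r. Proof. exact: lt_trans r1. Qed.
Let muD : mu D = (b - a)%:E.
Proof. by rewrite lebesgue_measure_itv/= lte_fin ab. Qed.

Lemma normL_powE f : (normL D r f `^ r = \int[mu]_(x in D) (`|f x| `^ r)%:E)%E.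
Proof.
rewrite /normL poweR_Lnorm ?gt_eqF// [RHS]integral_mkcond.
apply: eq_integral => x _; rewrite /= !patchE.
by case: ifPn => // _; rewrite normr0 powR0// gt_eqF.
Qed.

Lemma normL_ge0 f : (0 <= normL D r f)%E.
Proof. exact: Lnorm_ge0. Qed.

Lemma memL_measurable f : memL D r f -> measurable_fun D f.
Proof. by rewrite /memL inE => /andP[/[!inE]/= mf _]; exact/measurable_restrictT. Qed.

Lemma memL_integrable_powR f : memL D r f ->
  mu.-integrable D (EFin \o (fun x => `|f x| `^ r)).
Proof.
move=> /(Lfun_integrable (ltW r1)) H.
apply: (eq_integrable mD (fun x => (`|(f \_ D) x| `^ r)%:E)) => //.
  by move=> x xD; rewrite patchE xD.
exact: integrableS H.
Qed.

Lemma integrable_cstD (c : R) : mu.-integrable D (EFin \o cst c).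
Proof.
by apply: continuous_integrable_itvoo; exact: cst_continuous.
Qed.

(** On a bounded interval |f|^s <= 1 + |f|^r provides an integrable majorant. *)
Lemma powR_integrable f : measurable_fun D f ->
  mu.-integrable D (EFin \o (fun x => `|f x| `^ r)) ->
  forall s, 0 < s <= r -> mu.-integrable D (EFin \o (fun x => `|f x| `^ s)).
Proof.
move=> mf H s /andP[s0 sr].
apply: (le_integrable mD (g := EFin \o (fun x => 1 + `|f x| `^ r))).
- apply/measurable_EFinP; apply: (measurableT_comp (measurable_powR s)).
  exact: measurableT_comp.
- move=> x _ /=; rewrite lee_fin (ger0_norm (powR_ge0 _ _)) [leRHS]ger0_norm ?addr_ge0 ?powR_ge0//.
  have [f1|f1] := leP `|f x| 1.
    rewrite (@le_trans _ _ 1) ?lerDl ?powR_ge0//.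
    have <- : (1 : R) `^ s = 1 by rewrite powR1.
    by rewrite ge0_ler_powR ?nnegrE ?(ltW s0).
  by rewrite (@le_trans _ _ (`|f x| `^ r)) ?lerDr// ler_powR// ltW.
- exact: integrable_addr (integrable_cstD 1) H.
Qed.

Lemma memL_integrable f : memL D r f -> mu.-integrable D (EFin \o f).
Proof.
move=> mf; have mm := memL_measurable mf.
have /= H := powR_integrable mm (memL_integrable_powR mf) (_ : 0 < 1 <= r).
apply: (le_integrable mD (g := EFin \o (fun x => `|f x| `^ 1))).
- exact/measurable_EFinP.
- by move=> x _ /=; rewrite lee_fin powRr1// normr_id.
- by apply: H; rewrite ltr01 ltW.
Qed.

Lemma integrable_memL f : measurable_fun D f ->
  mu.-integrable D (EFin \o (fun x => `|f x| `^ r)) -> memL D r f.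
Proof.
move=> mf H; rewrite /memL inE; apply/andP; split; rewrite inE/=.
  by apply/(measurable_restrictT _ mD).
rewrite /finite_norm -/(normL D r f).
have := integrable_fin_num mD H; rewrite -normL_powE => H'.
have := normL_ge0 f; case E : (normL D r f) => [x| |]//= _; first exact: ltry.
by move: H'; rewrite E poweRyr// gt_eqF.
Qed.

(* Hoelder's inequality against the constant 1. *)
Lemma Rintegral_le_normL f : memL D r f ->
  ((\int[mu]_(x in D) `|f x|)%:E <= normL D r f * ((b - a) `^ (1 - r^-1))%:E)%E.
Proof.
move=> mf; have fi := integrable_normr (memL_integrable mf).
have r'0 : 0 < (1 - r^-1)^-1 by rewrite invr_gt0 subr_gt0 invf_lt1.
have := @hoelder _ _ _ mu (f \_ D) (\1_D) r (1 - r^-1)^-1.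
move=> /(_ _ _ r0 r'0); rewrite invrK addrC subrK.
have m1 : measurable_fun setT (f \_ D).
  by apply/(measurable_restrictT _ mD); exact: memL_measurable.
have m2 : measurable_fun setT (\1_D : R -> R) by exact: measurable_indic.
move=> /(_ m1 m2 erefl).
have -> : 'N[mu]_1[(EFin \o ((f \_ D) \* \1_D)%R)]%E = (\int[mu]_(x in D) `|f x|)%:E.
  rewrite Lnorm1 fineK; last exact: integrable_fin_num.
  rewrite [RHS]integral_mkcond; apply: eq_integral => x _ /=.
  rewrite !patchE indicE; case: (x \in D); last by rewrite mul0r normr0.
  by rewrite mulr1.
have -> // : 'N[mu]_(1 - r^-1)^-1%:E[EFin \o \1_D]%E = ((b - a) `^ (1 - r^-1))%:E.
rewrite unlock invrK.
have -> : (\int[mu]_x `|(EFin \o \1_D) x| `^ (1 - r^-1)^-1 = mu D)%E.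
  rewrite -[mu D]mul1e -integral_cst// [RHS]integral_mkcond; apply: eq_integral => x _.
  rewrite /= patchE indicE; case: (x \in D); first by rewrite normr1 powR1.
  by rewrite normr0 powR0// gt_eqF.
by rewrite [X in (X `^ _)%E]muD poweR_EFin.
Qed.

Lemma normL_L1cvg (f_ : nat -> R -> R) f : (forall n, memL D r (f_ n \- f)) ->
  normL D r (f_ n \- f) @[n --> \oo] --> 0%E -> L1cvg mu D f_ f.
Proof.
move=> mf H; pose K : R := (b - a) `^ (1 - r^-1).
have HK : (normL D r (f_ n \- f)%R * K%:E)%E @[n --> \oo] --> 0%E.
  by rewrite -(mul0e K%:E); exact: cvgeZr.
have : (\int[mu]_(x in D) `|f_ n x - f x|)%:E @[n --> \oo] --> (0%:E : \bar R).
  apply: (squeeze_cvge _ (cvg_cst _) HK); apply: nearW => n.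
  by rewrite lee_fin Rintegral_ge0//; exact: (Rintegral_le_normL (mf n)).
by move=> /fine_cvg.
Qed.

(** A converse of [normL_L1cvg] under a uniform bound, since |f_n - f|^r is at most a constant times
    |f_n - f|. One L^1 estimate thus yields convergence for every exponent. *)
Lemma L1cvg_normL (f_ : nat -> R -> R) f C :
  (forall n, mu.-integrable D (EFin \o f_ n)) -> mu.-integrable D (EFin \o f) ->
  (forall n x, D x -> `|f_ n x - f x| <= C) ->
  L1cvg mu D f_ f -> normL D r (f_ n \- f) @[n --> \oo] --> 0%E.
Proof.
move=> fni fi bC ff.
have C1 : 0 < `|C| + 1 by rewrite ltr_wpDl.
have bC' n x : D x -> `|f_ n x - f x| `^ r <= (`|C| + 1) `^ (r - 1) * `|f_ n x - f x|.
  move=> Dx; rewrite -(mulr_powRB1 (normr_ge0 _) r0) mulrC ler_wpM2r//.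
  rewrite ge0_ler_powR ?nnegrE ?subr_ge0 ?(ltW r1) ?(ltW C1)//.
  by rewrite (le_trans (bC _ _ Dx))// (le_trans (ler_norm C))// lerDl.
have mfn n : measurable_fun D (fun x => f_ n x - f x).
  exact: integrable_measurable (integrable_subr mD (fni n) fi).
have ifn n : mu.-integrable D (EFin \o (fun x => `|f_ n x - f x| `^ r)).
  apply: (le_integrable mD (g := EFin \o (fun x => (`|C| + 1) `^ (r - 1) * `|f_ n x - f x|))).
  - apply/measurable_EFinP; apply: (measurableT_comp (measurable_powR r)).
    exact: measurableT_comp.
  - move=> x Dx /=; rewrite lee_fin ger0_norm ?powR_ge0//.
    by rewrite (le_trans (bC' _ _ Dx))// ler_norm.
  - by apply: integrable_mulr => //; apply: integrable_normr => //; exact: integrable_subr.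
pose I n : R := \int[mu]_(x in D) `|f_ n x - f x| `^ r.
have I0 n : 0 <= I n by apply: Rintegral_ge0 => x _; exact: powR_ge0.
have IE n : normL D r (f_ n \- f) = (`|I n| `^ r^-1)%:E.
  have := normL_powE (f_ n \- f); rewrite -[RHS]fineK; last exact: (integrable_fin_num mD (ifn n)).
  move=> E; rewrite -[LHS]poweRe1 ?normL_ge0// -(divff (lt0r_neq0 r0)) poweRrM E.
  by rewrite poweR_EFin (ger0_norm (I0 n)).
have cI : I n @[n --> \oo] --> (0 : R).
  have H : (`|C| + 1) `^ (r - 1) * \int[mu]_(x in D) `|f_ n x - f x| @[n --> \oo] --> (0 : R).
    by rewrite -(mulr0 ((`|C| + 1) `^ (r - 1))); apply: cvgM => //; exact: cvg_cst.
  apply: (squeeze_cvgr _ (cvg_cst _) H); apply: nearW => n; rewrite I0/=.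
  rewrite -RintegralZl//; last by apply: integrable_normr => //; exact: integrable_subr.
  apply: le_Rintegral => //; last exact: bC'.
  by apply: integrable_mulr => //; apply: integrable_normr => //; exact: integrable_subr.
have : (`|I n| `^ r^-1)%:E @[n --> \oo] --> ((`|0 : R| `^ r^-1)%:E : \bar R).
  apply: cvg_EFin; first exact: nearW.
  have rV0 : 0 < r^-1 by rewrite invr_gt0.
  exact: (cvg_comp _ _ cI (@continuous_normr_powR R _ rV0 0)).
rewrite normr0 powR0; last by rewrite invr_neq0// gt_eqF.
by under eq_fun do rewrite -IE.
Qed.

End Lr.

(** * Continuous representatives and a criterion for membership in W_0^{1,r} *)

Section Sobolev.
Context {R : realType}.
Notation mu := (@lebesgue_measure R).
Variables (a b : R).
Hypothesis ab : a < b.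
Notation D := (`]a, b[%classic : set (measurableTypeR R)).
Implicit Types (f g h u v du : R -> R) (r c d C x y : R).

Let mD : measurable D. Proof. exact: measurable_itv. Qed.
Let muD : mu D = (b - a)%:E.
Proof. by rewrite lebesgue_measure_itv/= lte_fin ab. Qed.

Lemma continuous_supp_bounded f c d : continuous f ->
  (forall x, ~~ (c < x < d) -> f x = 0) -> exists C, forall x, `|f x| <= C.
Proof.
move=> cf f0; have [cd|dc] := leP c d; last first.
  exists 0 => x; rewrite f0 ?normr0//; apply/negP => /andP[/lt_trans /[apply]].
  by move=> /(lt_trans dc); rewrite ltxx.
have cnf : {within `[c, d], continuous (fun x => `|f x|)}.
  by apply: continuous_subspaceT => x; apply: continuous_comp; [exact: cf|exact: norm_continuous].
have [z _ zmax] := EVT_max cd cnf; exists `|f z| => x.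
have [/andP[cx xd]|/f0 ->] := boolP (c < x < d); last by rewrite normr0.
by apply: zmax; rewrite in_itv/= !ltW.
Qed.

Lemma test_is_derive f x : test_function D f -> is_derive x 1 f (f^`()%classic x).
Proof.
by move=> /(test_functionP ab)[/(_ 0%N) Cf _]; apply: derivable_is_derive1; exact: Cn_derivable Cf.
Qed.

Lemma test_continuous f : test_function D f -> continuous f.
Proof. by move=> /(test_functionP ab)[/(_ 0%N) /Cn_continuous]. Qed.

Lemma test_derive_continuous f : test_function D f -> continuous (f^`())%classic.
Proof. by move=> /(test_functionP ab)[/(_ 1%N) /Cn_derive /Cn_continuous]. Qed.

Lemma test_eq0 f x : test_function D f -> ~~ (a < x < b) -> f x = 0.
Proof.
move=> /(test_functionP ab)[_ [c [d [ac cd db f0]]]] xab; apply: f0.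
apply: contra xab => /andP[cx xd].
by rewrite (lt_trans ac cx) (lt_trans xd db).
Qed.

Lemma test_bounded f : test_function D f -> exists C, forall x, `|f x| <= C.
Proof.
move=> tf; apply: (continuous_supp_bounded (test_continuous tf)) => x.
exact: test_eq0.
Qed.

Lemma test_derive_supp f : test_function D f -> exists c d, [/\ a < c, c < d, d < b &
  forall x, ~~ (c < x < d) -> f x = 0 /\ f^`()%classic x = 0].
Proof.
move=> /(test_functionP ab)[_ [c [d [ac cd db f0]]]].
(* Outside the enlarged interval [f] vanishes on a whole neighbourhood of the point, hence so does
   its derivative there. *)
exists ((a + c) / 2), ((d + b) / 2); split; try lra.
move=> x xcd; split.
  by apply: f0; apply: contra xcd => /andP[? ?]; apply/andP; split; lra.
rewrite derive1E (near_eq_derive (g := cst 0)) ?derive_cst//.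
move: xcd; rewrite negb_and -!leNgt => /orP[xc|dx].
  have {}xc : x < c by lra.
  near=> y; apply: f0; rewrite negb_and -!leNgt; apply/orP; left; apply/ltW.
  by near: y; exact: lt_nbhsl.
have {}dx : d < x by lra.
near=> y; apply: f0; rewrite negb_and -!leNgt; apply/orP; right; apply/ltW.
by near: y; exact: lt_nbhsr.
Unshelve. all: by end_near. Qed.

Lemma test_derive_bounded f : test_function D f ->
  exists C, forall x, `|f^`()%classic x| <= C.
Proof.
move=> tf; have [c [d [_ _ _ f0]]] := test_derive_supp tf.
by apply: (continuous_supp_bounded (test_derive_continuous tf)) => x /f0[].
Qed.

Lemma test_integrable f : test_function D f -> mu.-integrable D (EFin \o f).
Proof. by move=> /test_continuous; exact: continuous_integrable_itvoo. Qed.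

Lemma test_derive_integrable f : test_function D f ->
  mu.-integrable D (EFin \o (f^`())%classic).
Proof. by move=> /test_derive_continuous; exact: continuous_integrable_itvoo. Qed.

Lemma test_by_parts f g : test_function D f -> test_function D g ->
  \int[mu]_(x in D) (f x * (g^`())%classic x) =
  - \int[mu]_(x in D) ((f^`())%classic x * g x).
Proof.
move=> tf tg; have cf := test_continuous tf; have cg := test_continuous tg.
have cf' := test_derive_continuous tf; have cg' := test_derive_continuous tg.
have cM h k : continuous h -> continuous k -> continuous (fun x : R => h x * k x).
  by move=> ch ck x; apply: (continuousM (s := h) (t := k)); [exact: ch|exact: ck].
apply/eqP; rewrite -addr_eq0 -RintegralD//; first last.
- exact: continuous_integrable_itvoo (cM _ _ cf' cg).
- exact: continuous_integrable_itvoo (cM _ _ cf cg').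
pose fg' x := f x * (g^`())%classic x + (f^`())%classic x * g x.
have H : \int[mu]_(x in D) fg' x = f b * g b - f a * g a.
  apply: (ftc (f := fun x => f x * g x) (g := fg') ab); first exact: cM.
    move=> x; exact: (continuousD (cM _ _ cf cg' x) (cM _ _ cf' cg x)).
  move=> x _; have := is_deriveM (test_is_derive x tf) (test_is_derive x tg).
  by rewrite /GRing.scale/= [g x * _]mulrC.
by rewrite H !(test_eq0 tf) ?ltxx ?andbF// !mul0r subrr.
Qed.

Lemma memLB r f g : 1 < r -> memL D r f -> memL D r g -> memL D r (f \- g).
Proof.
move=> r1 Lf Lg; have r0 : 0 < r by rewrite (lt_trans ltr01).
have mf := memL_measurable Lf; have mg := memL_measurable Lg.
have mfg : measurable_fun D (f \- g) by exact: measurable_funB.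
apply: integrable_memL => //.
apply: (le_integrable mD (g := EFin \o (fun x => 2 `^ r * (`|f x| `^ r + `|g x| `^ r)))).
- apply/measurable_EFinP; apply: (measurableT_comp (measurable_powR r)).
  exact: measurableT_comp.
- move=> x _ /=; rewrite lee_fin (ger0_norm (powR_ge0 _ _)).
  rewrite [leRHS]ger0_norm ?mulr_ge0 ?addr_ge0 ?powR_ge0//.
  have H (s t : R) : 0 <= s -> s <= t -> (s + t) `^ r <= 2 `^ r * (s `^ r + t `^ r).
    move=> s0 st; have t0 := le_trans s0 st.
    rewrite (@le_trans _ _ ((2 * t) `^ r))//.
      by rewrite ge0_ler_powR ?nnegrE ?addr_ge0 ?mulr_ge0 ?(ltW r0)//; lra.
    by rewrite powRM// ler_wpM2l ?powR_ge0// lerDr powR_ge0.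
  rewrite (@le_trans _ _ ((`|f x| + `|g x|) `^ r))//.
    by rewrite ge0_ler_powR ?nnegrE ?addr_ge0 ?(ltW r0)//; exact: ler_normB.
  have [fg|/ltW gf] := leP `|f x| `|g x|; first exact: H.
  by rewrite addrC [X in _ * X]addrC H.
- apply: integrable_mulr => //; apply: integrable_addr => //; exact: memL_integrable_powR.
Qed.

Lemma continuous_powR_integrable f r : 0 < r -> continuous f ->
  mu.-integrable D (EFin \o (fun x => `|f x| `^ r)).
Proof.
move=> r0 cf; apply: continuous_integrable_itvoo => x.
exact: continuous_comp (cf x) (continuous_normr_powR r0 (x := f x)).
Qed.

Lemma continuous_memL f r : 1 < r -> continuous f -> memL D r f.
Proof.
move=> r1 cf; apply: integrable_memL => //.
  exact: integrable_measurable (continuous_integrable_itvoo a b cf).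
by apply: continuous_powR_integrable => //; rewrite (lt_trans ltr01).
Qed.

(** What is retained from the definition of W_0^{1,r}: integrability, and L^1 approximation by test
    functions together with their derivatives. *)
Lemma W10_approx r u du : 1 < r -> W10 D r u du ->
  [/\ mu.-integrable D (EFin \o u), mu.-integrable D (EFin \o du),
      mu.-integrable D (EFin \o (fun x => `|du x| `^ r)) &
      exists f_ : nat -> R -> R, [/\ forall n, test_function D (f_ n),
        L1cvg mu D f_ u & L1cvg mu D (fun n => (f_ n)^`()%classic) du]].
Proof.
move=> r1 [[Lu Ldu _] [f_ [tf fu fdu]]]; split.
- exact: memL_integrable Lu.
- exact: memL_integrable Ldu.
- exact: memL_integrable_powR Ldu.
exists f_; split => //.
- apply: (normL_L1cvg ab r1) fu => n; apply: memLB => //.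
  by apply: continuous_memL => //; exact: test_continuous.
- apply: (normL_L1cvg ab r1) fdu => n; apply: memLB => //.
  by apply: continuous_memL => //; exact: test_derive_continuous.
Qed.

Lemma Rintegral_subset_le f (E : set R) : measurable (E : set (measurableTypeR R)) ->
  E `<=` D -> mu.-integrable D (EFin \o f) ->
  `|\int[mu]_(x in E) f x| <= \int[mu]_(x in D) `|f x|.
Proof.
move=> mE ED fi; have fiE : mu.-integrable E (EFin \o f) by exact: integrableS fi.
rewrite (le_trans (le_normr_Rintegral _ _))//.
have nfi := integrable_normr fi; have nfiE := integrable_normr fiE.
rewrite -lee_fin !fineK ?integrable_fin_num//.
apply: ge0_subset_integral => //; exact: measurable_int nfi.
Qed.

(** Intersecting with the domain makes the primitive of [du] meaningful at every real [x], so the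
    continuous representative is defined on the whole line. *)
Let below x : set (measurableTypeR R) := D `&` `]-oo, x[.

Let m_below x : measurable (below x).
Proof. by apply: measurableI => //; exact: measurable_itv. Qed.

Let below_lo x : x <= a -> below x = set0.
Proof.
move=> xa; apply/seteqP; split => // y [] /=; rewrite !in_itv/= => /andP[ay _] yx.
by move: (lt_trans ay yx); rewrite ltNge xa.
Qed.

Let below_mid x : x <= b -> below x = `]a, x[%classic.
Proof.
move=> xb; apply/seteqP; split => y /=; rewrite /below /= !in_itv/=.
  by move=> [/andP[-> _] ->].
by move=> /andP[-> yx]; rewrite yx (lt_le_trans yx xb).
Qed.

Let below_hi x : b <= x -> below x = D.
Proof.
move=> bx; apply/seteqP; split => y; first by case.
by rewrite /below /= !in_itv/= => /andP[-> yb]; rewrite yb (lt_le_trans yb bx).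
Qed.

Let test_below f x : test_function D f -> f x = \int[mu]_(t in below x) (f^`())%classic t.
Proof.
move=> tf; have cf := test_continuous tf; have cf' := test_derive_continuous tf.
have dft t : a < t < x -> is_derive t 1 f ((f^`())%classic t).
  by move=> _; exact: test_is_derive.
have [xa|ax] := leP x a.
  by rewrite below_lo// Rintegral_set0 (test_eq0 tf)// negb_and -!leNgt xa.
have fa : f a = 0 by rewrite (test_eq0 tf)// ltxx.
have [xb|bx] := leP x b.
  by rewrite below_mid// (ftc ax cf cf' dft) fa subr0.
have dfab t : a < t < b -> is_derive t 1 f ((f^`())%classic t).
  by move=> _; exact: test_is_derive.
rewrite below_hi ?(ltW bx)// (ftc ab cf cf' dfab) fa subr0 !(test_eq0 tf)// ?ltxx ?andbF//.
by rewrite negb_and -!leNgt (ltW bx) orbT.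
Qed.

(** A test function is the primitive of its derivative, so [f_ n] converges uniformly to the
    primitive [U] of [du], at the rate of the L^1 distance of the derivatives. Continuity and
    vanishing outside the domain pass to the limit, and [U] agrees with [u] by uniqueness of L^1
    limits. *)
Lemma W10_continuous r u du : 1 < r -> W10 D r u du ->
  exists U, [/\ continuous U, forall x, ~~ (a < x < b) -> U x = 0,
    ae_eq mu D u U &
    forall x, a <= x <= b -> U x = \int[mu]_(t in `]a, x[) du t].
Proof.
move=> r1 /(W10_approx r1)[ui dui _ [f_ [tf fu fdu]]].
pose U x : R := \int[mu]_(t in below x) du t.
have f'i n := test_derive_integrable (tf n).
have unif n x : `|f_ n x - U x| <= \int[mu]_(t in D) `|(f_ n)^`()%classic t - du t|.
  rewrite (test_below x (tf n)) -RintegralB//; last 2 first.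
  - by apply: integrableS (f'i n) => // ? [].
  - by apply: integrableS dui => // ? [].
  apply: Rintegral_subset_le => //; first by move=> ? [].
  exact: integrable_subr.
have Ucvg x : f_ n x @[n --> \oo] --> U x.
  apply/cvgrPdistC_le => e e0; move/cvgr0Pnorm_lt : fdu => /(_ _ e0).
  by apply: filterS => n H; rewrite (le_trans (unif n x))// (le_trans (ler_norm _))// ltW.
have cU : continuous U.
  move=> x; apply/cvgrPdist_lt => e e0; have e3 : 0 < e / 3 by rewrite divr_gt0.
  move/cvgr0Pnorm_lt : (fdu) => /(_ _ e3) [N _ /(_ N (leqnn N)) /=] HN.
  have {HN} HN y : `|f_ N y - U y| < e / 3.
    by rewrite (le_lt_trans (unif N y))// (le_lt_trans (ler_norm _)).
  have /cvgrPdist_lt /(_ _ e3) := test_continuous (tf N) (x := x).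
  apply: filterS => y Hy.
  have -> : U x - U y = - (f_ N x - U x) + ((f_ N x - f_ N y) + (f_ N y - U y)) by ring.
  rewrite (le_lt_trans (ler_normD _ _))// normrN.
  rewrite (le_lt_trans (lerD (lexx _) (ler_normD _ _)))//.
  by have := HN x; have := HN y; lra.
exists U; split => //.
- move=> x xab; have H : f_ n x @[n --> \oo] --> (0 : R).
    by apply: cvg_near_cst; apply: nearW => n; apply/eqP; rewrite (test_eq0 (tf n) xab).
  exact: cvg_unique (Ucvg x) H.
- apply: (L1cvg_ae_eq mD (f_ := f_)) => //.
  + by move=> n; exact: test_integrable.
  + exact: continuous_integrable_itvoo.
  rewrite /L1cvg; pose I n : R := \int[mu]_(t in D) `|(f_ n)^`()%classic t - du t|.
  have H : I n * (b - a) @[n --> \oo] --> (0 : R).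
    by rewrite -(mul0r (b - a)); apply: cvgM => //; exact: cvg_cst.
  apply: (squeeze_cvgr _ (cvg_cst _) H); apply: nearW => n.
  have ic : mu.-integrable D (EFin \o (fun x => `|f_ n x - U x|)).
    apply: integrable_normr; apply: integrable_subr => //; first exact: test_integrable.
    exact: continuous_integrable_itvoo.
  have -> : I n * (b - a) = \int[mu]_(t in D) I n.
    by rewrite Rintegral_cst//; congr (_ * _); rewrite -[LHS]/(fine (b - a)%:E) -muD.
  rewrite Rintegral_ge0//=; apply: le_Rintegral => //.
    exact: (integrable_cstD a b (I n)).
  by move=> x _; exact: unif.
- by move=> x /andP[_ xb]; rewrite /U (below_mid xb).
Qed.

(** The hypotheses do not mention [r]. Uniform bounds upgrade L^1 convergence to L^r, and the weak
    derivative identity is the limit of integration by parts for the [f_ n]. *)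
Lemma W10_intro r u du (f_ : nat -> R -> R) C : 1 < r ->
  measurable_fun D u -> measurable_fun D du ->
  (forall n, test_function D (f_ n)) ->
  (forall x, D x -> `|u x| <= C /\ `|du x| <= C) ->
  (forall n x, D x -> `|f_ n x| <= C /\ `|(f_ n)^`()%classic x| <= C) ->
  L1cvg mu D f_ u -> L1cvg mu D (fun n => (f_ n)^`()%classic) du ->
  W10 D r u du.
Proof.
move=> r1 mu_ mdu tf bu bf fu fdu; have r0 : 0 < r by rewrite (lt_trans ltr01).
have bint v : measurable_fun D v -> (forall x, D x -> `|v x| <= C) ->
    mu.-integrable D (EFin \o v).
  move=> mv bv; apply: (le_integrable mD (g := EFin \o cst C)).
  - exact/measurable_EFinP.
  - by move=> x Dx; rewrite /= lee_fin (le_trans (bv _ Dx))// ler_norm.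
  - exact: integrable_cstD.
have ui : mu.-integrable D (EFin \o u) by apply: bint => // x /bu[].
have dui : mu.-integrable D (EFin \o du) by apply: bint => // x /bu[].
have bmem v : measurable_fun D v -> (forall x, D x -> `|v x| <= C) -> memL D r v.
  move=> mv bv; apply: integrable_memL => //.
  apply: (le_integrable mD (g := EFin \o cst (C `^ r))).
  - apply/measurable_EFinP; apply: (measurableT_comp (measurable_powR r)).
    exact: measurableT_comp.
  - move=> x Dx; rewrite /= lee_fin (ger0_norm (powR_ge0 C r)) (ger0_norm (powR_ge0 _ _)).
    have C0 : 0 <= C by rewrite (le_trans _ (bv _ Dx)).
    by rewrite ge0_ler_powR ?nnegrE ?(ltW r0)// bv.
  - exact: integrable_cstD.
have fi n := test_integrable (tf n); have f'i n := test_derive_integrable (tf n).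
split; first split.
- by apply: bmem => // x /bu[].
- by apply: bmem => // x /bu[].
- move=> f ft.
  have [C1 bf1] := test_bounded ft; have [C2 bf2] := test_derive_bounded ft.
  have mf := integrable_measurable (test_integrable ft).
  have mf' := integrable_measurable (test_derive_integrable ft).
  have H1 := L1cvg_mul mD mf' (fun x _ => bf2 x) fi ui fu.
  have H2 := cvgN (L1cvg_mul mD mf (fun x _ => bf1 x) f'i dui fdu).
  have -> : \int[mu]_(x in D) (u x * f^`()%classic x) =
      \int[mu]_(x in D) (f^`()%classic x * u x).
    by apply: eq_Rintegral => x _; rewrite mulrC.
  have -> : \int[mu]_(x in D) (du x * f x) = \int[mu]_(x in D) (f x * du x).
    by apply: eq_Rintegral => x _; rewrite mulrC.
  have E : (fun n => \int[mu]_(x in D) (f^`()%classic x * f_ n x)) =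
      (fun n => - \int[mu]_(x in D) (f x * (f_ n)^`()%classic x)).
    by apply/funext => n; rewrite test_by_parts// opprK.
  have H3 : \int[mu]_(x in D) (f^`()%classic x * f_ n x) @[n --> \oo]
      --> - \int[mu]_(x in D) (f x * du x) by rewrite E; exact: H2.
  exact: cvg_unique H1 H3.
exists f_; split => //.
- apply: (L1cvg_normL r1 (C := C + C) _ _ _ fu) => // n x Dx.
  by rewrite (le_trans (ler_normB _ _))// lerD// ?(bf n x Dx).1 ?(bu x Dx).1.
- apply: (L1cvg_normL r1 (C := C + C) _ _ _ fdu) => // n x Dx.
  by rewrite (le_trans (ler_normB _ _))// lerD// ?(bf n x Dx).2 ?(bu x Dx).2.
Qed.

Lemma test_W10 r f : 1 < r -> test_function D f -> W10 D r f (f^`())%classic.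
Proof.
move=> r1 tf; have [C1 b1] := test_bounded tf; have [C2 b2] := test_derive_bounded tf.
have bC x : `|f x| <= Num.max C1 C2 /\ `|f^`()%classic x| <= Num.max C1 C2.
  by split; rewrite le_max ?b1 ?b2 ?orbT.
have L0 g : L1cvg mu D (fun=> g) g.
  rewrite /L1cvg; apply: cvg_near_cst; apply: nearW => n; apply/eqP.
  by under eq_Rintegral do rewrite subrr normr0; rewrite Rintegral_cst// mul0r.
apply: (W10_intro (f_ := fun=> f) (C := Num.max C1 C2)) => //.
- exact: integrable_measurable (test_integrable tf).
- exact: integrable_measurable (test_derive_integrable tf).
Qed.

End Sobolev.

(** * Smooth approximation of continuous functions in L^1 *)

Section Density.
Context {R : realType}.
Notation mu := (@lebesgue_measure R).
Notation oo c d := (`]c, d[%classic : set (measurableTypeR R)).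
Implicit Types (f g h u v du : R -> R) (r a b c d C M x y : R).

Let m_oo c d : measurable (oo c d). Proof. exact: measurable_itv. Qed.

Let mu_oo c d : c <= d -> fine (mu (oo c d)) = d - c.
Proof.
rewrite le_eqVlt => /predU1P[->|cd].
  by rewrite set_itv_ge ?bnd_simp// measure0 subrr.
by rewrite lebesgue_measure_itv/= lte_fin cd.
Qed.

Lemma Rintegral_cst_oo c d (k : R) : c <= d -> \int[mu]_(x in oo c d) k = k * (d - c).
Proof. by move=> cd; rewrite Rintegral_cst// -(mu_oo cd). Qed.

Lemma ge0_Rintegral_subset f c d c' d' : c <= c' -> d' <= d ->
  mu.-integrable (oo c d) (EFin \o f) -> (forall x, 0 <= f x) ->
  \int[mu]_(x in oo c' d') f x <= \int[mu]_(x in oo c d) f x.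
Proof.
move=> cc dd fi f0; have sub : oo c' d' `<=` oo c d.
  by move=> x /=; rewrite !in_itv/= => /andP[/(le_lt_trans cc) -> /lt_le_trans ->].
have fi' : mu.-integrable (oo c' d') (EFin \o f) by exact: integrableS fi.
rewrite -lee_fin !fineK ?integrable_fin_num//.
apply: ge0_subset_integral => //; first exact: measurable_int fi.
by move=> x _; rewrite lee_fin.
Qed.

Lemma plateau_approx c d (e : R) : c < d -> 0 < e ->
  exists chi c' d', [/\ forall n, Cn n chi, c < c', d' < d,
    forall x, ~~ (c' < x < d') -> chi x = 0 &
    (forall x, 0 <= chi x <= 1) /\
    \int[mu]_(x in oo c d) (1 - chi x) <= e].
Proof.
move=> cd e0; pose s := Num.min (e / 4) ((d - c) / 4).
have s0 : 0 < s by rewrite lt_min !divr_gt0// subr_gt0.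
have se : s <= e / 4 by rewrite ge_min lexx.
have sd : s <= (d - c) / 4 by rewrite ge_min lexx orbT.
pose c' := c + s; pose d' := d - s.
have cd' : c' < d' by rewrite /c' /d'; lra.
pose chi := plateau c' d'.
have ci n : mu.-integrable (oo c d) (EFin \o chi n).
  by apply: continuous_integrable_itvoo; exact: Cn_continuous (Cn_plateau 0 c' d' n).
have sub : oo c' d' `<=` oo c d.
  move=> x /=; rewrite !in_itv/= /c' /d' => /andP[? ?]; apply/andP; split; lra.
have cvg1 : \int[mu]_(x in oo c' d') chi n x @[n --> \oo] --> \int[mu]_(x in oo c' d') (1 : R).
  apply: (Rint_dominated_cvg (m_oo c' d') (g := cst 1) _ _ _ _).2.
  - by move=> n; apply: integrable_measurable (integrableS _ _ sub (ci n)).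
  - by move=> x /=; rewrite in_itv/=; exact: plateau_cvg.
  - exact: integrable_cstD.
  - by move=> n x _; have /andP[p0 p1] := plateau_bnd c' d' n x; rewrite ger0_norm.
rewrite (Rintegral_cst_oo _ (ltW cd')) mul1r in cvg1.
have [N _ /(_ N (leqnn N)) /= HN] : \forall n \near \oo,
    (d' - c') - e / 2 < \int[mu]_(x in oo c' d') chi n x.
  by apply: (cvgr_gt _ cvg1); lra.
exists (chi N), c', d'; split => //.
- by move=> n; exact: Cn_plateau.
- by rewrite /c' ltrDl.
- by rewrite /d' gtrBl.
- by move=> x; exact: plateau_eq0.
split; first by move=> x; exact: plateau_bnd.
rewrite RintegralB//; last exact: integrable_cstD.
rewrite (Rintegral_cst_oo _ (ltW cd)) mul1r.
have : \int[mu]_(x in oo c' d') chi N x <= \int[mu]_(x in oo c d) chi N x.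
  apply: ge0_Rintegral_subset => //; rewrite /c' /d'; try lra.
  by move=> x; have /andP[] := plateau_bnd c' d' N x.
by move: HN; rewrite /c' /d'; lra.
Qed.

(** The error allowed is proportional to the length, so that errors on adjacent intervals add up
    correctly. The support stays strictly inside, so that pieces can be joined smoothly. *)
Definition smooth_approx_on g M (e : R) a t : Prop :=
  exists h c d, [/\ forall n, Cn n h, a < c, d < t,
    forall x, ~~ (c < x < d) -> h x = 0 &
    (forall x, `|h x| <= M) /\
    \int[mu]_(x in oo a t) `|g x - h x| <= e * (t - a)].

Lemma smooth_approx_cell g M (e k : R) x y : continuous g -> x < y -> 0 < e ->
  `|k| <= M -> (forall t, x < t < y -> `|g t - k| <= e / 2) ->
  smooth_approx_on g M e x y.
Proof.
move=> cg xy e0 kM gk; have k1 : 0 < `|k| + 1 by rewrite ltr_wpDl.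
have e'0 : 0 < e * (y - x) / 2 / (`|k| + 1) by rewrite !divr_gt0// mulr_gt0// subr_gt0.
have [chi [c [d [Cchi xc dy chi0 [chi1 Ichi]]]]] := plateau_approx xy e'0.
exists (fun t => k * chi t), c, d; split => //.
- by move=> n; apply: (CnM (f := cst k)) => //; exact: Cn_cst.
- by move=> t /chi0 ->; rewrite mulr0.
split.
  move=> t; have /andP[p0 p1] := chi1 t.
  by rewrite normrM (ger0_norm p0) (le_trans _ kM)// ler_piMr.
have cchi : continuous chi := Cn_continuous (Cchi 0%N).
have ci1 : mu.-integrable (oo x y) (EFin \o (fun t => 1 - chi t)).
  apply: integrable_subr => //; [exact: integrable_cstD|exact: continuous_integrable_itvoo].
have ci2 : mu.-integrable (oo x y) (EFin \o (fun t => g t - k * chi t)).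
  apply: integrable_subr => //; first exact: continuous_integrable_itvoo.
  by apply: integrable_mulr => //; exact: continuous_integrable_itvoo.
apply: (@le_trans _ _ (\int[mu]_(t in oo x y) (e / 2 + `|k| * (1 - chi t)))).
  apply: le_Rintegral => //; first exact: integrable_normr.
    apply: integrable_addr => //; first exact: integrable_cstD.
    exact: integrable_mulr.
  move=> t; rewrite /= in_itv/= => txy; have /andP[p0 p1] := chi1 t.
  have -> : g t - k * chi t = (g t - k) + k * (1 - chi t) by ring.
  rewrite (le_trans (ler_normD _ _))// lerD ?gk// normrM [X in _ * X]ger0_norm//.
  by rewrite subr_ge0.
rewrite RintegralD//; last 2 first.
- exact: integrable_cstD.
- exact: integrable_mulr.
rewrite (Rintegral_cst_oo _ (ltW xy)) RintegralZl//.
have H : `|k| * \int[mu]_(t in oo x y) (1 - chi t) <= e * (y - x) / 2.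
  rewrite (le_trans (ler_wpM2l (normr_ge0 k) Ichi))//.
  by rewrite mulrCA ger_pMr ?divr_gt0 ?mulr_gt0 ?subr_gt0// ler_pdivrMr// mul1r lerDl.
by move: H; lra.
Qed.

Lemma Rintegral_oo_split f a x y : a <= x -> x <= y -> continuous f ->
  \int[mu]_(t in oo a y) f t = \int[mu]_(t in oo a x) f t + \int[mu]_(t in oo x y) f t.
Proof.
move=> ax xy cf; have ic c d := continuous_integrable_itv c d cf.
by rewrite !Rintegral_itvoo_cc// (Rintegral_itv_split ax xy).
Qed.

(** The supports lie on different sides of [x], so the sum of the two pieces is still bounded by
    [M]. *)
Lemma smooth_approx_cat g M (e : R) a x y : continuous g -> 0 <= M -> a <= x -> x < y ->
  smooth_approx_on g M e a x -> smooth_approx_on g M e x y -> smooth_approx_on g M e a y.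
Proof.
move=> cg M0 ax xy [h1 [c1 [d1 [C1 ac1 d1x h10 [M1 I1]]]]].
move=> [h2 [c2 [d2 [C2 xc2 d2y h20 [M2 I2]]]]].
have h1x t : x <= t -> h1 t = 0.
  by move=> xt; apply: h10; rewrite negb_and -!leNgt (ltW (lt_le_trans d1x xt)) orbT.
have h2x t : t <= x -> h2 t = 0.
  by move=> tx; apply: h20; rewrite negb_and -!leNgt (ltW (le_lt_trans tx xc2)).
exists (fun t => h1 t + h2 t), (Num.min c1 c2), (Num.max d1 d2); split.
- by move=> n; exact: CnD.
- by rewrite lt_min ac1 (le_lt_trans ax).
- by rewrite gt_max d2y (lt_trans d1x).
- move=> t; rewrite negb_and -!leNgt le_min ge_max => H.
  rewrite h10 ?h20 ?addr0//; rewrite negb_and -!leNgt.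
    by case/orP: H => /andP[H1 H2]; rewrite ?H1 ?H2 ?orbT.
  by case/orP: H => /andP[H1 H2]; rewrite ?H1 ?H2 ?orbT.
split.
  by move=> t; have [tx|/ltW xt] := leP t x; [rewrite h2x// addr0|rewrite h1x// add0r].
have cn h : (forall n, Cn n h) -> continuous (fun t => `|g t - h t|).
  move=> Ch t; have ch := Cn_continuous (Ch 0%N) (x := t).
  exact: continuous_comp (continuousB (cg t) ch) (@norm_continuous _ R _).
rewrite (Rintegral_oo_split ax (ltW xy)); last by apply: cn => n; exact: CnD.
have -> : e * (y - a) = e * (x - a) + e * (y - x) by ring.
apply: lerD.
  rewrite (_ : \int[mu]_(t in oo a x) _ = \int[mu]_(t in oo a x) `|g t - h1 t|)//.
  by apply: eq_Rintegral => t /[!inE]/=; rewrite in_itv/= => /andP[_ /ltW tx]; rewrite h2x// addr0.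
rewrite (_ : \int[mu]_(t in oo x y) _ = \int[mu]_(t in oo x y) `|g t - h2 t|)//.
by apply: eq_Rintegral => t /[!inE]/=; rewrite in_itv/= => /andP[/ltW xt _]; rewrite h1x// add0r.
Qed.

(** Continuous induction: let [T] be the supremum of the points reached. Near [T] the function [g]
    is within e/2 of [g T], so a single cell leads from a reached point close to [T] past [T], or up
    to [b]. *)
Lemma smooth_approx g M (e : R) a b : continuous g -> a < b -> 0 < e ->
  (forall x, a <= x <= b -> `|g x| <= M) -> smooth_approx_on g M e a b.
Proof.
move=> cg ab e0 gM; have M0 : 0 <= M.
  by apply: le_trans (normr_ge0 (g a)) (gM a _); rewrite lexx ltW.
pose S : set R := [set t | a <= t <= b /\ (t = a \/ smooth_approx_on g M e a t)].
have Sa : S a by split; [rewrite lexx ltW|left].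
have supS : has_sup S by split; [exists a|exists b => t [/andP[]]].
pose T := sup S.
have aT : a <= T by apply: ub_le_sup => //; case: supS.
have Tb : T <= b by apply: ge_sup; [exists a|move=> t [/andP[]]].
have /cvgrPdist_le /(_ (e / 2)) := cg T.
rewrite divr_gt0// => /(_ isT) /nbhs_ballP[dl /= dl0 Hdl].
have gT t : `|T - t| < dl -> `|g t - g T| <= e / 2.
  by move=> Tt; rewrite distrC; apply: Hdl; rewrite -ball_normE.
have [s sS sT] : exists2 s, S s & T - dl < s.
  by apply: sup_adherent => //; rewrite gtrBl.
have sT' : s <= T by apply: ub_le_sup => //; case: supS.
have [/andP[as_ sb] Ss] := sS.
pose t := Num.min b (T + dl / 2).
have tb : t <= b by rewrite /t ge_min lexx.
have tT : t <= T + dl / 2 by rewrite /t ge_min lexx orbT.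
have Tt : T <= t by rewrite le_min Tb lerDl divr_ge0// ltW.
have St : s < t -> smooth_approx_on g M e a t.
  move=> st; have cell : smooth_approx_on g M e s t.
    apply: (smooth_approx_cell cg st e0 (k := g T)); first by rewrite gM ?aT.
    move=> z /andP[sz zt]; apply: gT; rewrite ltr_norml; apply/andP; split; lra.
  by case: Ss => [<-//|Ss]; exact: smooth_approx_cat Ss cell.
have [bT|Tltb] := leP b T.
  have tE : t = b by apply/eqP; rewrite eq_le tb (le_trans bT Tt).
  have [sltt|ts] := ltP s t; first by rewrite -tE; exact: St.
  case: Ss => [sa|]; first by move: ts; rewrite tE sa leNgt ab.
  by have -> // : s = b by apply/eqP; rewrite eq_le sb -tE.
have Tltt : T < t by rewrite lt_min Tltb ltrDl divr_gt0.
have : t <= T.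
  apply: ub_le_sup; first by case: supS.
  split; first by rewrite (le_trans aT Tt).
  by right; apply: St; exact: le_lt_trans Tltt.
by rewrite leNgt Tltt.
Qed.

End Density.

(** * Approximation of arcs by test functions *)

Section ArcApproximation.
Context {R : realType}.
Notation mu := (@lebesgue_measure R).
Notation oo c d := (`]c, d[%classic : set (measurableTypeR R)).
Implicit Types (f g h u v du phi : R -> R) (r a b c d C M x y : R).

Lemma continuous_segment_bounded f c d : c <= d -> continuous f ->
  exists2 C, 0 <= C & forall x, c <= x <= d -> `|f x| <= C.
Proof.
move=> cd cf.
have cnf : {within `[c, d], continuous (fun x => `|f x|)}.
  by apply: continuous_subspaceT => x; apply: continuous_comp; [exact: cf|exact: norm_continuous].
have [z _ zmax] := EVT_max cd cnf; exists `|f z|; first exact: normr_ge0.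
by move=> x xcd; apply: zmax; rewrite in_itv.
Qed.

Lemma bump_integral_gt0 a b c d : a < c -> c < d -> d < b ->
  0 < \int[mu]_(x in oo a b) bump c d x.
Proof.
move=> ac cd db; have ab : a < b by lra.
have crho := Cn_continuous (Cn_bump 0 c d).
have [F dF] := antiderivative crho.
have cF : continuous F by move=> x; exact: is_derive_continuous (dF x).
rewrite (ftc ab cF crho (fun x _ => dF x)) subr_gt0.
have b0 x : 0 <= bump c d x by have /andP[] := bump_bnd c d x.
have F1 : F a <= F c by apply: (is_derive_ge0_le (ltW ac) (fun x _ => dF x)).
have F2 : F d <= F b by apply: (is_derive_ge0_le (ltW db) (fun x _ => dF x)).
have [z zcd Fz] := mean_value cd (fun x _ => dF x).
have : 0 < F d - F c by rewrite Fz mulr_gt0 ?bump_gt0// subr_gt0.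
by move: F1 F2; lra.
Qed.

(** Approximate the derivative [g] by a smooth [h] with compact support, restore mean zero with a
    multiple of a fixed bump, and integrate. Closeness of the derivatives in L^1 gives uniform
    closeness of the functions. *)
Lemma arc_approx c d phi g : c < d -> continuous phi -> continuous g ->
  (forall x, c < x < d -> is_derive x 1 phi (g x)) -> phi c = 0 -> phi d = 0 ->
  exists C (f_ : nat -> R -> R), [/\ forall n, test_function (oo c d) (f_ n),
    forall n x, `|f_ n x| <= C /\ `|(f_ n)^`()%classic x| <= C,
    forall n x, c <= x <= d -> `|f_ n x - phi x| <= C * n.+1%:R^-1 &
    forall n, \int[mu]_(x in oo c d) `|(f_ n)^`()%classic x - g x| <= C * n.+1%:R^-1].
Proof.
move=> cd cphi cg dphi phic phid.
have mI : measurable (oo c d) by exact: measurable_itv.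
have [M M0 gM] := continuous_segment_bounded (ltW cd) cg.
have [P P0 phiP] := continuous_segment_bounded (ltW cd) cphi.
pose e n : R := n.+1%:R^-1.
have e0 n : 0 < e n by rewrite invr_gt0.
have e1 n : e n <= 1 by rewrite invf_le1// ler1n.
pose L := d - c; have L0 : 0 < L by rewrite subr_gt0.
have [c1 [d1 [cc1 cd1 d1d]]] : exists c1 d1, [/\ c < c1, c1 < d1 & d1 < d].
  by exists (c + L / 3), (d - L / 3); rewrite /L; split; lra.
have crho := Cn_continuous (Cn_bump 0 c1 d1).
pose I : R := \int[mu]_(x in oo c d) bump c1 d1 x.
have Ig0 : 0 < I by exact: bump_integral_gt0.
have step n : exists f, [/\ test_function (oo c d) f,
    forall x, `|f^`()%classic x| <= M + L / I,
    forall x, c <= x <= d -> `|f x - phi x| <= 2 * L * e n &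
    \int[mu]_(x in oo c d) `|f^`()%classic x - g x| <= 2 * L * e n].
  have [h [c2 [d2 [Ch cc2 d2d h0 [hM Ih]]]]] := smooth_approx cg cd (e0 n) gM.
  rewrite -/L in Ih.
  have ch := Cn_continuous (Ch 0%N).
  have hi : mu.-integrable (oo c d) (EFin \o h) by exact: continuous_integrable_itvoo.
  have gi : mu.-integrable (oo c d) (EFin \o g) by exact: continuous_integrable_itvoo.
  have rhoi : mu.-integrable (oo c d) (EFin \o bump c1 d1) by exact: continuous_integrable_itvoo.
  (* Chosen so that h + k bump has integral zero. As [g] integrates to phi d - phi c = 0, the
     correction is no larger than the L^1 error of [h]. *)
  pose k : R := - (\int[mu]_(x in oo c d) h x / I).
  have kI : `|k| * I <= e n * L.
    rewrite normrN normrM [X in _ * X * _]gtr0_norm ?invr_gt0// divfK ?gt_eqF//.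
    rewrite (le_trans _ Ih)//.
    have -> : \int[mu]_(x in oo c d) h x = - \int[mu]_(x in oo c d) (g x - h x).
      by rewrite RintegralB// (ftc cd cphi cg dphi) phic phid subrr sub0r opprK.
    by rewrite normrN; apply: le_normr_Rintegral => //; exact: integrable_subr.
  pose h' x := h x + k * bump c1 d1 x.
  have Ch' n' : Cn n' h'.
    by apply: CnD => //; apply: (CnM (f := cst k)); [exact: Cn_cst|exact: Cn_bump].
  have ch' := Cn_continuous (Ch' 0%N).
  pose c3 := Num.min c1 c2; pose d3 := Num.max d1 d2.
  have cc3 : c < c3 by rewrite lt_min cc1 cc2.
  have d3d : d3 < d by rewrite gt_max d1d d2d.
  have cd3 : c3 <= d3 by rewrite /c3 /d3 ge_min le_max (ltW cd1).
  have h'0 x : ~~ (c3 < x < d3) -> h' x = 0.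
    move=> xcd; rewrite /h' h0 ?bump_eq0 ?mulr0 ?addr0//; apply: contra xcd => /andP[x1 x2];
      by rewrite gt_min lt_max x1 x2 ?orbT.
  have [f [df Cf fc fd]] := smooth_primitive Ch' cd3 h'0.
  have cf := Cn_continuous (Cf 0%N).
  have f'E x : f^`()%classic x = h' x.
    by rewrite derive1E (@derive_val _ _ _ _ _ _ _ (df x)).
  have fcE : f c = 0 by rewrite fc// ltW.
  have fdE : f d = 0.
    have := ftc cd cf ch' (fun x _ => df x); rewrite fcE subr0 => <-.
    rewrite RintegralD//; last exact: integrable_mulr.
    by rewrite RintegralZl// -/I /k mulNr divfK ?gt_eqF// subrr.
  have Ih' : \int[mu]_(x in oo c d) `|h' x - g x| <= 2 * L * e n.
    apply: (@le_trans _ _ (\int[mu]_(x in oo c d) (`|g x - h x| + `|k| * bump c1 d1 x))).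
      apply: le_Rintegral => //.
      - apply: integrable_normr; apply: integrable_subr => //.
        exact: continuous_integrable_itvoo.
      - apply: integrable_addr => //; last exact: integrable_mulr.
        by apply: integrable_normr; exact: integrable_subr.
      - move=> x _; have -> : h' x - g x = - (g x - h x) + k * bump c1 d1 x by rewrite /h'; ring.
        rewrite (le_trans (ler_normD _ _))// normrN normrM lerD2l ler_wpM2l//.
        by rewrite ger0_norm//; have /andP[] := bump_bnd c1 d1 x.
    rewrite RintegralD//; last 2 first.
    - by apply: integrable_normr; exact: integrable_subr.
    - exact: integrable_mulr.
    by rewrite RintegralZl// -/I; move: Ih kI; lra.
  exists f; split.
  - apply: (test_functionI Cf cc3 d3d) => x; rewrite negb_and -!ltNge => /orP[/ltW/fc//|].
    by move=> /ltW dx; rewrite fd// -(fd d) ?fdE// ltW.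
  - move=> x; rewrite f'E (le_trans (ler_normD _ _))// lerD// normrM.
    have /andP[b0 b1] := bump_bnd c1 d1 x.
    rewrite (ger0_norm b0) (@le_trans _ _ `|k|)// ?ler_piMr//.
    rewrite ler_pdivlMr// (le_trans kI)// mulrC ler_piMr// ltW//.
  - move=> x /andP[]; rewrite le_eqVlt => /predU1P[<- _|cx xd].
      by rewrite fcE phic subrr normr0 !mulr_ge0// ltW.
    have sub t : c < t < x -> c < t < d by move=> /andP[-> /lt_le_trans ->].
    have E1 := ftc cx cf ch' (fun x _ => df x).
    have E2 := ftc cx cphi cg (fun t tx => dphi t (sub t tx)).
    rewrite fcE subr0 in E1; rewrite phic subr0 in E2.
    rewrite -E1 -E2 -RintegralB//; last 2 first.
    - exact: continuous_integrable_itvoo.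
    - exact: continuous_integrable_itvoo.
    apply: le_trans (Rintegral_subset_le _ _ _) Ih' => //.
    by apply: integrable_subr => //; exact: continuous_integrable_itvoo.
  - rewrite (_ : \int[mu]_(x in _) _ = \int[mu]_(x in oo c d) `|h' x - g x|)//.
    by apply: eq_Rintegral => x _; rewrite f'E.
have [f_ Hf] := choice step.
pose C := P + 2 * L + (M + L / I).
have LI0 : 0 <= L / I by rewrite divr_ge0// ltW.
have CL : 2 * L <= C by rewrite /C; lra.
exists C, f_; split.
- by move=> n; have [] := Hf n.
- move=> n x; have [tf f'b fphi _] := Hf n; split; last first.
    by rewrite (le_trans (f'b x))// /C; lra.
  have [xcd|xcd] := boolP (c < x < d); last first.
    by rewrite (test_eq0 cd tf xcd) normr0 /C; lra.
  have xcd' : c <= x <= d by case/andP: xcd => /ltW -> /ltW ->.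
  have := fphi x xcd'; have := phiP x xcd' => ? H.
  have -> : f_ n x = (f_ n x - phi x) + phi x by rewrite subrK.
  rewrite (le_trans (ler_normD _ _))// /C.
  have : 2 * L * e n <= 2 * L by rewrite ler_piMr// mulr_ge0// ltW.
  by move: H; lra.
- move=> n x xcd; have [_ _ H _] := Hf n.
  by rewrite (le_trans (H x xcd))// ler_wpM2r// ltW.
- move=> n; have [_ _ _ H] := Hf n.
  by rewrite (le_trans H)// ler_wpM2r// ltW.
Qed.

Lemma test_functionW a b c d f : a <= c -> d <= b -> c < d ->
  test_function (oo c d) f -> test_function (oo a b) f.
Proof.
move=> ac db cd tf; have [Cf [c' [d' [cc' _ d'd f0]]]] := test_functionP cd tf.
apply: (test_functionI Cf (c := c') (d := d')).
- exact: le_lt_trans cc'.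
- exact: lt_le_trans db.
- move=> x H; apply: f0; apply: contra H => /andP[/ltW -> /ltW ->] //.
Qed.

(* Convergence in every W^{1,r} at once: in W^{1,1} with uniform bounds. *)
Definition bounded_approx a b u du : Prop :=
  exists C (f_ : nat -> R -> R),
  [/\ measurable_fun (oo a b) u /\ measurable_fun (oo a b) du,
      forall x, `|u x| <= C /\ `|du x| <= C,
      forall n, test_function (oo a b) (f_ n),
      forall n x, `|f_ n x| <= C /\ `|(f_ n)^`()%classic x| <= C &
      L1cvg mu (oo a b) f_ u /\ L1cvg mu (oo a b) (fun n => (f_ n)^`()%classic) du].

Lemma bounded_approx_W10 a b r u du : a < b -> 1 < r -> bounded_approx a b u du ->
  W10 (oo a b) r u du.
Proof.
move=> ab r1 [C [f_ [[mu_ mdu] bu tf bf [fu fdu]]]].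
exact: (W10_intro ab (f_ := f_) (C := C)).
Qed.

End ArcApproximation.

(** * The second eigenvalue *)

Section Eigenvalues.
Context {R : realType}.
Notation mu := (@lebesgue_measure R).
Notation oo c d := (`]c, d[%classic : set (measurableTypeR R)).
Implicit Types (f g h u v du df phi : R -> R) (r a b c d m C M x y lam : R).

(** A difference at one point persists on an interval of positive length, which a null set cannot
    contain. *)
Lemma continuous_ae_eq a b u v : continuous u -> continuous v ->
  ae_eq mu (oo a b) u v -> forall x, a < x < b -> u x = v x.
Proof.
move=> cu cv [N [mN N0 uvN]] x xab; apply: contrapT => /eqP uvx.
pose w y := u y - v y.
have cw : continuous w by move=> y; exact: continuousB (cu y) (cv y).
have w0 : \forall y \near x, w y != 0.
  by apply: (@cvgr_neq0 _ _ _ (nbhs x) _ w (w x) (cw x)); rewrite subr_eq0.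
have [e /= e0 He] : \forall y \near x, w y != 0 /\ a < y < b.
  by apply: filterI; [exact: w0|exact: near_itvoo].
have sub : oo (x - e) (x + e) `<=` N.
  move=> y /=; rewrite in_itv/= => xy; apply: uvN => /= H.
  have [] := He y _.
    by rewrite /ball/= ltr_norml; case/andP: xy => ? ?; apply/andP; split; lra.
  by rewrite /w subr_eq0 => /eqP uvy yab; apply: uvy; apply: H; rewrite /= in_itv.
have : (mu (oo (x - e)%R (x + e)%R) <= mu N)%E by apply: le_measure; rewrite ?inE.
rewrite N0 lebesgue_measure_itv/= lte_fin ifT; last by lra.
by rewrite -EFinD lee_fin; lra.
Qed.

Lemma normL_fineE a b r f : 1 < r -> memL (oo a b) r f ->
  fine (normL (oo a b) r f) `^ r = \int[mu]_(x in oo a b) `|f x| `^ r.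
Proof.
move=> r1 mf; rewrite /Rintegral -normL_powE//.
have := memL_integrable_powR r1 mf => /integrable_fin_num.
rewrite -normL_powE// => /(_ (measurable_itv _)).
case: (normL _ _ _) (normL_ge0 a b r f) => //= _.
by rewrite gt_eqF// (lt_trans ltr01).
Qed.

Lemma test_functionB a b f g : a < b ->
  test_function (oo a b) f -> test_function (oo a b) g ->
  test_function (oo a b) (f \- g) /\
  forall x, (f \- g)^`()%classic x = f^`()%classic x - g^`()%classic x.
Proof.
move=> ab tf tg; split; last first.
  move=> x; rewrite derive1E.
  exact: (@derive_val _ _ _ _ _ _ _ (is_deriveB (test_is_derive ab x tf) (test_is_derive ab x tg))).
have [Cf [c1 [d1 [ac1 _ d1b f0]]]] := test_functionP ab tf.
have [Cg [c2 [d2 [ac2 _ d2b g0]]]] := test_functionP ab tg.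
apply: (test_functionI (c := Num.min c1 c2) (d := Num.max d1 d2)).
- move=> n; apply: Cn_ext (CnD (Cf n) (CnM (Cn_cst n (-1)) (Cg n))) => x.
  by rewrite /= mulN1r.
- by rewrite lt_min ac1.
- by rewrite gt_max d1b.
- move=> x xcd; rewrite /= f0 ?g0 ?subr0//; apply: contra xcd => /andP[/ltW x1 /ltW x2];
  by rewrite ge_min le_max x1 x2 ?orbT.
Qed.

Lemma bounded_approxB a b u du v dv : a < b ->
  bounded_approx a b u du -> bounded_approx a b v dv ->
  bounded_approx a b (u \- v) (du \- dv).
Proof.
have mD : measurable (oo a b) by exact: measurable_itv.
move=> ab [C1 [f1 [[mu1 mdu1] bu1 tf1 bf1 [fu1 fdu1]]]].
move=> [C2 [f2 [[mu2 mdu2] bu2 tf2 bf2 [fu2 fdu2]]]].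
have bint (w : R -> R) C : measurable_fun (oo a b) w -> (forall x, `|w x| <= C) ->
    mu.-integrable (oo a b) (EFin \o w).
  move=> mw bw; apply: (le_integrable mD (g := EFin \o cst C)).
  - exact/measurable_EFinP.
  - by move=> x _; rewrite /= lee_fin (le_trans (bw x))// ler_norm.
  - exact: integrable_cstD.
have L1B (k1 k2 : nat -> R -> R) (w1 w2 : R -> R) :
    (forall n, mu.-integrable (oo a b) (EFin \o k1 n)) ->
    (forall n, mu.-integrable (oo a b) (EFin \o k2 n)) ->
    mu.-integrable (oo a b) (EFin \o w1) -> mu.-integrable (oo a b) (EFin \o w2) ->
    L1cvg mu (oo a b) k1 w1 -> L1cvg mu (oo a b) k2 w2 ->
    L1cvg mu (oo a b) (fun n => k1 n \- k2 n) (w1 \- w2).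
  move=> k1i k2i w1i w2i c1 c2.
  have H : \int[mu]_(x in oo a b) `|k1 n x - w1 x| + \int[mu]_(x in oo a b) `|k2 n x - w2 x|
      @[n --> \oo] --> (0 : R) by rewrite -[X in _ --> X]addr0; exact: cvgD.
  apply: (squeeze_cvgr _ (cvg_cst _) H); apply: nearW => n.
  have i1 := integrable_normr (integrable_subr mD (k1i n) w1i).
  have i2 := integrable_normr (integrable_subr mD (k2i n) w2i).
  rewrite Rintegral_ge0//= -RintegralD//; apply: le_Rintegral => //.
  - by apply: integrable_normr; do 2! [apply: integrable_subr => //].
  - exact: integrable_addr.
  - move=> x _; have -> : k1 n x - k2 n x - (w1 x - w2 x) =
      (k1 n x - w1 x) - (k2 n x - w2 x) by ring.
    exact: ler_normB.
have tB n := test_functionB ab (tf1 n) (tf2 n).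
exists (C1 + C2), (fun n => f1 n \- f2 n); split.
- by split; exact: measurable_funB.
- by move=> x; have [? ?] := bu1 x; have [? ?] := bu2 x;
    split; rewrite (le_trans (ler_normB _ _))// lerD.
- by move=> n; case: (tB n).
- by move=> n x; rewrite (tB n).2; have [? ?] := bf1 n x; have [? ?] := bf2 n x;
    split; rewrite (le_trans (ler_normB _ _))// lerD.
split.
- apply: L1B => //; [by move=> n; exact: test_integrable (tf1 n)
    |by move=> n; exact: test_integrable (tf2 n)
    |by apply: (bint _ C1) => // x; case: (bu1 x)
    |by apply: (bint _ C2) => // x; case: (bu2 x)].
- rewrite (_ : (fun n => _) = (fun n => (f1 n)^`()%classic \- (f2 n)^`()%classic)).
    apply: L1B => //; [by move=> n; exact: test_derive_integrable (tf1 n)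
      |by move=> n; exact: test_derive_integrable (tf2 n)
      |by apply: (bint _ C1) => // x; case: (bu1 x)
      |by apply: (bint _ C2) => // x; case: (bu2 x)].
  by apply/funext => n; apply/funext => x; exact: (tB n).2.
Qed.

(** [g] has to be cut off outside the arc: there [phi] is zero, whereas the continuous extension [g]
    need not vanish. *)
Lemma arc_bounded_approx a b c d r lam phi g : a <= c -> c < d -> d <= b ->
  eigen_arc r lam c d phi g -> bounded_approx a b phi (g \_ (oo c d)).
Proof.
move=> ac cd db [[cphi cg phi0 phiE gE] dphi]; have ab : a < b by lra.
have mD : measurable (oo a b) by exact: measurable_itv.
have mI : measurable (oo c d) by exact: measurable_itv.
have phic : phi c = 0 by rewrite phiE ?ltxx.
have phid : phi d = 0 by rewrite phiE ?ltxx ?andbF.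
have [C [f_ [tf bf fphi fg]]] :=
  arc_approx cd cphi cg (fun x xcd => (dphi x xcd).1) phic phid.
have [M M0 gM] := continuous_segment_bounded (ltW cd) cg.
have [P P0 phiP] := continuous_segment_bounded (ltW cd) cphi.
have C0 : 0 <= C by rewrite (le_trans _ (bf 0%N c).1).
pose K := C + M + P.
have gr x : (g \_ (oo c d)) x = if c < x < d then g x else 0.
  by rewrite patchE mem_setE in_itv.
have DI : oo a b `&` oo c d = oo c d.
  apply/seteqP; split => x /=; first by case.
  by rewrite !in_itv/= => /andP[cx xd]; rewrite cx xd (le_lt_trans ac cx) (lt_le_trans xd db).
have invn : (n.+1%:R^-1 : R) @[n --> \oo] --> (0 : R) by exact: cvg_harmonic.
have Cinv : C * n.+1%:R^-1 * (b - a) @[n --> \oo] --> (0 : R).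
  rewrite -(mul0r (b - a)) -[X in X * _](mulr0 C).
  by apply: cvgM; [apply: cvgM => //|]; exact: cvg_cst.
exists K, f_; split.
- split; first exact: integrable_measurable (continuous_integrable_itvoo a b cphi).
  apply/(measurable_restrict _ mI mD); rewrite DI.
  exact: integrable_measurable (continuous_integrable_itvoo c d cg).
- move=> x; rewrite gr; have [xcd|xcd] := boolP (c < x < d); last first.
    by rewrite phiE// normr0 /K; split; lra.
  have xcd' : c <= x <= d by case/andP: xcd => /ltW -> /ltW ->.
  split; first by rewrite (le_trans (phiP _ xcd'))// /K; lra.
  by rewrite (le_trans (gM _ xcd'))// /K; lra.
- by move=> n; exact: test_functionW (tf n).
- by move=> n x; have [H1 H2] := bf n x; split; rewrite /K; lra.
split.
- apply: (squeeze_cvgr _ (cvg_cst _) Cinv); apply: nearW => n.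
  rewrite Rintegral_ge0//= -Rintegral_cst_oo ?(ltW ab)//.
  apply: le_Rintegral => //.
  + apply: integrable_normr; apply: integrable_subr => //; apply: continuous_integrable_itvoo => //.
    exact: test_continuous (tf n).
  + exact: integrable_cstD.
  + move=> x _; have [xcd|xcd] := boolP (c < x < d); last first.
      by rewrite phiE// (test_eq0 cd (tf n))// subrr normr0 mulr_ge0.
    by apply: fphi; case/andP: xcd => /ltW -> /ltW ->.
- have Cinv' : C * n.+1%:R^-1 @[n --> \oo] --> (0 : R).
    by rewrite -(mulr0 C); apply: cvgM => //; exact: cvg_cst.
  apply: (squeeze_cvgr _ (cvg_cst _) Cinv'); apply: nearW => n.
  rewrite Rintegral_ge0//= (le_trans _ (fg n))//.
  rewrite le_eqVlt; apply/orP; left; apply/eqP.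
  rewrite -[in RHS]DI Rintegral_mkcondr; apply: eq_Rintegral => x _.
  rewrite gr patchE mem_setE in_itv/=; case: ifPn => // xcd.
  have [c' [d' [cc' _ d'd f0]]] := test_derive_supp cd (tf n).
  rewrite (f0 x _).2 ?subrr ?normr0//; apply: contra xcd => /andP[c'x xd'].
  by rewrite (lt_trans cc' c'x) (lt_trans xd' d'd).
Qed.

(** Integration by parts on a single arc. The boundary terms are kept because [f] need not vanish at
    the ends of the arc; they cancel only after gluing. *)
Lemma arc_weak r lam c d phi g f : 1 < r -> c < d -> eigen_arc r lam c d phi g ->
  (forall n, Cn n f) ->
  \int[mu]_(x in oo c d) (spow r (g x) * f^`()%classic x) =
  spow r (g d) * f d - spow r (g c) * f c
  + lam * \int[mu]_(x in oo c d) (spow r (phi x) * f x).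
Proof.
move=> r1 cd [[cphi cg phi0 phiE gE] dphi] Cf.
have cf := Cn_continuous (Cf 0%N); have cf' := Cn_continuous (Cn_derive (Cf 1%N)).
have cM h k : continuous h -> continuous k -> continuous (fun x : R => h x * k x).
  by move=> ch ck x; apply: (continuousM (s := h) (t := k)); [exact: ch|exact: ck].
have cS h : continuous h -> continuous (fun x => spow r (h x)).
  by move=> ch x; exact: continuous_comp (ch x) (continuous_spow r1 (x := h x)).
pose k x := spow r (g x) * f^`()%classic x - lam * (spow r (phi x) * f x).
have i1 := continuous_integrable_itvoo c d (cM _ _ (cS _ cg) cf').
have i2 := continuous_integrable_itvoo c d (cM _ _ (cS _ cphi) cf).
have ck : continuous k.
  move=> x; apply: (continuousB (cM _ _ (cS _ cg) cf' x)).
  exact: continuous_comp (cM _ _ (cS _ cphi) cf x) (@mulrl_continuous _ lam _).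
have dk x : c < x < d -> is_derive x 1 (fun x => spow r (g x) * f x) (k x).
  move=> xcd; have [_ D] := dphi x xcd.
  have := is_deriveM D (derivable_is_derive1 (Cn_derivable (x := x) (Cf 0%N))).
  rewrite /GRing.scale/= => D'; apply: is_derive_eq D' _.
  by rewrite /k (spow_ge0E r1 (ltW (phi0 _ xcd))); ring.
have E := ftc cd (cM _ _ (cS _ cg) cf) ck dk.
move: E; rewrite RintegralB//; last exact: integrable_mulr.
by rewrite RintegralZl//= => <-; rewrite subrK.
Qed.

(** [V] and [W] stand for the nonlinear expressions in the solution. Frozen as bounded functions,
    they leave an identity linear in [f], which passes to L^1 limits of test functions. *)
Lemma weak_extend a b r lam (V W : R -> R) C : a < b -> 1 < r ->
  measurable_fun (oo a b) V -> measurable_fun (oo a b) W ->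
  (forall x, `|V x| <= C /\ `|W x| <= C) ->
  (forall f, test_function (oo a b) f ->
    \int[mu]_(x in oo a b) (V x * f^`()%classic x) =
    lam * \int[mu]_(x in oo a b) (W x * f x)) ->
  forall f df, W10 (oo a b) r f df ->
    \int[mu]_(x in oo a b) (V x * df x) = lam * \int[mu]_(x in oo a b) (W x * f x).
Proof.
move=> ab r1 mV mW bC H f df /(W10_approx ab r1)[fi dfi _ [f_ [tf ff fdf]]].
have mD : measurable (oo a b) by exact: measurable_itv.
have H1 := L1cvg_mul mD mV (fun x _ => (bC x).1)
  (fun n => test_derive_integrable ab (tf n)) dfi fdf.
have H2 := L1cvg_mul mD mW (fun x _ => (bC x).2) (fun n => test_integrable ab (tf n)) fi ff.
have H3 : \int[mu]_(x in oo a b) (V x * (f_ n)^`()%classic x) @[n --> \oo] -->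
    lam * \int[mu]_(x in oo a b) (W x * f x).
  rewrite (_ : (fun n => _) = (fun n => lam * \int[mu]_(x in oo a b) (W x * f_ n x))).
    by apply: cvgM => //; exact: cvg_cst.
  by apply/funext => n; rewrite H.
exact: cvg_unique H1 H3.
Qed.

End Eigenvalues.

(** * Upper bounds for the first two eigenvalues *)

Section Lambda2.
Context {R : realType}.
Notation mu := (@lebesgue_measure R).
Notation oo c d := (`]c, d[%classic : set (measurableTypeR R)).
Implicit Types (f g h u v du df phi : R -> R) (r a b c d m C M x y lam : R).

(** The arc is a competitor whose Rayleigh quotient is [lam]: integrate the derivative of spow r (g)
    phi, which vanishes at both ends. *)
Lemma lambda1_le_arc a b r lam phi g : a < b -> 1 < r -> 0 <= lam ->
  eigen_arc r lam a b phi g -> lambda1 (oo a b) r <= lam.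
Proof.
move=> ab r1 lam0 arc; have [[cphi cg phi0 phiE gE] dphi] := arc.
have r0 : 0 < r by rewrite (lt_trans ltr01).
have mD : measurable (oo a b) by exact: measurable_itv.
have cN h : continuous h -> continuous (fun x => `|h x| `^ r).
  by move=> ch x; exact: continuous_comp (ch x) (continuous_normr_powR r0 (x := h x)).
have HW : W10 (oo a b) r phi (g \_ (oo a b)).
  by apply: bounded_approx_W10 => //; exact: arc_bounded_approx arc.
have [[Lphi Lg _] _] := HW.
have i1 := continuous_integrable_itvoo a b (cN _ cg).
have i2 := continuous_integrable_itvoo a b (cN _ cphi).
have E : \int[mu]_(x in oo a b) `|g x| `^ r =
    lam * \int[mu]_(x in oo a b) `|phi x| `^ r.
  pose k x := `|g x| `^ r - lam * `|phi x| `^ r.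
  have ck : continuous k.
    move=> x; apply: (continuousB (cN _ cg x)).
    exact: continuous_comp (cN _ cphi x) (@mulrl_continuous _ lam _).
  have cF : continuous (fun x => spow r (g x) * phi x).
    move=> x; apply: (continuousM (s := fun x => spow r (g x)) (t := phi)).
      exact: continuous_comp (cg x) (continuous_spow r1 (x := g x)).
    exact: cphi.
  have dk x : a < x < b -> is_derive x 1 (fun x => spow r (g x) * phi x) (k x).
    move=> xab; have [D1 D2] := dphi x xab; have := is_deriveM D2 D1.
    rewrite /GRing.scale/= => D; apply: is_derive_eq D _; have ph0 := phi0 _ xab.
    rewrite /k -spow_mulr// (gtr0_norm ph0) -(mulr_powRB1 (ltW ph0) r0); ring.
  have := ftc ab cF ck dk; rewrite !phiE ?ltxx ?andbF// !mulr0 subrr.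
  rewrite RintegralB//; last exact: integrable_mulr.
  by rewrite RintegralZl// => /eqP; rewrite subr_eq0 => /eqP.
have E' : \int[mu]_(x in oo a b) `|(g \_ (oo a b)) x| `^ r =
    lam * \int[mu]_(x in oo a b) `|phi x| `^ r.
  by rewrite -E; apply: eq_Rintegral => x xD; rewrite patchE xD.
pose t := fine (normL (oo a b) r (g \_ (oo a b))) `^ r / fine (normL (oo a b) r phi) `^ r.
apply: (@le_trans _ _ t).
  apply: ge_inf; first by exists 0 => _ [u [du [_ _ ->]]]; rewrite divr_ge0 ?powR_ge0.
  exists phi, (g \_ (oo a b)); split => //.
  move=> /(continuous_ae_eq cphi (@cst_continuous _ _ (0 : R))) H.
  have mid : a < (a + b) / 2 < b by apply/andP; split; lra.
  by have := phi0 _ mid; rewrite H// ltxx.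
rewrite /t !normL_fineE// E'.
(* If the integral were 0, division by zero would make the quotient 0, which is still at most
   [lam]. *)
have [->|I0] := eqVneq (\int[mu]_(x in oo a b) `|phi x| `^ r) 0.
  by rewrite invr0 mulr0.
by rewrite mulfK.
Qed.

Lemma Rintegral_patch (D I : set (measurableTypeR R)) h : I `<=` D ->
  \int[mu]_(x in D) ((h \_ I) x) = \int[mu]_(x in I) h x.
Proof. by move=> ID; rewrite -Rintegral_mkcondr; congr Rintegral; exact/setIidPr. Qed.

(** For phi1 - phi2 the one-sided derivatives at [m] are g1 m and - g2 m, which agree, so the
    boundary terms of the two arcs cancel at [m]; those at [a] and [b] vanish with the test
    function. So [lam] is an eigenvalue above [lambda1] and belongs to the set whose infimum is
    [lambda2]. *)
Lemma lambda2_le_arcs a m b r lam phi1 g1 phi2 g2 : a < m -> m < b -> 1 < r ->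
  eigen_arc r lam a m phi1 g1 -> eigen_arc r lam m b phi2 g2 -> g2 m = - g1 m ->
  lambda1 (oo a b) r < lam -> lambda2 (oo a b) r <= lam.
Proof.
move=> am mb r1 arc1 arc2 gm l1; have ab := lt_trans am mb.
have rB0 : 0 < r - 1 by rewrite subr_gt0.
have mD : measurable (oo a b) by exact: measurable_itv.
have I1D : oo a m `<=` oo a b.
  by move=> x /=; rewrite !in_itv/= => /andP[-> xm]; rewrite (lt_trans xm mb).
have I2D : oo m b `<=` oo a b.
  by move=> x /=; rewrite !in_itv/= => /andP[mx ->]; rewrite (lt_trans am mx).
have ba1 := arc_bounded_approx (lexx a) am (ltW mb) arc1.
have ba2 := arc_bounded_approx (ltW am) mb (lexx b) arc2.
have [[cphi1 cg1 phi10 phi1E g1E] _] := arc1.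
have [[cphi2 cg2 phi20 phi2E g2E] _] := arc2.
pose u := phi1 \- phi2; pose du := (g1 \_ (oo a m)) \- (g2 \_ (oo m b)).
have ba : bounded_approx a b u du by exact: bounded_approxB.
apply: ge_inf; first by exists (lambda1 (oo a b) r) => x [_ /ltW].
split => //; exists u, du; split.
- exact: bounded_approx_W10.
- have cu : continuous u by move=> x; exact: continuousB (cphi1 x) (cphi2 x).
  move=> /(continuous_ae_eq cu (@cst_continuous _ _ (0 : R))) H.
  have mid : a < (a + m) / 2 < m by apply/andP; split; lra.
  have := phi10 _ mid; have := H ((a + m) / 2) _.
  rewrite /u /= (phi2E ((a + m) / 2)); last by rewrite negb_and -!leNgt; apply/orP; left; lra.
  by rewrite subr0 => -> //; [rewrite ltxx|apply/andP; split; lra].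
have [C [_ [[mu_ mdu] bu _ _ _]]] := ba.
have msp v : measurable_fun (oo a b) v -> measurable_fun (oo a b) (fun x => spow r (v x)).
  move=> mv; apply: measurableT_comp => //.
  by apply: continuous_measurable_fun; exact: continuous_spow.
have bsp (s : R) : `|s| <= C -> `|spow r s| <= C `^ (r - 1).
  by move=> sC; rewrite normr_spow// ge0_ler_powR ?nnegrE ?(ltW rB0) ?(le_trans _ sC).
apply: (weak_extend (C := C `^ (r - 1)) ab r1).
- exact: msp.
- exact: msp.
- by move=> x; have [? ?] := bu x; split; exact: bsp.
move=> f tf; have [Cf _] := test_functionP ab tf.
have cf := Cn_continuous (Cf 0%N); have cf' := Cn_continuous (Cn_derive (Cf 1%N)).
have gluing (v1 v2 k w : R -> R) : continuous v1 -> continuous v2 -> continuous k ->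
    (forall x, w x = (v1 \_ (oo a m)) x - (v2 \_ (oo m b)) x) ->
    \int[mu]_(x in oo a b) (spow r (w x) * k x) =
    \int[mu]_(x in oo a m) (spow r (v1 x) * k x) -
    \int[mu]_(x in oo m b) (spow r (v2 x) * k x).
  move=> cv1 cv2 ck wE.
  have csk v : continuous v -> continuous (fun x => spow r (v x) * k x).
    move=> cv x; apply: (continuousM (s := fun x => spow r (v x)) (t := k)); last exact: ck.
    exact: continuous_comp (cv x) (continuous_spow r1 (x := v x)).
  rewrite -(Rintegral_patch _ I1D) -(Rintegral_patch _ I2D) -RintegralB//; first last.
  - rewrite -restrict_EFin; apply/integrable_restrict => //; rewrite setIidr//.
    by apply: continuous_integrable_itvoo; exact: csk.
  - rewrite -restrict_EFin; apply/integrable_restrict => //; rewrite setIidr//.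
    by apply: continuous_integrable_itvoo; exact: csk.
  apply: eq_Rintegral => x _; rewrite wE !patchE !mem_setE !in_itv/=.
  case: ifPn => x1; case: ifPn => x2; rewrite ?subr0 ?sub0r ?subrr ?spowN ?spow0 ?mul0r ?mulNr//.
  by case/andP: x1 => _ xm; case/andP: x2 => /(lt_trans xm); rewrite ltxx.
rewrite (gluing g1 g2)//.
rewrite (gluing phi1 phi2)//; last first.
  move=> x; rewrite !patchE !mem_setE !in_itv/= /u /=.
  by congr (_ - _); case: ifPn => // /[dup] ? ; [move/phi1E|move/phi2E].
rewrite (arc_weak r1 am arc1 Cf) (arc_weak r1 mb arc2 Cf).
have fa : f a = 0 by rewrite (test_eq0 ab tf)// ltxx.
have fb : f b = 0 by rewrite (test_eq0 ab tf)// ltxx andbF.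
by rewrite fa fb gm spowN; ring.
Qed.

(** A single [lam] serves every short interval, since the eigenvalue of a rescaled arc depends only
    on its length and not on its position. *)
Lemma lambda2_bound a b r : a < b -> 1 < r -> exists lam, [/\ 0 < lam,
  lambda2 (oo a b) r <= lam &
  forall c d, c < d -> d - c <= (b - a) / 2 -> exists A, log_slope r lam c d A].
Proof.
move=> ab r1; have r0 : 0 < r by rewrite (lt_trans ltr01).
have [T1 [T2 [A [phi [g [T12 HA arc]]]]]] := @unit_arc R r r1.
pose L := (b - a) / 2; have L0 : 0 < L by rewrite divr_gt0// subr_gt0.
have S0 : 0 < T2 - T1 by rewrite subr_gt0.
pose m := a + L; have mL : m - a = L by rewrite /m addrC addKr.
have bm : b - m = L by rewrite /m /L; lra.
have am : a < m by rewrite -subr_gt0 mL.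
have mb : m < b by rewrite -subr_gt0 bm.
(* The eigenvalue of the unit arc rescaled to length [L]; the factor 1 is the original eigenvalue,
   kept to match the rescaling lemmas. *)
pose lam := ((T2 - T1) / L) `^ r * 1.
exists lam; split.
- by rewrite /lam mulr1 powR_gt0// divr_gt0.
- have arc1 := eigen_arc_rescale r1 T12 am arc.
  have arc2 := eigen_arc_rescale r1 T12 mb arc.
  have arc0 := eigen_arc_rescale r1 T12 ab arc.
  rewrite mL -/lam in arc1; rewrite bm -/lam in arc2.
  apply: (lambda2_le_arcs am mb r1 arc1 arc2).
    have [[_ _ _ _ g1E] _] := arc.
    by rewrite subrr mulr0 addr0 mL divfK ?gt_eqF// [T1 + _]addrC subrK g1E mulrN opprK.
  have lam00 : 0 <= ((T2 - T1) / (b - a)) `^ r * 1 by rewrite mulr1 powR_ge0.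
  apply: le_lt_trans (lambda1_le_arc ab r1 lam00 arc0) _.
  rewrite /lam !mulr1 gt0_ltr_powR ?nnegrE ?divr_ge0 ?(ltW S0) ?(ltW L0) ?subr_ge0 ?(ltW ab)//.
  by rewrite ltr_pM2l// ltf_pV2 ?posrE ?subr_gt0// /L; lra.
(* The interval of half the length of the domain is placed with its left end at [c] and then
   shortened to end at [d]; it may stick out of the domain. *)
- move=> c d cd dcL; have cL : c < c + L by rewrite ltrDl.
  have := log_slope_rescale r1 T12 cL HA; rewrite [c + L - c]addrC addKr -/lam => H.
  eexists; apply: log_slope_sub H; rewrite -lerBlDl//.
Qed.

End Lambda2.

(** * Regularity of solutions *)

Section Regularity.
Context {R : realType}.
Notation mu := (@lebesgue_measure R).
Notation oo c d := (`]c, d[%classic : set (measurableTypeR R)).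
Implicit Types (f g h u v du df phi H : R -> R) (r a b c d m k C M x y lam : R).

(** Lebesgue differentiation: the primitive of [H] from an interior point is zero, hence so is [H]
    almost everywhere to the right of that point. Countably many such points tending to [a] cover
    the interval. *)
Lemma Rintegral_all_itv_eq0 a b H : a < b -> mu.-integrable (oo a b) (EFin \o H) ->
  (forall x y, a < x -> x < y -> y < b -> \int[mu]_(t in oo x y) H t = 0) ->
  ae_eq mu (oo a b) H (cst 0).
Proof.
move=> ab Hi H0; have mD : measurable (oo a b) by exact: measurable_itv.
pose h := H \_ (oo a b).
have hi : mu.-integrable setT (EFin \o h).
  by rewrite -restrict_EFin; apply/integrable_restrict => //; rewrite setTI.
have hS (E : set (measurableTypeR R)) : measurable E -> mu.-integrable E (EFin \o h).
  by move=> mE; exact: integrableS hi.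
have lh : locally_integrable [set: R] h by exact: integrable_locally Hi.
(* The shift by 2 keeps [x_ 0] strictly below [b]. *)
pose x_ n : R := a + (b - a) / n.+2%:R.
have x_b n : a < x_ n < b.
  rewrite /x_ ltrDl divr_gt0 ?subr_gt0//= -ltrBrDl ltr_pdivrMr// ltr_pMr ?subr_gt0//.
  by rewrite ltr1n.
have Hn n : {ae mu, forall x, x_ n < x < b -> H x = 0}.
  have := FTC1 (a := BLeft (x_ n)) (fun y => hS _ (measurable_itv _)) lh.
  apply: (@filterS _ _ (ae_filter_ringOfSetsType mu)) => x Hx /andP[xnx xb].
  have [axn xnb] := andP (x_b n).
  have [dF] := Hx xnx; rewrite derive1E.
  rewrite (near_eq_derive (g := cst 0)) ?derive_cst.
    by rewrite /h patchE mem_setE in_itv/= (lt_trans axn xnx) xb /= => <-.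
  have := near_itvoo (introT andP (conj xnx xb)); apply: filterS => y /andP[xny yb].
  rewrite -Rintegral_itvoo_cc; last exact: hS.
  rewrite -[RHS](H0 _ _ axn xny yb); apply: eq_Rintegral => t.
  rewrite inE/= in_itv/= => /andP[xt ty].
  by rewrite /h patchE mem_setE in_itv/= (lt_trans axn xt) (lt_trans ty yb).
have := ae_foralln Hn; apply: (@filterS _ _ (ae_filter_ringOfSetsType mu)) => x Hx /=.
rewrite in_itv/= => /andP[ax xb].
have xa0 : 0 < x - a by rewrite subr_gt0.
have [n nx] : exists n : nat, (b - a) / (x - a) < n%:R.
  by exists (Num.bound ((b - a) / (x - a))); apply: archi_boundP; rewrite divr_ge0// ltW// subr_gt0.
apply: (Hx n); rewrite xb andbT /x_ -ltrBrDl ltr_pdivrMr// mulrC -ltr_pdivrMr//.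
by rewrite (lt_le_trans nx)// ler_nat -addn2 leq_addr.
Qed.

(** Any smooth compactly supported [chi] becomes the derivative of a test function once a multiple
    of a fixed bump has removed its mean. Hence [H] integrates against [chi] like the constant [k],
    its average with respect to the bump; plateaus carry this over to indicators of intervals. *)
Lemma du_bois_reymond a b H : a < b -> mu.-integrable (oo a b) (EFin \o H) ->
  (forall f, test_function (oo a b) f -> \int[mu]_(x in oo a b) (H x * f^`()%classic x) = 0) ->
  exists k, ae_eq mu (oo a b) H (cst k).
Proof.
move=> ab Hi Hf; have mD : measurable (oo a b) by exact: measurable_itv.
have bi f C : continuous f -> (forall x, `|f x| <= C) ->
    mu.-integrable (oo a b) (EFin \o (fun x => H x * f x)).
  move=> cf fC.
  have mf := integrable_measurable (continuous_integrable_itvoo a b cf).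
  apply: (eq_integrable mD _ _ _ (integrable_mulbnd mD mf (fun x _ => fC x) Hi)) => x _.
  by rewrite /= mulrC.
have [c1 [d1 [cc1 cd1 d1d]]] : exists c1 d1, [/\ a < c1, c1 < d1 & d1 < b].
  by exists (a + (b - a) / 3), (b - (b - a) / 3); split; lra.
have rho1 x : `|bump c1 d1 x| <= 1.
  by have /andP[? ?] := bump_bnd c1 d1 x; rewrite ger0_norm.
have crho := Cn_continuous (Cn_bump 0 c1 d1).
have rhoi := continuous_integrable_itvoo a b crho.
pose I : R := \int[mu]_(x in oo a b) bump c1 d1 x.
have I0 : I != 0 by rewrite gt_eqF// bump_integral_gt0.
pose k : R := (\int[mu]_(x in oo a b) (H x * bump c1 d1 x)) / I.
have key chi C c d : (forall n, Cn n chi) -> a < c -> c < d -> d < b ->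
    (forall x, ~~ (c < x < d) -> chi x = 0) -> (forall x, `|chi x| <= C) ->
    \int[mu]_(x in oo a b) (H x * chi x) = k * \int[mu]_(x in oo a b) chi x.
  move=> Cchi ac cd db chi0 chiC.
  have cchi := Cn_continuous (Cchi 0%N).
  have chii := continuous_integrable_itvoo a b cchi.
  pose J : R := \int[mu]_(x in oo a b) chi x.
  pose h x := chi x + - (J / I) * bump c1 d1 x.
  have Ch n : Cn n h.
    by apply: CnD => //; apply: (CnM (f := cst (- (J / I)))); [exact: Cn_cst|exact: Cn_bump].
  pose c3 := Num.min c1 c; pose d3 := Num.max d1 d.
  have cd3 : c3 <= d3 by rewrite /c3 /d3 ge_min le_max (ltW cd1).
  have h0 x : ~~ (c3 < x < d3) -> h x = 0.
    move=> xcd; rewrite /h chi0 ?bump_eq0 ?mulr0 ?addr0//; apply: contra xcd => /andP[x1 x2];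
    by rewrite gt_min lt_max x1 x2 ?orbT.
  have [f [dfh Cf fc fd]] := smooth_primitive Ch cd3 h0.
  have f'E x : f^`()%classic x = h x.
    by rewrite derive1E (@derive_val _ _ _ _ _ _ _ (dfh x)).
  have ac3 : a < c3 by rewrite lt_min cc1 ac.
  have d3b : d3 < b by rewrite gt_max d1d db.
  have faE : f a = 0 by rewrite fc// ltW.
  have fbE : f b = 0.
    have := ftc ab (Cn_continuous (Cf 0%N)) (Cn_continuous (Ch 0%N)) (fun x _ => dfh x).
    rewrite faE subr0 => <-; rewrite RintegralD//; last exact: integrable_mulr.
    by rewrite RintegralZl// -/I -/J mulNr divfK// subrr.
  have tf : test_function (oo a b) f.
    apply: (test_functionI Cf ac3 d3b) => x; rewrite negb_and -!ltNge => /orP[/ltW/fc//|].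
    by move=> /ltW dx; rewrite fd// -(fd b) ?fbE// ltW.
  have := Hf f tf; rewrite (_ : \int[mu]_(x in _) _ =
      \int[mu]_(x in oo a b) (H x * chi x + - (J / I) * (H x * bump c1 d1 x))); last first.
    by apply: eq_Rintegral => x _; rewrite f'E /h; ring.
  rewrite RintegralD//; first last.
  - by apply: integrable_mulr => //; exact: bi rho1.
  - exact: bi chiC.
  rewrite RintegralZl//; last exact: bi rho1.
  by rewrite mulNr => /eqP; rewrite subr_eq0 => /eqP ->; rewrite /k /J; field.
exists k; have ki : mu.-integrable (oo a b) (EFin \o (fun x => H x - k)).
  by apply: integrable_subr => //; exact: integrable_cstD.
have : ae_eq mu (oo a b) (fun x => H x - k) (cst 0).
  apply: Rintegral_all_itv_eq0 => // x y ax xy yb.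
  have sub : oo x y `<=` oo a b.
    by move=> t /=; rewrite !in_itv/= => /andP[/(lt_trans ax) -> /lt_trans ->].
  pose chi := plateau x y.
  have Cchi n i : Cn i (chi n) by exact: Cn_plateau.
  have chi1 n t : `|chi n t| <= 1.
    by have /andP[? ?] := plateau_bnd x y n t; rewrite ger0_norm.
  have int0 n : \int[mu]_(t in oo a b) ((H t - k) * chi n t) = 0.
    have chii := continuous_integrable_itvoo a b (Cn_continuous (Cchi n 0%N)).
    rewrite (_ : \int[mu]_(t in _) _ =
        \int[mu]_(t in oo a b) (H t * chi n t - k * chi n t)); last first.
      by apply: eq_Rintegral => t _; ring.
    rewrite RintegralB//; last 2 first.
    - by apply: bi (chi1 n); exact: Cn_continuous (Cchi n 0%N).
    - exact: integrable_mulr.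
    rewrite RintegralZl// (key _ 1 x y)// ?subrr//.
    by move=> t; exact: plateau_eq0.
  have [_] : mu.-integrable (oo a b) (EFin \o ((fun t => H t - k) \_ (oo x y))) /\
      \int[mu]_(t in oo a b) ((H t - k) * chi n t) @[n --> \oo] -->
      \int[mu]_(t in oo a b) ((fun t => H t - k) \_ (oo x y)) t.
    apply: (Rint_dominated_cvg mD _ _ (integrable_normr ki)).
    - move=> n; apply: measurable_funM; first exact: integrable_measurable ki.
      apply: integrable_measurable (continuous_integrable_itvoo a b _).
      exact: Cn_continuous (Cchi n 0%N).
    - move=> t _; rewrite patchE mem_setE in_itv/=; case: ifPn => txy.
        rewrite -[X in _ --> X]mulr1; apply: cvgM; first exact: cvg_cst.
        exact: plateau_cvg.
      apply: cvg_near_cst; apply: nearW => n; apply/eqP.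
      by rewrite /chi plateau_eq0// mulr0.
    - by move=> n t _; rewrite normrM ler_piMr.
  rewrite Rintegral_patch// => lim1.
  have lim0 : \int[mu]_(t in oo a b) ((H t - k) * chi n t) @[n --> \oo] --> (0 : R).
    by apply: cvg_near_cst; apply: nearW => n; exact: int0.
  exact: cvg_unique lim1 lim0.
apply: (@filterS _ _ (ae_filter_ringOfSetsType mu)) => x /= Hx /Hx /eqP.
by rewrite subr_eq0 => /eqP ->.
Qed.

Lemma ae_eq_Rintegral a b u v : measurable_fun (oo a b) u -> measurable_fun (oo a b) v ->
  ae_eq mu (oo a b) u v -> \int[mu]_(x in oo a b) u x = \int[mu]_(x in oo a b) v x.
Proof.
move=> mu_ mv uv; congr fine; apply: ae_eq_integral => //.
- exact/measurable_EFinP.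
- exact/measurable_EFinP.
- by apply: (@filterS _ _ (ae_filter_ringOfSetsType mu)) uv => x H /H /= ->.
Qed.

(** Recovers u' from the flux continuously. For y >= 0 surjectivity follows from the intermediate
    value theorem up to y^(1/(q-1)), where the term of exponent [q] alone reaches [y]; oddness gives
    the rest. *)
Lemma spow_sum_inverse p q : 1 < p -> 1 < q -> exists f : R -> R,
  continuous f /\ (forall y, spow p (f y) + spow q (f y) = y) /\
  (forall s, f (spow p s + spow q s) = s).
Proof.
move=> p1 q1; pose psi s : R := spow p s + spow q s.
have psiN s : psi (- s) = - psi s by rewrite /psi !spowN opprD.
have psi_lt : {homo psi : x y / x < y} by move=> x y xy; rewrite ltrD ?spow_lt.
have cpsi : continuous psi.
  by move=> x; exact: continuousD (continuous_spow p1 (x := x)) (continuous_spow q1 (x := x)).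
have onto0 y : 0 <= y -> exists s, psi s = y.
  move=> y0; have q0 : 0 < q - 1 by rewrite subr_gt0.
  pose s := y `^ (q - 1)^-1; have s0 : 0 <= s by exact: powR_ge0.
  have psis : y <= psi s.
    rewrite /psi (spow_ge0E p1 s0) (spow_ge0E q1 s0) -[X in _ + X]powRrM mulVf ?gt_eqF//.
    by rewrite powRr1// lerDr powR_ge0.
  have psi0 : psi 0 = 0 by rewrite /psi !spow0 addr0.
  have [||z _ zy] := @IVT _ psi 0 s y s0; last by exists z.
    exact: continuous_subspaceT.
  by rewrite psi0 ge_min le_max y0 psis orbT.
have onto y : exists s, psi s = y.
  have [|y0] := leP 0 y; first exact: onto0.
  have Ny0 : 0 <= - y by rewrite oppr_ge0 ltW.
  have [s Es] := onto0 _ Ny0.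
  by exists (- s); rewrite psiN Es opprK.
have [f Hf] := choice onto.
have psi_inj : injective psi.
  by move=> x y xy; case: (ltgtP x y) => // /psi_lt; rewrite xy ltxx.
exists f; split; [|split] => //.
- exact: (increasing_can_continuous psi_lt Hf).
- by move=> s; apply: psi_inj; rewrite Hf.
Qed.

Lemma GEV_regular a b p q al be u : a < b -> 1 < q -> q < p ->
  GEV_solution (oo a b) p q al be u ->
  exists U G : R -> R, [/\ continuous U, continuous G,
    forall x, ~~ (a < x < b) -> U x = 0,
    ae_eq mu (oo a b) u U &
    forall x, a < x < b -> is_derive x 1 U (G x) /\
      is_derive x 1 (fun y => spow p (G y) + spow q (G y))
        (- (al * spow p (U x) + be * spow q (U x)))].
Proof.
move=> ab q1 qp [du W weak]; have p1 := lt_trans q1 qp.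
have mD : measurable (oo a b) by exact: measurable_itv.
have [ui dui dupi _] := W10_approx ab p1 W.
have [U [cU U0 uU Udu]] := W10_continuous ab p1 W.
have mu_ := integrable_measurable ui; have mdu := integrable_measurable dui.
have cS r h : 1 < r -> continuous h -> continuous (fun x => spow r (h x)).
  by move=> r1 ch x; exact: continuous_comp (ch x) (continuous_spow r1 (x := h x)).
have mS r v : 1 < r -> measurable_fun (oo a b) v ->
    measurable_fun (oo a b) (fun x => spow r (v x)).
  move=> r1 mv; apply: measurableT_comp => //.
  by apply: continuous_measurable_fun; exact: continuous_spow.
have Si r : 1 < r <= p -> mu.-integrable (oo a b) (EFin \o (fun x => spow r (du x))).
  move=> /andP[r1 rp].
  have := powR_integrable (a := a) (b := b) mdu dupi (s := r - 1).
  rewrite subr_gt0 r1 lerBlDr (le_trans rp) ?lerDl// => /(_ isT) H.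
  apply: (le_integrable mD _ _ H); first by apply/measurable_EFinP; exact: mS.
  by move=> x _; rewrite /= lee_fin normr_spow// [leRHS]ger0_norm// powR_ge0.
pose h x : R := al * spow p (U x) + be * spow q (U x).
have ch : continuous h.
  have cZ c v : continuous v -> continuous (fun x => c * v x).
    by move=> cv x; exact: continuous_comp (cv x) (@mulrl_continuous _ c _).
  by move=> x; exact: continuousD (cZ al _ (cS _ _ p1 cU) x) (cZ be _ (cS _ _ q1 cU) x).
have [P dP] := antiderivative ch.
have cP : continuous P by move=> x; exact: is_derive_continuous (dP x).
have Pi := continuous_integrable_itvoo a b cP.
(* As [P] is a primitive of the right-hand side, the weak equation says that [H] integrates to zero
   against derivatives of test functions. *)
pose H x : R := spow p (du x) + spow q (du x) + P x.
have Spi : mu.-integrable (oo a b) (EFin \o (fun x => spow p (du x))).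
  by apply: Si; rewrite p1 lexx.
have Sqi : mu.-integrable (oo a b) (EFin \o (fun x => spow q (du x))).
  by apply: Si; rewrite q1 ltW.
have Hi : mu.-integrable (oo a b) (EFin \o H).
  by apply: integrable_addr => //; exact: integrable_addr.
have [k Hk] : exists k, ae_eq mu (oo a b) H (cst k).
  apply: du_bois_reymond => // f tf.
  have [C1 bf] := test_bounded ab tf; have [C2 bf'] := test_derive_bounded ab tf.
  have cf := test_continuous ab tf; have cf' := test_derive_continuous ab tf.
  have mf := integrable_measurable (test_integrable ab tf).
  have mf' := integrable_measurable (test_derive_integrable ab tf).
  have prod v : mu.-integrable (oo a b) (EFin \o v) ->
      mu.-integrable (oo a b) (EFin \o (fun x => v x * f^`()%classic x)).
    move=> /(integrable_mulbnd mD mf' (fun x _ => bf' x)) vi.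
    by apply: (eq_integrable mD _ _ _ vi) => x _; rewrite /= mulrC.
  have E1 : \int[mu]_(x in oo a b) (P x * f^`()%classic x) =
      - \int[mu]_(x in oo a b) (h x * f x).
    have cM (v w : R -> R) : continuous v -> continuous w -> continuous (fun x => v x * w x).
      by move=> cv cw x; apply: (continuousM (s := v) (t := w)); [exact: cv|exact: cw].
    apply/eqP; rewrite -addr_eq0 -RintegralD//; first last.
    - exact: continuous_integrable_itvoo (cM _ _ ch cf).
    - exact: prod.
    pose w x := P x * f^`()%classic x + h x * f x.
    have cw : continuous w.
      by move=> x; exact: continuousD (cM _ _ cP cf' x) (cM _ _ ch cf x).
    have dw x : a < x < b -> is_derive x 1 (fun x => P x * f x) (w x).
      move=> _; have := is_deriveM (dP x) (test_is_derive ab x tf).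
      by rewrite /GRing.scale/= [f x * _]mulrC.
    rewrite (ftc ab (cM _ _ cP cf) cw dw) (test_eq0 ab (x := a) tf) ?ltxx//.
    by rewrite (test_eq0 ab (x := b) tf) ?ltxx ?andbF// !mulr0 subrr.
  have E2 r : 1 < r -> \int[mu]_(x in oo a b) (spow r (u x) * f x) =
      \int[mu]_(x in oo a b) (spow r (U x) * f x).
    move=> r1; apply: ae_eq_Rintegral.
    - by apply: measurable_funM => //; exact: mS.
    - by apply: measurable_funM => //; apply: mS => //;
        exact: integrable_measurable (continuous_integrable_itvoo a b cU).
    - by apply: (@filterS _ _ (ae_filter_ringOfSetsType mu)) uU => x /[apply] ->.
  have Ui r : 1 < r -> mu.-integrable (oo a b) (EFin \o (fun x => spow r (U x) * f x)).
    move=> r1; apply: continuous_integrable_itvoo => x.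
    apply: (continuousM (s := fun x => spow r (U x)) (t := f)); last exact: cf.
    exact: cS.
  have := weak f _ (test_W10 ab p1 tf); rewrite !E2// => E3.
  have E4 : \int[mu]_(x in oo a b) (h x * f x) =
      al * \int[mu]_(x in oo a b) (spow p (U x) * f x) +
      be * \int[mu]_(x in oo a b) (spow q (U x) * f x).
    rewrite -!RintegralZl ?Ui// -RintegralD//; try by apply: integrable_mulr => //; exact: Ui.
    by apply: eq_Rintegral => x _; rewrite /h; ring.
  rewrite (_ : \int[mu]_(x in _) _ = \int[mu]_(x in oo a b)
      (spow p (du x) * f^`()%classic x + spow q (du x) * f^`()%classic x + P x * f^`()%classic x)).
    rewrite RintegralD//; last 2 first.
    - by apply: integrable_addr => //; exact: prod.
    - exact: prod.
    rewrite RintegralD//; last 2 first.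
    - exact: prod.
    - exact: prod.
    by rewrite E3 E1 E4 subrr.
  by apply: eq_Rintegral => x _; rewrite /H; ring.
have [psiV [cpsiV [psiVK psiK]]] := spow_sum_inverse p1 q1.
(* A continuous function equal to [du] almost everywhere, for which the flux is k - P at every
   point. *)
pose G x := psiV (k - P x).
have cG : continuous G.
  move=> x; apply: (continuous_comp (f := fun x => k - P x) (g := psiV)); last exact: cpsiV.
  apply: continuousB; [exact: cst_continuous|exact: cP].
have duG : ae_eq mu (oo a b) du G.
  apply: (@filterS _ _ (ae_filter_ringOfSetsType mu)) Hk => x /[apply] /= Hx.
  by rewrite /G -Hx /H addrK psiK.
exists U, G; split => // x xab.
have [ax xb] := andP xab; split.
- have [Q dQ] := antiderivative cG.
  have cQ : continuous Q by move=> y; exact: is_derive_continuous (dQ y).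
  apply: (eq_is_derive_itvoo (f := fun y => Q y - Q a) _ xab).
    move=> y /andP[ay yb]; rewrite Udu ?(ltW ay) ?(ltW yb)//.
    rewrite -(ftc ay cQ cG (fun t _ => dQ t)); apply: esym; apply: ae_eq_Rintegral.
    + apply: measurable_funS mdu => // t /=.
      by rewrite !in_itv/= => /andP[-> /lt_trans ->].
    + exact: integrable_measurable (continuous_integrable_itvoo a y cG).
    + apply: (@filterS _ _ (ae_filter_ringOfSetsType mu)) duG => t Ht.
      by rewrite /= in_itv/= => /andP[at_ ty]; apply: Ht; rewrite /= in_itv/= at_ (lt_trans ty).
  by have := is_deriveB (dQ x) (is_derive_cst (Q a) x (1 : R)); rewrite subr0.
- rewrite (_ : (fun y => _) = (fun y => k - P y)); last by apply/funext => y; exact: psiVK.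
  by have := is_deriveB (is_derive_cst k x (1 : R)) (dP x); rewrite sub0r.
Qed.

End Regularity.

(** * Nodal intervals *)

Section NodalInterval.
Context {R : realType}.
Notation mu := (@lebesgue_measure R).
Notation oo c d := (`]c, d[%classic : set (measurableTypeR R)).
Implicit Types (U G u : R -> R) (a b c d p q x y M : R).

(** The ends are the last point before [x] and the first point after [x] where [U <= 0]; [a] and [b]
    are such points. There [U] is both a limit of nonpositive values and a limit of positive ones,
    hence zero. *)
Lemma positive_interval a b U x : continuous U ->
  (forall y, ~~ (a < y < b) -> U y = 0) -> 0 < U x ->
  exists c d, [/\ a <= c, c < x < d, d <= b, U c = 0 /\ U d = 0 &
    forall y, c < y < d -> 0 < U y].
Proof.
move=> cU U0 Ux.
have /andP[ax xb] : a < x < b.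
  by apply: contraT => /U0 Ux0; rewrite Ux0 ltxx in Ux.
have Ua : U a = 0 by rewrite U0// ltxx.
have Ub : U b = 0 by rewrite U0// ltxx andbF.
pose S : set R := [set t | a <= t <= x /\ U t <= 0].
pose S' : set R := [set t | x <= t <= b /\ U t <= 0].
have supS : has_sup S.
  by split; [exists a; rewrite /S /= lexx ltW// Ua|exists x => t [/andP[]]].
have infS : has_inf S'.
  by split; [exists b; rewrite /S' /= lexx ltW// Ub|exists x => t [/andP[]]].
pose c := sup S; pose d := inf S'.
have ac : a <= c by apply: ub_le_sup; [case: supS|rewrite /S /= lexx ltW// Ua].
have db : d <= b by apply: ge_inf; [case: infS|rewrite /S' /= lexx ltW// Ub].
have cx : c <= x by apply: ge_sup; [case: supS|move=> t [/andP[]]].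
have xd : x <= d by apply: lb_le_inf; [case: infS|move=> t [/andP[]]].
have posr y : c < y -> y <= x -> 0 < U y.
  move=> cy yx; rewrite ltNge; apply/negP => Uy.
  have : y <= c by apply: ub_le_sup; [case: supS|split=> //; rewrite (le_trans ac (ltW cy))].
  by rewrite leNgt cy.
have posl y : x <= y -> y < d -> 0 < U y.
  move=> xy yd; rewrite ltNge; apply/negP => Uy.
  have : d <= y by apply: ge_inf; [case: infS|split=> //; rewrite xy (le_trans (ltW yd) db)].
  by rewrite leNgt yd.
have Uc : U c <= 0.
  rewrite leNgt; apply/negP => Uc.
  have /nbhs_ballP[e /= e0 He] : \forall y \near c, 0 < U y.
    exact: (cvgr_gt _ (cU c)).
  have [t St ct] : exists2 t, S t & c - e < t.
    by apply: sup_adherent => //; rewrite gtrBl.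
  have tc : t <= c by apply: ub_le_sup => //; case: supS.
  have : 0 < U t.
    by apply: He; rewrite -ball_normE/= ger0_norm ?subr_ge0//; move: ct; lra.
  by case: St => _ /le_lt_trans /[apply]; rewrite ltxx.
have Ud : U d <= 0.
  rewrite leNgt; apply/negP => Ud.
  have /nbhs_ballP[e /= e0 He] : \forall y \near d, 0 < U y.
    exact: (cvgr_gt _ (cU d)).
  have [t St dt] : exists2 t, S' t & t < d + e.
    by apply: inf_adherent => //; rewrite ltrDl.
  have td : d <= t by apply: ge_inf => //; case: infS.
  have : 0 < U t.
    by apply: He; rewrite -ball_normE/= ler0_norm ?subr_le0//; move: dt; lra.
  by case: St => _ /le_lt_trans /[apply]; rewrite ltxx.
have {}cx : c < x by rewrite lt_neqAle cx andbT; apply: contraTneq Ux => <-; rewrite -leNgt.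
have {}xd : x < d by rewrite lt_neqAle xd andbT; apply: contraTneq Ux => ->; rewrite -leNgt.
have pos y : c < y < d -> 0 < U y.
  by move=> /andP[cy yd]; have [/posr|/ltW/posl] := leP y x; exact.
exists c, d; split => //; first by rewrite cx.
have limit z : (forall e : R, 0 < e -> exists2 y, ball z e y & 0 < U y) -> 0 <= U z.
  move=> H; rewrite leNgt; apply/negP => Uz.
  have /nbhs_ballP[e /= e0 He] : \forall y \near z, U y < 0.
    exact: (cvgr_lt _ (cU z)).
  by have [y /He yz /(lt_trans yz)] := H e e0; rewrite ltxx.
split; apply/eqP; rewrite eq_le ?Uc ?Ud/=; apply: limit => e e0.
- pose s := Num.min (e / 2) ((x - c) / 2).
  have s0 : 0 < s by rewrite lt_min !divr_gt0// subr_gt0.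
  have se : s <= e / 2 by rewrite /s ge_min lexx.
  have sx : s <= (x - c) / 2 by rewrite /s ge_min lexx orbT.
  exists (c + s); last by apply: posr; lra.
  by rewrite -ball_normE/= ler0_norm; lra.
- pose s := Num.min (e / 2) ((d - x) / 2).
  have s0 : 0 < s by rewrite lt_min !divr_gt0// subr_gt0.
  have se : s <= e / 2 by rewrite /s ge_min lexx.
  have sx : s <= (d - x) / 2 by rewrite /s ge_min lexx orbT.
  exists (d - s); last by apply: posl; lra.
  by rewrite -ball_normE/= ger0_norm; lra.
Qed.

Lemma disjoint_length_le (a b c d c' d' : R) (P : R -> Prop) :
  a <= c -> c < d -> d <= b -> a <= c' -> c' < d' -> d' <= b ->
  (forall y, c < y < d -> P y) -> (forall y, c' < y < d' -> ~ P y) ->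
  d - c <= (b - a) / 2 \/ d' - c' <= (b - a) / 2.
Proof.
move=> ac cd db ac' cd' db' Pcd Pcd'.
have [dc'|c'd] := leP d c'.
  by have [?|?] := leP (d - c) ((b - a) / 2); [left|right; lra].
have [d'c|cd2] := leP d' c.
  by have [?|?] := leP (d - c) ((b - a) / 2); [left|right; lra].
(* If neither interval lies to one side of the other, they overlap, and the midpoint of the overlap
   satisfies both [P] and its negation. *)
pose y := (Num.max c c' + Num.min d d') / 2.
have H : Num.max c c' < Num.min d d'.
  by rewrite gt_max !lt_min cd c'd cd2 cd'.
have [H1 H2] : c <= Num.max c c' /\ c' <= Num.max c c' by rewrite !le_max !lexx orbT.
have [H3 H4] : Num.min d d' <= d /\ Num.min d d' <= d' by rewrite !ge_min !lexx orbT.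
exfalso; apply: (Pcd' y); last apply: Pcd.
  by rewrite /y; apply/andP; split; lra.
by rewrite /y; apply/andP; split; lra.
Qed.

Lemma no_positive_nodal_interval a b p q (al be : R) U G c d : a < b ->
  1 < q -> q < p -> al <= lambda2 (oo a b) p -> be <= lambda2 (oo a b) q ->
  continuous U -> continuous G ->
  (forall x, a < x < b -> is_derive x 1 U (G x) /\
     is_derive x 1 (fun y => spow p (G y) + spow q (G y))
       (- (al * spow p (U x) + be * spow q (U x)))) ->
  a <= c -> c < d -> d <= b -> d - c <= (b - a) / 2 -> U c = 0 -> U d = 0 ->
  ~ (forall x, c < x < d -> 0 < U x).
Proof.
move=> ab q1 qp alp beq cU cG dUG ac cd db dcL Uc Ud Upos.
have p1 := lt_trans q1 qp.
have sub x : c < x < d -> a < x < b.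
  by move=> /andP[cx xd]; rewrite (le_lt_trans ac cx) (lt_le_trans xd db).
have [lp [lp0 lamp /(_ c d cd dcL) [Ap HAp]]] := lambda2_bound ab p1.
have [lq [lq0 lamq /(_ c d cd dcL) [Aq HAq]]] := lambda2_bound ab q1.
have [M M0 GM] := continuous_segment_bounded (ltW cd) cG.
have GM' x : c < x < d -> `|G x| <= M by move=> /andP[/ltW cx /ltW xd]; rewrite GM ?cx.
(* An end of the nodal interval may be an end of the domain, where only continuity of [U] is known;
   so the mean value theorem is used with derivatives in the open interval only. It gives the linear
   decay of [U] at both ends. *)
have mvt x y : c <= x -> x < y -> y <= d -> `|U y - U x| <= M * (y - x).
  move=> cx xy yd; have dU z : z \in `]x, y[ -> is_derive z 1 U (G z).
    rewrite in_itv/= => /andP[xz zy]; apply: (dUG z _).1; apply: sub.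
    by rewrite (le_lt_trans cx xz) (lt_le_trans zy yd).
  have [|z] := MVT xy dU; first exact: continuous_subspaceT.
  rewrite in_itv/= => /andP[xz zy] ->.
  rewrite normrM [X in _ * X]ger0_norm ?subr_ge0 ?(ltW xy)// ler_wpM2r ?subr_ge0 ?(ltW xy)//.
  by rewrite GM' ?(le_lt_trans cx xz) ?(lt_le_trans zy yd).
apply: (@no_positive_arc R p q al be lp lq c d M Ap Aq U G) => //.
- exact: le_trans lamp.
- exact: le_trans lamq.
- by move=> x xcd; case: (dUG x (sub x xcd)).
- move=> x xcd; have [_] := dUG x (sub x xcd).
  by rewrite !spow_ge0E// ltW// Upos.
- move=> x xcd; have [cx xd] := andP xcd; split.
    have := mvt _ _ (lexx c) cx (ltW xd); rewrite Uc subr0.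
    by apply: le_trans; exact: ler_norm.
  have := mvt _ _ (ltW cx) xd (lexx d); rewrite Ud sub0r normrN.
  by apply: le_trans; exact: ler_norm.
Qed.

End NodalInterval.

Unset Implicit Arguments.

Theorem theorem1p4 (R : realType) (a b p q alpha beta : R)
  (hab : a < b) (hq : 1 < q) (hqp : q < p)
  (halpha : alpha <= lambda2 `]a, b[ p)
  (hbeta : beta <= lambda2 `]a, b[ q) :
  ~ exists u : R -> R,
      GEV_solution `]a, b[ p q alpha beta u /\ nodal `]a, b[ u.
Proof.
move=> [u [sol [up un]]].
have [U [G [cU cG U0 uU dUG]]] := GEV_regular hab hq hqp sol.
have [x Ux] : exists x, 0 < U x.
  apply: contrapT => H; apply: up; move: uU.
  apply: (@filterS _ _ (ae_filter_ringOfSetsType (@lebesgue_measure R))) => x /[apply].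
  rewrite /funrpos /= => ->; apply/max_idPr; rewrite leNgt; apply/negP => Ux.
  by apply: H; exists x.
have [y Uy] : exists y, U y < 0.
  apply: contrapT => H; apply: un; move: uU.
  apply: (@filterS _ _ (ae_filter_ringOfSetsType (@lebesgue_measure R))) => y /[apply].
  rewrite /funrneg /= => ->; apply/max_idPr; rewrite oppr_le0 leNgt; apply/negP => Uy.
  by apply: H; exists y.
(* [spow] is odd, so - U satisfies the same equation with derivative - G, and an interval where [U]
   is negative reduces to the positive case. *)
have cV : continuous (fun t => - U t) by move=> t; exact: continuousN (cU t).
have cGN : continuous (fun t => - G t) by move=> t; exact: continuousN (cG t).
have V0 t : ~~ (a < t < b) -> - U t = 0 by move=> /U0 ->; rewrite oppr0.
have dVG t : a < t < b -> is_derive t 1 (fun t => - U t) (- G t) /\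
    is_derive t 1 (fun y => spow p (- G y) + spow q (- G y))
      (- (alpha * spow p (- U t) + beta * spow q (- U t))).
  move=> tab; have [D1 D2] := dUG t tab; split; first exact: is_deriveN.
  rewrite (_ : (fun y => _) = (fun y => - (spow p (G y) + spow q (G y)))).
    by rewrite !spowN !mulrN -opprD; exact: is_deriveN.
  by apply/funext => s; rewrite !spowN opprD.
have Vy : 0 < - U y by rewrite oppr_gt0.
have [c [d [ac /andP[cx xd] db [Uc Ud] Upos]]] := positive_interval cU U0 Ux.
have [c' [d' [ac' /andP[cy yd] db' [Vc Vd] Vpos]]] := positive_interval cV V0 Vy.
have [||L|L] := disjoint_length_le (P := fun t => 0 < U t)
  ac (lt_trans cx xd) db ac' (lt_trans cy yd) db'.
- exact: Upos.
- by move=> t /Vpos; rewrite oppr_gt0 => /lt_trans /[apply]; rewrite ltxx.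
- exact: (no_positive_nodal_interval hab hq hqp halpha hbeta cU cG dUG ac
    (lt_trans cx xd) db L Uc Ud Upos).
- exact: (no_positive_nodal_interval hab hq hqp halpha hbeta cV cGN dVG ac'
    (lt_trans cy yd) db' L Vc Vd Vpos).
Qed.
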